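(* Suppose $n=k+1$ (so $k=n-1$), $r\ge2$. Then for every $\lambda\in S^{(n-1,r)}$ the polynomial $E_\lambda$ has no pole at $(\ast)$; the images in $V/I^{(n-1,r)}$ of the specializations of $\{E_\lambda:\lambda\in S^{(n-1,r)}\}$ form a $\mathbb K$-basis of $V/I^{(n-1,r)}$; and the quotient representation $V/I^{(n-1,r)}$ of $\mathcal H_n^{(n-1,r)}$ is irreducible.
   Context: Let $\tilde{\mathbb K}=\mathbb C(t^{1/2},q)$. The double affine Hecke algebra $\mathcal H_n$ of type $GL_n$ is the $\tilde{\mathbb K}$-algebra generated by $X_i^{\pm1},Y_i^{\pm1}$ ($1\le i\le n$), $T_j$ ($1\le j\le n-1$) with relations: $X$'s commute, $Y$'s commute; $(T_i-t^{1/2})(T_i+t^{-1/2})=0$; braid relations; $T_iX_iT_i=X_{i+1}$; $T_iX_j=X_jT_i$ ($j\ne i,i+1$); $T_i^{-1}Y_iT_i^{-1}=Y_{i+1}$; $T_iY_j=Y_jT_i$ ($j\ne i,i+1$); $Y_2^{-1}X_1Y_2X_1^{-1}=T_1^2$; $Y_i\tilde X=q\tilde XY_i$; $X_i\tilde Y=q^{-1}\tilde YX_i$ ($\tilde X=\prod X_i$, $\tilde Y=\prod Y_i$). It acts on $U=\tilde{\mathbb K}[x_1^{\pm1},\dots,x_n^{\pm1}]$ by $X_i\mapsto x_i$, $T_i\mapsto t^{1/2}s_i+\frac{t^{1/2}-t^{-1/2}}{x_i/x_{i+1}-1}(s_i-1)$, $Y_i\mapsto T_i\cdots T_{n-1}\omega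 T_1^{-1}\cdots T_{i-1}^{-1}$ ($s_i$ swaps $x_i,x_{i+1}$; $(\omega f)(x)=f(qx_n,x_1,\dots,x_{n-1})$). $P=\mathbb Z^n$; $\rho(\lambda)$ is the unique permutation of $(\frac{n-1}2,\dots,-\frac{n-1}2)$ with $\rho(\lambda)_i>\rho(\lambda)_j$ iff $\lambda_i>\lambda_j$ or ($\lambda_i=\lambda_j$, $i<j$); $\lambda\succ\mu$ iff $\lambda^+>\mu^+$ or ($\lambda^+=\mu^+$ and $\lambda>\mu$) in dominance order. $E_\lambda$ is the unique element of $U$ with $E_\lambda=x^\lambda+\sum_{\mu\prec\lambda}c_{\lambda\mu}x^\mu$ and $Y_iE_\lambda=t^{\rho(\lambda)_i}q^{\lambda_i}E_\lambda$. Fix $1\le k\le n-1$, $r\ge2$, $g=\gcd(k+1,r-1)$, $\tau=e^{2\pi\sqrt{-1}/(r-1)}$, specialization $(\ast)$: $t=u^{(r-1)/g}$, $q=\tau u^{-(k+1)/g}$. $\mathbb K$, $\mathcal H_n^{(k,r)}$, $V=\mathbb K[x_1^{\pm1},\dots,x_n^{\pm1}]$ are the images under $(\ast)$ of elements of $\tilde{\mathbb K}$, $\mathcal H_n$, $U$ regular at $(\ast)$. $Z^{(k,r)}$ is the set of $z\in\mathbb K^n$ for which there exist distinct $i_1,\dots,i_{k+1}$ and $s_1,\dots,s_k\in\mathbb Z_{\ge0}$ with $z_{i_{a+1}}=z_{i_a}tq^{s_a}$ ($1\le a\le k$), $\sum_as_a\le r-2$, and $i_a<i_{a+1}$ whenever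 $s_a=0$; $I^{(k,r)}=\{f\in V:f(z)=0\ \forall z\in Z^{(k,r)}\}$ (an $\mathcal H_n^{(k,r)}$-subrepresentation of $V$). $(i,j)$ is a neighborhood of type $(a,b)$ in $\lambda$ if $\rho(\lambda)_i-\rho(\lambda)_j=a-1$ and either $\lambda_i-\lambda_j\le b-1$, or $\lambda_i-\lambda_j=b$ and $j<i$. $S^{(k,r)}$ is the set of $\lambda\in P$ having a neighborhood of type $(k+1,r-1)$. *)

(* Defs.v *)
From HB Require Import structures.
From mathcomp Require Import all_boot all_algebra.
From mathcomp Require Import fraction.
From mathcomp Require Import finmap.
From mathcomp.multinomials Require Import monalg.
From mathcomp Require Import complex.
From mathcomp Require Import Rstruct.
From Stdlib Require Import Rdefinitions Raxioms Rtrigo_def Rtrigo1 ClassicalEpsilon.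

Set Implicit Arguments.
Unset Strict Implicit.
Unset Printing Implicit Defensive.

Import GRing.Theory.
Local Open Scope ring_scope.

Definition C : fieldType := Rdefinitions.R[i].

Definition tau (r : nat) : C :=
  Complex (cos (2 * PI / INR (r - 1)))%R (sin (2 * PI / INR (r - 1)))%R.

(* Ktilde = C(t^{1/2}, q) = fraction field of C[t^{1/2}][q].
   Inner polynomial variable: s = t^{1/2}; outer variable: q. *)
Definition Kt : fieldType := {fraction {poly {poly C}}}.
Definition sK : Kt := FracField.tofrac (polyC 'X).
Definition qK : Kt := FracField.tofrac 'X.

(* Ambient field of the specialization: L = C(w), w = u^{1/2}.  The field
   K (= "\mathbb K") is the subfield of L of images of regular elements. *)
Definition Lf : fieldType := {fraction {poly C}}.
Definition wL : Lf := FracField.tofrac 'X.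
Definition cL (c : C) : Lf := FracField.tofrac (c%:P).

(* specialization (star): t = u^{(r-1)/g}, q = tau u^{-(k+1)/g}, g = gcd(k+1,r-1);
   hence t^{1/2} |-> w^{(r-1)/g},  q |-> tau w^{-2(k+1)/g}. *)
Definition gg (k r : nat) : nat := gcdn k.+1 (r - 1).
Definition sL (k r : nat) : Lf := wL ^+ ((r - 1) %/ gg k r).
Definition qL (k r : nat) : Lf := cL (tau r) * wL ^- (2 * (k.+1 %/ gg k r)).

Definition ev1 (k r : nat) (p : {poly C}) : Lf :=
  \sum_(i < size p) cL p`_i * sL k r ^+ i.
Definition ev2 (k r : nat) (P : {poly {poly C}}) : Lf :=
  \sum_(j < size P) ev1 k r P`_j * qL k r ^+ j.

Definition is_spec (k r : nat) (x : Kt) (c : Lf) : Prop :=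
  exists a b : {poly {poly C}},
    x = FracField.tofrac a / FracField.tofrac b /\ ev2 k r b != 0 /\
    c = ev2 k r a / ev2 k r b.
Definition regular (k r : nat) (x : Kt) : Prop := exists c, is_spec k r x c.
Definition spec (k r : nat) (x : Kt) : Lf := epsilon (inhabits 0) (is_spec k r x).
Definition inK (k r : nat) (c : Lf) : Prop := exists x, is_spec k r x c.

(* Laurent polynomials F[x_1^{+-1},...,x_n^{+-1}] : finitely supported
   functions Z^n -> F (variables indexed 0-based by 'I_n). *)
Definition expo (n : nat) := {ffun 'I_n -> int}.
Definition LP (F : fieldType) (n : nat) := {malg F[expo n]}.

Section Operators.
Variables (F : fieldType) (n : nat).

Definition mono (a : expo n) : LP F n := mkmalgU a 1.

Definition linext (phi : expo n -> LP F n) (f : LP F n) : LP F n :=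
  \sum_(a <- msupp f) f@_a *: phi a.

Definition av (a : expo n) (j : nat) : int :=
  if insub j is Some m then a m else 0.

Definition ebump (a : expo n) (i : 'I_n) (d : int) : expo n :=
  [ffun m => if m == i then a m + d else a m].
Definition Xop (i : 'I_n) := linext (fun a => mono (ebump a i 1)).
Definition Xinv (i : 'I_n) := linext (fun a => mono (ebump a i (-1))).

Definition sidx (j : nat) (m : 'I_n) : 'I_n :=
  if val m == j then insubd m j.+1 else if val m == j.+1 then insubd m j else m.
Definition sw_expo (j : nat) (a : expo n) : expo n := [ffun m => a (sidx j m)].

Definition yshift (a : expo n) (j : nat) (m : int) : expo n :=
  [ffun p => if val p == j then a p + m
             else if val p == j.+1 then a p - m else a p].

(* divided difference  (s_j - 1)/(x_j/x_{j+1} - 1)  on the monomial x^a: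
   with d = a_j - a_{j+1} and y = x_j/x_{j+1}:
     d > 0 : - (y^{-1} + ... + y^{-d}) x^a
     d <= 0:   (1 + y + ... + y^{-d-1}) x^a                                *)
Definition Dmono (j : nat) (a : expo n) : LP F n :=
  let d := av a j - av a j.+1 in
  if 0 < d then - \sum_(m < absz d) mono (yshift a j (- (m.+1)%:Z))
  else \sum_(m < absz d) mono (yshift a j m%:Z).

(* T_{j+1} (paper indexing) acting on U, with s = t^{1/2} *)
Definition Top (s : F) (j : nat) : LP F n -> LP F n :=
  linext (fun a => s *: mono (sw_expo j a) + (s - s^-1) *: Dmono j a).
Definition Tinv (s : F) (j : nat) (f : LP F n) : LP F n :=
  Top s j f - (s - s^-1) *: f.

(* (omega f)(x) = f(q x_n, x_1, ..., x_{n-1}) and its inverse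
   (omega^{-1} f)(x) = f(x_2, ..., x_n, q^{-1} x_1). *)
Definition omega (q : F) : LP F n -> LP F n :=
  linext (fun a => q ^ (av a 0) *:
                   mono [ffun m : 'I_n => a (insubd m (modn (val m).+1 n))]).
Definition omegainv (q : F) : LP F n -> LP F n :=
  linext (fun a => q ^ (- av a n.-1) *:
                   mono [ffun m : 'I_n => a (insubd m (modn (val m + n.-1) n))]).

(* Y_{i+1} = T_{i+1} ... T_{n-1} omega T_1^{-1} ... T_i^{-1}  (paper indexing) *)
Definition Yop (s q : F) (i : 'I_n) (f : LP F n) : LP F n :=
  foldr (fun j g => Top s j g)
        (omega q (foldr (fun j g => Tinv s j g) f (iota 0 i)))
        (iota i (n.-1 - i)).
(* Y_{i+1}^{-1} = T_i ... T_1 omega^{-1} T_{n-1}^{-1} ... T_{i+1}^{-1} *)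
Definition Yinv (s q : F) (i : 'I_n) (f : LP F n) : LP F n :=
  foldr (fun j g => Top s j g)
        (omegainv q (foldr (fun j g => Tinv s j g) f (rev (iota i (n.-1 - i)))))
        (rev (iota 0 i)).

End Operators.

(* rho(lambda) : rho(lambda)_i = (n-1)/2 - rk lambda i, where rk lambda i is
   the number of j with lambda_j > lambda_i, or lambda_j = lambda_i and j < i. *)
Definition rk (n : nat) (lam : expo n) (i : 'I_n) : nat :=
  #|[pred j : 'I_n | (lam i < lam j) || ((lam j == lam i) && ltn (val j) (val i))]|.

(* Y-eigenvalue t^{rho(lambda)_i} q^{lambda_i} = s^{(n-1) - 2 rk} q^{lambda_i} *)
Definition eig (F : fieldType) (n : nat) (s q : F) (lam : expo n) (i : 'I_n) : F :=
  s ^ ((n.-1)%:Z - 2 * (rk lam i)%:Z) * q ^ (lam i).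

Definition psum (n : nat) (a : expo n) (m : nat) : int := \sum_(j < n | ltn j m) a j.
Definition dom_le (n : nat) (mu lam : expo n) : bool :=
  (psum mu n == psum lam n) && [forall m : 'I_n.+1, psum mu m <= psum lam m].
Definition dom_lt (n : nat) (mu lam : expo n) : bool := dom_le mu lam && (mu != lam).
Definition dplus (n : nat) (a : expo n) : expo n :=
  [ffun m : 'I_n => nth 0 (sort (fun x y : int => y <= x) (codom a)) m].
Definition prec (n : nat) (mu lam : expo n) : bool :=
  dom_lt (dplus mu) (dplus lam) || ((dplus mu == dplus lam) && dom_lt mu lam).

Definition isE (n : nat) (lam : expo n) (f : LP Kt n) : Prop :=
  f@_lam = 1 /\
  (forall mu, mu \in msupp f -> mu = lam \/ prec mu lam) /\
  (forall i : 'I_n, Yop sK qK i f = eig sK qK lam i *: f).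
Definition E (n : nat) (lam : expo n) : LP Kt n :=
  epsilon (inhabits 0) (isE lam).

Section Specialized.
Variables (k r n : nat).

Definition Ebar (lam : expo n) : LP Lf n :=
  [malg a in msupp (E lam) => spec k r ((E lam)@_a)].

Definition inV (f : LP Lf n) : Prop := forall a, inK k r f@_a.

Definition evalL (f : LP Lf n) (z : 'I_n -> Lf) : Lf :=
  \sum_(a <- msupp f) f@_a * \prod_(i < n) z i ^ (a i).

Definition inZ (z : 'I_n -> Lf) : Prop :=
  (forall i, inK k r (z i) /\ z i != 0) /\
  exists (idx : 'I_k.+1 -> 'I_n) (sa : 'I_k -> nat),
    injective idx /\ leq (\sum_(a < k) sa a) (r - 2) /\
    forall a : 'I_k,
      z (idx (lift ord0 a)) = z (idx (widen_ord (leqnSn k) a)) * sL k r ^+ 2 * qL k r ^+ sa a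
      /\ (sa a = 0%N -> ltn (idx (widen_ord (leqnSn k) a)) (idx (lift ord0 a))).

Definition inI (f : LP Lf n) : Prop := inV f /\ forall z, inZ z -> evalL f z = 0.

Definition inS (lam : expo n) : Prop :=
  exists i j : 'I_n,
    (rk lam j = rk lam i + k)%N /\
    ((lam i - lam j <= r%:Z - 2) \/ (lam i - lam j = r%:Z - 1 /\ ltn j i)).

(* W (a subset of V containing I) is the preimage of an
   H_n^{(k,r)}-subrepresentation of V/I *)
Definition subrep (W : LP Lf n -> Prop) : Prop :=
  (forall f, inI f -> W f) /\ (forall f, W f -> inV f) /\
  (forall f g, W f -> W g -> W (f + g)) /\
  (forall c f, inK k r c -> W f -> W (c *: f)) /\
  (forall (i : 'I_n) f, W f ->
      [/\ W (Xop i f), W (Xinv i f),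
          W (Yop (sL k r) (qL k r) i f) & W (Yinv (sL k r) (qL k r) i f)]) /\
  (forall (j : nat) f, ltn j.+1 n -> W f -> W (Top (sL k r) j f)).

Definition quotient_irreducible : Prop :=
  (exists f, inV f /\ ~ inI f) /\
  forall W, subrep W -> (forall f, W f -> inI f) \/ (forall f, inV f -> W f).

End Specialized.

(* Main.v *)
(* Under the specialization [s^(2a) q^b = 1] holds exactly for [(a, b)] in
   [Z (n, r - 1)], so two weights never share all their Y-eigenvalues. Hence the
   recursion for [E_lambda] along swaps and the affine rotation [pie] never meets
   a zero denominator, every [E_lambda] is regular, and the joint Y-spectrum on
   [V] is simple.

   Let [zpt c mu] be the point with coordinates [c / eig mu i]. Evaluation at
   these points is compatible with both recursions: swapping [j, j+1] costs the
   factor [s + icoef], which vanishes exactly on the wall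
   [lambda_(j+1) - lambda_j = r - 1] bounding S. Two inductions over the weights
   give [E_lambda (zpt c 0) <> 0] iff [lambda] is in S, and [E_lambda (zpt c mu) = 0]
   for [mu] in S and [lambda] outside S. The set Z consists of the points
   [zpt c mu] with [max mu - min mu <= r - 2], so [E_lambda] is in I for [lambda]
   outside S. The ideal I is Y-stable, so a combination of [E_lambda] in I has all
   its components in I, and evaluating at [zpt 1 0] gives independence. The
   K-span of all [E_lambda] is stable under the algebra, hence is V. Finally a
   subrepresentation not inside I contains some [E_lambda] with [lambda] in S, and
   one descends inside S to [E_0 = 1]. *)

(* What makes n = k + 1 tractable is that the relations between t and q have period n in the rank,
   while two ranks differ by at most n - 1. So no resonance reaches the denominators
   [eig (j+1) - eig j] of the intertwiners; it can only appear in numerators. The points [zpt c mu]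
   work because, at such a point, the divided difference in T_j has the same coefficients as the
   intertwiner that moves the weight mu. Statements about values at points can therefore be proved
   by the very induction on weights that builds the eigenvectors. The scalar c is there because Z is
   cut out by conditions on ratios of coordinates. The field K is only a predicate on [Lf], closed
   under the field operations: eigenvectors live over [Lf], and membership of their coefficients in
   K is tracked separately. Since [E] is chosen over [Kt] by epsilon, the recursion is run over [Kt]
   and [Lf] in parallel and [E] is identified by uniqueness. Relations between the operators are
   obtained by evaluation: at points with distinct nonzero coordinates they become identities of
   rational functions. *)
Require Import Defs.
From HB Require Import structures.
From mathcomp Require Import all_boot all_order all_algebra.
From mathcomp Require Import fraction finmap.
From mathcomp.multinomials Require Import monalg.
From mathcomp Require Import complex Rstruct.
From mathcomp Require Import zify ring.
From Stdlib Require Rdefinitions Raxioms RIneq Rtrigo_def Rtrigo1 Lra.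
From Stdlib Require ClassicalEpsilon Classical_Prop.

Set Implicit Arguments.
Unset Strict Implicit.
Unset Printing Implicit Defensive.

Import Order.TTheory GRing.Theory Num.Theory.
Local Open Scope fset_scope.
Local Open Scope ring_scope.

(** * Evaluation of Laurent polynomials *)

Section LinearExtension.
Variables (F : fieldType) (n : nat).
Implicit Types (f g : LP F n) (a : expo n) (phi : expo n -> LP F n).

Lemma linextEw phi (d : {fset expo n}) f : msupp f `<=` d ->
  linext phi f = \sum_(a <- d) f@_a *: phi a.
Proof.
move=> le; rewrite /linext (big_fset_incl _ le) // => x _ /mcoeff_outdom ->.
by rewrite scale0r.
Qed.

Lemma linext_is_linear phi : linear (linext phi).
Proof.
move=> c f g; set d := msupp f `|` msupp g.
have lf : msupp f `<=` d by exact: fsubsetUl.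
have lg : msupp g `<=` d by exact: fsubsetUr.
have lh : msupp (c *: f + g) `<=` d.
  apply: fsubset_trans (msuppD_le _ _) _.
  by apply: fsetSU; exact: msuppZ_le.
rewrite (linextEw phi lf) (linextEw phi lg) (linextEw phi lh).
rewrite scaler_sumr -big_split /=; apply: eq_bigr => a _.
by rewrite mcoeffD mcoeffZ scalerDl scalerA.
Qed.

HB.instance Definition _ phi :=
  GRing.isLinear.Build F (LP F n) (LP F n) _ (linext phi) (linext_is_linear phi).

Lemma linext_mono phi a : linext phi (mono F a) = phi a.
Proof.
rewrite /linext /mono msuppU oner_eq0 big_seq_fset1 mcoeffU eqxx mulr1n.
by rewrite scale1r.
Qed.

Lemma LP_monoE f : f = \sum_(a <- msupp f) f@_a *: mono F a.
Proof.
rewrite {1}(monalgE f); apply: eq_bigr => a _.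
apply/malgP => b; rewrite mcoeffZ !mcoeffU.
by case: eqP => _ /=; rewrite ?mulr1n ?mulr0n ?mulr1 ?mulr0.
Qed.

Lemma mcoeff_mono a b : (mono F a)@_b = (a == b)%:R.
Proof. by rewrite mcoeffU. Qed.

Lemma mcoeff_sum (I : Type) (r : seq I) (P : pred I) (G : I -> LP F n) b :
  (\sum_(i <- r | P i) G i)@_b = \sum_(i <- r | P i) (G i)@_b.
Proof. exact: (raddf_sum (mcoeff b)). Qed.

Definition monoval (z : 'I_n -> F) a : F := \prod_(i < n) z i ^ (a i).
Definition ev f (z : 'I_n -> F) : F := \sum_(a <- msupp f) f@_a * monoval z a.

Lemma evEw (d : {fset expo n}) f z : msupp f `<=` d ->
  ev f z = \sum_(a <- d) f@_a * monoval z a.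
Proof.
move=> le; rewrite /ev (big_fset_incl _ le) // => x _ /mcoeff_outdom ->.
by rewrite mul0r.
Qed.

Lemma ev_lin (c : F) f g z : ev (c *: f + g) z = c * ev f z + ev g z.
Proof.
set d := msupp f `|` msupp g.
have lf : msupp f `<=` d by exact: fsubsetUl.
have lg : msupp g `<=` d by exact: fsubsetUr.
have lh : msupp (c *: f + g) `<=` d.
  apply: fsubset_trans (msuppD_le _ _) _.
  by apply: fsetSU; exact: msuppZ_le.
rewrite (evEw z lf) (evEw z lg) (evEw z lh).
rewrite mulr_sumr -big_split /=; apply: eq_bigr => a _.
by rewrite mcoeffD mcoeffZ mulrDl mulrA.
Qed.

Lemma ev0 z : ev 0 z = 0.
Proof. by rewrite /ev msupp0 big_seq_fset0. Qed.
Lemma evZ c f z : ev (c *: f) z = c * ev f z.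
Proof. by rewrite -[_ *: _]addr0 ev_lin ev0 addr0. Qed.
Lemma evD f g z : ev (f + g) z = ev f z + ev g z.
Proof. by rewrite -{1}[f]scale1r ev_lin mul1r. Qed.
Lemma evN f z : ev (- f) z = - ev f z.
Proof. by rewrite -scaleN1r evZ mulN1r. Qed.
Lemma evB f g z : ev (f - g) z = ev f z - ev g z.
Proof. by rewrite evD evN. Qed.
Lemma ev_sum (I : Type) (r : seq I) (P : pred I) (G : I -> LP F n) z :
  ev (\sum_(i <- r | P i) G i) z = \sum_(i <- r | P i) ev (G i) z.
Proof.
by apply: (big_morph (fun f => ev f z)) => [f g|]; rewrite ?evD ?ev0.
Qed.

Lemma ev_mono a z : ev (mono F a) z = monoval z a.
Proof.
by rewrite /ev /mono msuppU oner_eq0 big_seq_fset1 mcoeffU eqxx mul1r.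
Qed.

Lemma ev_linext phi f z :
  ev (linext phi f) z = \sum_(a <- msupp f) f@_a * ev (phi a) z.
Proof. by rewrite /linext ev_sum; apply: eq_bigr => a _; rewrite evZ. Qed.

Lemma eq_ev f (z z' : 'I_n -> F) : z =1 z' -> ev f z = ev f z'.
Proof.
move=> e; apply: eq_bigr => a _; congr (_ * _).
by apply: eq_bigr => i _; rewrite e.
Qed.

End LinearExtension.

(** Base [M] digits are recovered one at a time by reduction modulo [M]; this makes Kronecker
    exponents injective. *)
Lemma digits_inj (n M : nat) (d e : nat -> nat) :
  (forall i, (d i < M)%N) -> (forall i, (e i < M)%N) ->
  (\sum_(i < n) d i * M ^ i = \sum_(i < n) e i * M ^ i)%N ->
  forall i, (i < n)%N -> d i = e i.
Proof.
elim: n d e => [//|n IH] d e hd he.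
have shift (u : nat -> nat) : (\sum_(i < n.+1) u i * M ^ i =
    (\sum_(i < n) u i.+1 * M ^ i) * M + u 0)%N.
  rewrite big_ord_recl expn0 muln1 addnC big_distrl /=; congr (_ + _)%N.
  by apply: eq_bigr => i _; rewrite /bump /= add1n expnSr mulnA.
rewrite !shift => eqs.
have M0 : (0 < M)%N by apply: leq_trans (hd 0%N).
have e0 : d 0%N = e 0%N.
  by have := congr1 (modn^~ M) eqs; rewrite !modnMDl !modn_small.
case=> [//|i] lt; apply: (IH (d \o S) (e \o S)) => //=.
by move/eqP: eqs; rewrite e0 eqn_add2r eqn_pmul2r // => /eqP.
Qed.

(* Kronecker substitution [z i = y ^ (M ^ i)] reduces the claim to univariate
   polynomials with infinitely many roots. *)
Lemma ev_eq0 (F : fieldType) (n : nat) (f : LP F n) :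
  (forall m, m.+1%:R != 0 :> F) ->
  (forall z, (forall i, z i != 0) -> injective z -> ev f z = 0) -> f = 0.
Proof.
move=> ch0 vanish.
have natI : injective (fun m : nat => m%:R : F).
  have key m p : (m <= p)%N -> m%:R = p%:R :> F -> m = p.
    move=> le; rewrite -(subnKC le) natrD => /eqP.
    rewrite -subr_eq0 opprD addNKr oppr_eq0.
    by case: (p - m)%N => [|u]; rewrite ?addn0 // (negPf (ch0 u)).
  move=> m p /= e; case: (leqP m p) => [/key|/ltnW /key] h; first exact: h.
  by rewrite h.
pose B := (\max_(a <- msupp f) \max_(i < n) `|a i|)%N.
have boundB a i : a \in msupp f -> (`|a i| <= B)%N.
  move=> ain; apply: leq_trans (leq_bigmax_seq _ ain isT).
  exact: (leq_bigmax i).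
(* Exponents shifted by [B] lie between 0 and 2B. The bound 2B + 1 would do for the digits, but [M]
   must be at least 2 even for B = 0, so that the powers [M ^ i] are distinct. *)
pose M := (2 * B + 2)%N.
pose code (a : expo n) : nat := (\sum_(i < n) `|(a i + B%:Z)%R| * M ^ i)%N.
have posB a i : a \in msupp f -> (`|(a i + B%:Z)%R|%N)%:Z = a i + B%:Z.
  by move=> /(boundB _ i) ?; lia.
have codeI : {in msupp f &, injective code}.
  move=> a b ain bin eqc; apply/ffunP => i.
  pose dg (c : expo n) (j : nat) := if insub j is Some i then `|(c i + B%:Z)%R|%N else 0%N.
  have dgE c (j : 'I_n) : dg c j = `|(c j + B%:Z)%R|%N.
    by rewrite /dg valK.
  have dgM c j : c \in msupp f -> (dg c j < M)%N.
    rewrite /dg /M => cin; case: insubP => [u _ _|_]; last by lia.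
    by move: (boundB _ u cin); move: (c u) => x; lia.
  have := digits_inj (fun j => dgM a j ain) (fun j => dgM b j bin).
  move=> /(_ n); rewrite (eq_bigr (fun i : 'I_n => `|(a i + B%:Z)%R| * M ^ i)%N); last first.
    by move=> j _; rewrite dgE.
  rewrite [X in _ = X -> _](eq_bigr (fun i : 'I_n => `|(b i + B%:Z)%R| * M ^ i)%N); last first.
    by move=> j _; rewrite dgE.
  move=> /(_ eqc i (ltn_ord i)); rewrite !dgE => e.
  have ea := posB a i ain; rewrite e (posB b i bin) in ea.
  by apply: (addIr B%:Z); rewrite ea.
pose p : {poly F} := \sum_(a <- msupp f) f@_a *: 'X^(code a).
have coefp a : a \in msupp f -> p`_(code a) = f@_a.
  move=> ain; rewrite coef_sum (big_fsetD1 a) //= coefZ coefXn eqxx mulr1.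
  rewrite big_seq big1 ?addr0 // => b; rewrite in_fsetD1 => /andP[nba bin].
  rewrite coefZ coefXn; case: eqP => [/codeI e|_]; last by rewrite mulr0.
  by rewrite e ?eqxx in nba.
(* Starting at 2 makes the coordinates, which are powers of this number, pairwise distinct as well
   as nonzero. *)
have rootp (m : nat) : p.[m.+2%:R] = 0.
  have y0 : m.+2%:R != 0 :> F by exact: ch0.
  pose z (i : 'I_n) : F := m.+2%:R ^+ (M ^ i).
  have z0 i : z i != 0 by rewrite expf_neq0.
  have zI : injective z.
    move=> i j; rewrite /z -!natrX => /natI /eqP.
    rewrite eqn_exp2l // eqn_exp2l ?/M; last by lia.
    by move=> /eqP /val_inj.
  have := vanish z z0 zI; rewrite /ev => h.
  (* The factor in front clears the negative exponents. *)
  suff -> : p.[m.+2%:R] = (\prod_(i < n) z i ^ B) * \sum_(a <- msupp f) f@_a * monoval z a.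
    by rewrite h mulr0.
  rewrite mulr_sumr horner_sum; apply: eq_big_seq => a ain.
  rewrite hornerZ hornerXn mulrCA; congr (_ * _).
  rewrite /monoval -big_split /= expr_sum; apply: eq_bigr => i _.
  rewrite -expfzDr // (addrC B%:Z) -posB // /z -exprnP -exprM; congr (_ ^+ _).
  by rewrite mulnC.
have p0 : p = 0.
  apply/eqP; apply: contraT => pn0.
  have := max_poly_roots pn0 (rs := [seq m.+2%:R | m <- iota 0 (size p)]).
  rewrite size_map size_iota ltnn; apply.
    by apply/allP => _ /mapP[m _ ->]; rewrite rootE rootp.
  by rewrite map_inj_uniq ?iota_uniq // => m1 m2 /natI [].
apply/malgP => a; rewrite mcoeff0.
case: (boolP (a \in msupp f)) => [ain|/mcoeff_outdom //].
by rewrite -coefp // p0 coef0.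
Qed.

(** * The operators in terms of values at points *)

Section Operators.
Variables (F : fieldType) (k : nat).
Local Notation n := k.+1.
Local Notation LP := (LP F n).
Local Notation expo := (expo n).
Implicit Types (f g : LP) (a : expo) (z : 'I_n -> F) (j : nat).

HB.instance Definition _ (s : F) j := GRing.isLinear.Build F LP LP _ (Top s j)
  (linext_is_linear _).
HB.instance Definition _ (q : F) := GRing.isLinear.Build F LP LP _ (@omega F n q)
  (linext_is_linear _).
HB.instance Definition _ (q : F) := GRing.isLinear.Build F LP LP _ (@omegainv F n q)
  (linext_is_linear _).
HB.instance Definition _ (i : 'I_n) := GRing.isLinear.Build F LP LP _ (@Xop F n i)
  (linext_is_linear _).
HB.instance Definition _ (i : 'I_n) := GRing.isLinear.Build F LP LP _ (@Xinv F n i)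
  (linext_is_linear _).

Lemma Tinv_is_linear (s : F) j : linear (@Tinv F n s j).
Proof.
move=> c f g; rewrite /Tinv linearP scalerDr opprD addrACA; congr (_ + _).
by rewrite scalerBr !scalerA mulrC.
Qed.
HB.instance Definition _ (s : F) j := GRing.isLinear.Build F LP LP _ (Tinv s j)
  (Tinv_is_linear s j).

Lemma val_sidx j (m : 'I_n) : (j < k)%N -> val (sidx j m) =
  if val m == j then j.+1 else if val m == j.+1 then j else val m.
Proof.
move=> hj; rewrite /sidx; case: eqP => [mj|_].
  by rewrite val_insubd ltnS hj.
by case: eqP => [mj|//]; rewrite val_insubd (leq_trans hj (leqnSn _)).
Qed.

Lemma sidxK j : (j < k)%N -> involutive (@sidx n j).
Proof.
move=> hj m; apply: val_inj; rewrite !val_sidx //.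
by do ?case: eqP; lia.
Qed.

Lemma sidx_far j (m : 'I_n) : val m != j -> val m != j.+1 -> sidx j m = m.
Proof. by rewrite /sidx => /negPf -> /negPf ->. Qed.

Lemma sidx_l j (m : 'I_n) : (j < k)%N -> val m = j -> sidx j m = inord j.+1.
Proof.
move=> hj e; apply: val_inj; rewrite val_sidx // e eqxx /= inordK //.
Qed.

Lemma sidx_r j (m : 'I_n) : (j < k)%N -> val m = j.+1 -> sidx j m = inord j.
Proof.
move=> hj e; apply: val_inj; rewrite val_sidx // e eqxx /= inordK ?ltnS; last by lia.
by case: eqP => //; lia.
Qed.

Lemma avE a j : (j < n)%N -> av a j = a (inord j).
Proof.
move=> hj; rewrite /av insubT; congr (a _); apply: val_inj.
by rewrite /= inordK.
Qed.

Lemma monoval_sw z j a : (j < k)%N ->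
  monoval z (sw_expo j a) = monoval (z \o sidx j) a.
Proof.
move=> hj; rewrite /monoval (reindex_inj (can_inj (sidxK hj))) /=.
by apply: eq_bigr => i _; rewrite ffunE sidxK.
Qed.

Lemma monoval_neq0 z a : (forall i, z i != 0) -> monoval z a != 0.
Proof. by move=> z0; apply/prodf_neq0 => i _; rewrite expfz_neq0. Qed.

Definition yratio z j : F := z (inord j) / z (inord j.+1).

Lemma val_inord j : (j < n)%N -> val (inord j : 'I_n) = j.
Proof. exact: inordK. Qed.

Lemma inord_neqS j : (j < k)%N -> inord j.+1 != inord j :> 'I_n.
Proof. by move=> hj; apply/eqP => /(congr1 val); rewrite !val_inord ?ltnS; lia. Qed.

Lemma monoval_yshift z j a m : (j < k)%N -> (forall i, z i != 0) ->
  monoval z (yshift a j m) = yratio z j ^ m * monoval z a.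
Proof.
move=> hj z0; have jn : (j < n)%N by lia.
rewrite /monoval (bigD1 (inord j)) //= (bigD1 (inord j.+1)) ?inord_neqS //=.
rewrite [in RHS](bigD1 (inord j)) //= [in RHS](bigD1 (inord j.+1)) ?inord_neqS //=.
rewrite !ffunE !val_inord // eqxx (_ : j.+1 == j = false) ?eqxx; last by lia.
rewrite (eq_bigr (fun i => z i ^ a i)); last first.
  move=> i /andP[h1 h2]; rewrite ffunE.
  move: h1 h2; rewrite -!val_eqE !val_inord // => /negPf -> /negPf -> //.
rewrite !expfzDr // /yratio expfzMl exprz_inv; ring.
Qed.

Lemma monoval_sw_yratio z j a : (j < k)%N -> (forall i, z i != 0) ->
  monoval (z \o sidx j) a = yratio z j ^ (a (inord j.+1) - a (inord j)) * monoval z a.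
Proof.
move=> hj z0; have jn : (j < n)%N by lia.
rewrite -monoval_yshift // -monoval_sw //; congr monoval.
apply/ffunP => p; rewrite !ffunE; case: eqP => [e|e1].
  have -> : p = inord j by apply: val_inj; rewrite val_inord.
  rewrite sidx_l ?val_inord //; ring.
case: eqP => [e|e2]; last by rewrite sidx_far //; apply/eqP.
have -> : p = inord j.+1 by apply: val_inj; rewrite val_inord.
rewrite sidx_r ?val_inord //; ring.
Qed.

(** Summing the geometric series in [yratio z j] turns the expansion [Dmono] back into the divided
    difference, for exponents of either sign. *)
Lemma ev_Dmono z j a : (j < k)%N -> (forall i, z i != 0) -> yratio z j != 1 ->
  ev (Dmono F j a) z = (monoval (z \o sidx j) a - monoval z a) / (yratio z j - 1).
Proof.
move=> hj z0; set y := yratio z j => y1.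
have y0 : y != 0 by rewrite mulf_neq0 ?invr_eq0.
rewrite monoval_sw_yratio // -/y /Dmono !avE //; last by lia.
set A := a (inord j); set B := a (inord j.+1).
have y1' : y - 1 != 0 by rewrite subr_eq0.
have geo (m : nat) : \sum_(i < m) y ^+ i = (y ^+ m - 1) / (y - 1).
  by rewrite subrX1 mulrC mulKf.
case: ifPn => [pos|npos].
  have [D eD] : exists D : nat, A - B = D%:Z by exists `|A - B|%N; lia.
  rewrite eD absz_nat (_ : B - A = - D%:Z); last by rewrite -eD opprB.
  rewrite evN ev_sum.
  rewrite (eq_bigr (fun i : 'I_D => y ^ (- (i.+1)%:Z) * monoval z a)); last first.
    by move=> i _; rewrite ev_mono monoval_yshift.
  rewrite -mulr_suml.
  have -> : \sum_(i < D) y ^ (- (i.+1)%:Z) = y ^ (- D%:Z) * \sum_(i < D) y ^+ i.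
    rewrite mulr_sumr (reindex_inj rev_ord_inj) /=; apply: eq_bigr => i _.
    rewrite -[y ^+ i]/(y ^ (i : nat)%:Z) -expfzDr //; congr (_ ^ _).
    by have := ltn_ord i; lia.
  rewrite geo -exprnN; field.
  by rewrite expf_neq0 ?y1'.
have [D eD] : exists D : nat, B - A = D%:Z by exists `|B - A|%N; lia.
rewrite -opprB eD abszN absz_nat ev_sum.
rewrite (eq_bigr (fun i : 'I_D => y ^+ i * monoval z a)); last first.
  by move=> i _; rewrite ev_mono monoval_yshift.
rewrite -mulr_suml geo -[y ^ D]/(y ^+ D); field.
by rewrite y1'.
Qed.

Lemma ev_Top s j f z : (j < k)%N -> (forall i, z i != 0) -> yratio z j != 1 ->
  ev (Top s j f) z = s * ev f (z \o sidx j) +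
    (s - s^-1) / (yratio z j - 1) * (ev f (z \o sidx j) - ev f z).
Proof.
move=> hj z0 y1; rewrite /Top ev_linext [ev f (_ \o _)]/ev [ev f z]/ev -sumrB !mulr_sumr -big_split /=.
apply: eq_bigr => a _; rewrite evD !evZ ev_mono monoval_sw // ev_Dmono //; ring.
Qed.

Definition osucc (m : 'I_n) : 'I_n := insubd m (m.+1 %% n)%N.
Definition opred (m : 'I_n) : 'I_n := insubd m ((m + k) %% n)%N.

Lemma val_osucc m : val (osucc m) = if val m == k then 0%N else m.+1.
Proof.
rewrite val_insubd ltn_mod /=; case: eqP => [->|ne]; first by rewrite modnn.
by rewrite modn_small //; have := ltn_ord m; lia.
Qed.
Lemma val_opred m : val (opred m) = if val m == 0 then k else (val m).-1.
Proof.
rewrite val_insubd ltn_mod /=; case: eqP => [->|ne]; first by rewrite add0n modn_small.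
by rewrite (_ : (m + k = m.-1 + n)%N) ?modnDr ?modn_small //; have := ltn_ord m; lia.
Qed.
Lemma osuccK : cancel osucc opred.
Proof.
move=> m; apply: val_inj; rewrite val_opred !val_osucc.
by case: (altP (val m =P k)).
Qed.
Lemma opredK : cancel opred osucc.
Proof.
move=> m; apply: val_inj; rewrite val_osucc !val_opred.
have : (val m < n)%N := ltn_ord m; move: (val m) => x hx; do ?case: eqP; lia.
Qed.

(** The substitution dual to [omega]: it moves the point instead of the polynomial. [omi] plays the
    same part for [omegainv]. *)
Definition om (q : F) z (i : 'I_n) : F := (if val i == 0 then q else 1) * z (opred i).
Definition omi (q : F) z (i : 'I_n) : F := (if val i == k then q^-1 else 1) * z (osucc i).

Lemma omK q z : q != 0 -> omi q (om q z) =1 z.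
Proof.
move=> q0 i; rewrite /omi /om osuccK val_osucc.
by case: eqP => [|_] /=; rewrite ?mulKf // !mul1r.
Qed.

Lemma omiK q z : q != 0 -> om q (omi q z) =1 z.
Proof.
move=> q0 i; rewrite /omi /om opredK val_opred.
case: (altP (val i =P 0%N)) => [_|h]; first by rewrite eqxx mulVKf.
case: eqP => [e|_]; last by rewrite !mul1r.
by have : (val i < n)%N := ltn_ord i; move: h e; move: (val i) => x; lia.
Qed.

Lemma ev_omega q f z : ev (omega q f) z = ev f (om q z).
Proof.
rewrite /omega ev_linext; apply: eq_bigr => a _; congr (_ * _).
rewrite evZ ev_mono avE // (_ : inord 0 = ord0); last by apply: val_inj; rewrite /= inordK.
have -> : monoval (om q z) a = q ^ a ord0 * \prod_i z (opred i) ^ a i.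
  rewrite /monoval (eq_bigr (fun i => (if i == ord0 then q ^ a ord0 else 1) * z (opred i) ^ a i)).
    by rewrite big_split /= -big_mkcond big_pred1_eq.
  move=> i _; rewrite /om expfzMl; case: (altP (i =P ord0)) => [->|ne] /=; first by [].
  case: eqP => e; last by rewrite exp1rz.
  by case/eqP: ne; apply: val_inj.
congr (_ * _); rewrite /monoval.
rewrite (reindex_inj (can_inj opredK)) /=; apply: eq_bigr => i _.
by rewrite ffunE; congr (_ ^ a _); apply: opredK.
Qed.

Lemma ev_omegainv q f z : ev (omegainv q f) z = ev f (omi q z).
Proof.
rewrite /omegainv ev_linext; apply: eq_bigr => a _; congr (_ * _).
rewrite evZ ev_mono avE // (_ : inord _ = ord_max); last by apply: val_inj; rewrite /= inordK.
have -> : monoval (omi q z) a = q ^ (- a ord_max) * \prod_i z (osucc i) ^ a i.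
  rewrite /monoval (eq_bigr (fun i => (if i == ord_max then q ^ (- a ord_max) else 1) * z (osucc i) ^ a i)).
    by rewrite big_split /= -big_mkcond big_pred1_eq.
  move=> i _; rewrite /omi expfzMl; case: (altP (i =P ord_max)) => [->|ne] /=.
    by rewrite eqxx exprz_inv.
  case: eqP => e; last by rewrite exp1rz.
  by case/eqP: ne; apply: val_inj.
congr (_ * _); rewrite /monoval.
rewrite (reindex_inj (can_inj osuccK)) /=; apply: eq_bigr => i _.
by rewrite ffunE; congr (_ ^ a _); apply: osuccK.
Qed.

Lemma monoval_bump z a i d : z i != 0 ->
  monoval z (ebump a i d) = z i ^ d * monoval z a.
Proof.
move=> z0; rewrite /monoval (bigD1 i) //= [in RHS](bigD1 i) //= ffunE eqxx.
rewrite expfzDr // [_ * z i ^ d]mulrC mulrA; congr (_ * _).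
by apply: eq_bigr => j /negPf h; rewrite ffunE h.
Qed.

Lemma ev_Xop i f z : z i != 0 -> ev (Xop i f) z = z i * ev f z.
Proof.
move=> z0; rewrite /Xop ev_linext mulr_sumr; apply: eq_bigr => a _.
by rewrite ev_mono monoval_bump // expr1z mulrCA.
Qed.

Lemma ev_Xinv i f z : z i != 0 -> ev (Xinv i f) z = (z i)^-1 * ev f z.
Proof.
move=> z0; rewrite /Xinv ev_linext mulr_sumr; apply: eq_bigr => a _.
by rewrite ev_mono monoval_bump // exprN1 mulrCA.
Qed.

Lemma Dmono_eq j a : (j < k)%N -> av a j = av a j.+1 -> Dmono F j a = 0.
Proof. by move=> hj e; rewrite /Dmono e subrr ltxx absz0 big_ord0. Qed.

End Operators.

(** * Relations of the polynomial representation *)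

Section HeckeRelations.
Variables (F : fieldType) (k : nat).
Local Notation n := k.+1.
Local Notation LP := (LP F n).
Local Notation expo := (expo n).
Implicit Types (f g : LP) (a : expo) (z : 'I_n -> F) (i j : nat).
Variables (s : F).
Hypothesis ch0 : forall m, m.+1%:R != 0 :> F.
Hypothesis s0 : s != 0.

Local Opaque Top ev omega omegainv Xop Xinv.

Definition generic z := (forall i : 'I_n, z i != 0) /\ injective z.

(** At generic points the denominators of all [Top s j] are nonzero, so an operator identity reduces
    to an identity of rational functions that [field] can decide. *)
Lemma LP_ext f g : (forall z, generic z -> ev f z = ev g z) -> f = g.
Proof.
move=> h; apply/eqP; rewrite -subr_eq0; apply/eqP; apply: ev_eq0 => // z z0 zI.
by rewrite evB h ?subrr.
Qed.

Lemma generic_sidx z j : (j < k)%N -> generic z -> generic (z \o sidx j).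
Proof.
move=> hj [z0 zI]; split=> [i|]; first exact: z0.
by apply: inj_comp zI _; apply: can_inj (sidxK hj).
Qed.

Lemma generic_sub z i j : (i < n)%N -> (j < n)%N -> i != j -> generic z ->
  z (inord i) - z (inord j) != 0.
Proof.
move=> hi hj ij [_ zI]; rewrite subr_eq0; apply: contraNneq ij => /zI /(congr1 val).
by rewrite !val_inord // => ->.
Qed.

Lemma yratio_neq1 z j : (j < k)%N -> generic z -> yratio z j != 1.
Proof.
move=> hj gz; rewrite /yratio -subr_eq0.
have z1 : z (inord j.+1) != 0 by apply: gz.1.
rewrite -[X in _ - X](divff z1) -mulrBl mulf_neq0 ?invr_eq0 //.
by apply: generic_sub => //; lia.
Qed.

Lemma ev_Top_gen j f z : (j < k)%N -> generic z ->
  ev (Top s j f) z = s * ev f (z \o sidx j) +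
    (s - s^-1) * z (inord j.+1) / (z (inord j) - z (inord j.+1))
     * (ev f (z \o sidx j) - ev f z).
Proof.
move=> hj gz; rewrite ev_Top ?yratio_neq1 ?gz.1 //; last by apply: gz.1.
congr (_ + _ * _); rewrite /yratio; field.
by rewrite s0 gz.1 generic_sub //=; lia.
Qed.

Lemma sidxL j : (j < k)%N -> sidx j (inord j) = inord j.+1 :> 'I_n.
Proof. by move=> hj; rewrite sidx_l ?val_inord //; lia. Qed.
Lemma sidxR j : (j < k)%N -> sidx j (inord j.+1) = inord j :> 'I_n.
Proof. by move=> hj; rewrite sidx_r ?val_inord //; lia. Qed.
Lemma sidxF j i : (i < n)%N -> i != j -> i != j.+1 -> sidx j (inord i) = inord i :> 'I_n.
Proof. by move=> hi h1 h2; rewrite sidx_far // val_inord. Qed.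

Lemma Hecke j f : (j < k)%N ->
  Top s j (Top s j f) = (s - s^-1) *: Top s j f + f.
Proof.
move=> hj; apply: LP_ext => z gz.
have gz' := generic_sidx hj gz.
rewrite evD evZ !ev_Top_gen //= sidxL // sidxR //.
rewrite (@eq_ev _ _ f ((z \o sidx j) \o sidx j) z); last by move=> i /=; rewrite sidxK.
have d0 : z (inord j) - z (inord j.+1) != 0 by apply: generic_sub => //; lia.
field; rewrite s0 d0 -opprB oppr_eq0 d0 //.
Qed.

Lemma TinvK j f : (j < k)%N -> Tinv s j (Top s j f) = f.
Proof. by move=> hj; rewrite /Tinv Hecke // addrC addKr. Qed.

Lemma TopK j f : (j < k)%N -> Top s j (Tinv s j f) = f.
Proof. by move=> hj; rewrite /Tinv linearB linearZ /= Hecke // addrC addKr. Qed.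

Lemma braid j f : (j.+1 < k)%N ->
  Top s j (Top s j.+1 (Top s j f)) = Top s j.+1 (Top s j (Top s j.+1 f)).
Proof.
move=> hj; have hj' : (j < k)%N by lia.
apply: LP_ext => z gz.
have g0 := generic_sidx hj' gz; have g1 := generic_sidx hj gz.
have g01 := generic_sidx hj g0; have g10 := generic_sidx hj' g1.
have := @ev_Top_gen j.+1 _ _ hj; have := @ev_Top_gen j _ _ hj'.
move: (Top s j) (Top s j.+1) => A B eA eB.
rewrite !(eA, eB) //.
have E00 : sidx j (inord j) = inord j.+1 :> 'I_n by exact: sidxL.
have E01 : sidx j (inord j.+1) = inord j :> 'I_n by exact: sidxR.
have E02 : sidx j (inord j.+2) = inord j.+2 :> 'I_n by apply: sidxF; lia.
have E10 : sidx j.+1 (inord j) = inord j :> 'I_n by apply: sidxF; lia.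
have E11 : sidx j.+1 (inord j.+1) = inord j.+2 :> 'I_n by exact: sidxL.
have E12 : sidx j.+1 (inord j.+2) = inord j.+1 :> 'I_n by exact: sidxR.
rewrite /= !(E00, E01, E02, E10, E11, E12).
(* With these rules and the braid relation [br] for transpositions, every evaluation point becomes
   one of six permutations of [z]. *)
have ss m (hm : (m < k)%N) (u : 'I_n -> F) : ev f ((u \o sidx m) \o sidx m) = ev f u.
  by apply: eq_ev => i /=; rewrite sidxK.
have ss2 m m' (hm : (m < k)%N) (u : 'I_n -> F) :
    ev f (((u \o sidx m) \o sidx m) \o sidx m') = ev f (u \o sidx m').
  by apply: eq_ev => i /=; rewrite sidxK.
have br : ev f (((z \o sidx j) \o sidx j.+1) \o sidx j)
        = ev f (((z \o sidx j.+1) \o sidx j) \o sidx j.+1).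
  apply: eq_ev => i /=; congr (z _).
  have ne m : (m < n)%N -> i != inord m -> val i != m.
    by move=> hm; apply: contraNneq => <-; rewrite inord_val.
  have [->|/ne n0] := eqVneq i (inord j); first by rewrite !(E00, E01, E02, E10, E11, E12).
  have [->|/ne n1] := eqVneq i (inord j.+1); first by rewrite !(E00, E01, E02, E10, E11, E12).
  have [->|/ne n2] := eqVneq i (inord j.+2); first by rewrite !(E00, E01, E02, E10, E11, E12).
  by rewrite !(@sidx_far _ _ i) ?n0 ?n1 ?n2 //; lia.
rewrite br ?(ss2 _ _ hj) ?(ss2 _ _ hj') ?(ss _ hj) ?(ss _ hj').
have d01 : z (inord j) - z (inord j.+1) != 0 by apply: generic_sub => //; lia.
have d02 : z (inord j) - z (inord j.+2) != 0 by apply: generic_sub => //; lia.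
have d12 : z (inord j.+1) - z (inord j.+2) != 0 by apply: generic_sub => //; lia.
move: d01 d02 d12.
move: (z (inord j)) (z (inord j.+1)) (z (inord j.+2)) => z0 z1 z2 d01 d02 d12.
(* The values of [f] at the six permuted points are now independent unknowns. *)
move: (ev f (_ \o _ \o _)) (ev f (_ \o _ \o _)) (ev f (_ \o _ \o _)) (ev f (_ \o _)) (ev f (_ \o _)) (ev f z).
move=> v1 v2 v3 v4 v5 v6.
have d10 : z1 - z0 != 0 by rewrite -opprB oppr_eq0.
have d20 : z2 - z0 != 0 by rewrite -opprB oppr_eq0.
have d21 : z2 - z1 != 0 by rewrite -opprB oppr_eq0.
field.
by rewrite ?s0 ?d01 ?d02 ?d12 ?d10 ?d20 ?d21.
Qed.

Lemma Top_comm i j f : (i.+1 < j)%N -> (j < k)%N ->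
  Top s i (Top s j f) = Top s j (Top s i f).
Proof.
move=> hij hj; have hi : (i < k)%N by lia.
apply: LP_ext => z gz; have gi := generic_sidx hi gz; have gj := generic_sidx hj gz.
have eA := @ev_Top_gen i _ _ hi; have eB := @ev_Top_gen j _ _ hj.
move: (Top s i) (Top s j) eA eB => A B eA eB.
rewrite !(eA, eB) //=.
rewrite !(@sidxF i j, @sidxF i j.+1, @sidxF j i, @sidxF j i.+1) //; try lia.
rewrite (@eq_ev _ _ f ((z \o sidx i) \o sidx j) ((z \o sidx j) \o sidx i)); last first.
  move=> m /=; congr (z _); apply: val_inj; rewrite !val_sidx //.
  move: (val m) => x; have [->|n0] := eqVneq x i; last have [->|n1] := eqVneq x i.+1;
    do ?case: eqP; lia.
have di : z (inord i) - z (inord i.+1) != 0 by apply: generic_sub => //; lia.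
have dj : z (inord j) - z (inord j.+1) != 0 by apply: generic_sub => //; lia.
by field; rewrite s0 di dj.
Qed.

Lemma ev_Xop_gen (i : 'I_n) f z : generic z -> ev (Xop i f) z = z i * ev f z.
Proof. by move=> gz; apply: ev_Xop; apply: gz.1. Qed.

Lemma TXT j f : (j < k)%N ->
  Top s j (Xop (inord j) (Top s j f)) = Xop (inord j.+1) f.
Proof.
move=> hj; apply: LP_ext => z gz; have gz' := generic_sidx hj gz.
have eA := @ev_Top_gen j _ _ hj; move: (Top s j) eA => A eA.
rewrite (ev_Xop_gen _ _ gz) !eA // !ev_Xop_gen // !eA //= sidxL // sidxR //.
rewrite (@eq_ev _ _ f ((z \o sidx j) \o sidx j) z); last by move=> i /=; rewrite sidxK.
have d0 : z (inord j) - z (inord j.+1) != 0 by apply: generic_sub => //; lia.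
by field; rewrite s0 d0 -opprB oppr_eq0 d0.
Qed.

Lemma Xop_Top i j f : (j < k)%N -> (i < n)%N -> i != j -> i != j.+1 ->
  Xop (inord i) (Top s j f) = Top s j (Xop (inord i) f).
Proof.
move=> hj hi h1 h2; apply: LP_ext => z gz; have gz' := generic_sidx hj gz.
have eA := @ev_Top_gen j _ _ hj; move: (Top s j) eA => A eA.
rewrite (ev_Xop_gen _ _ gz) !eA // !ev_Xop_gen //= sidxF //; ring.
Qed.

Variables (q : F).
Hypothesis q0 : q != 0.

Lemma opredS j : (j < k)%N -> opred (inord j.+1) = inord j :> 'I_n.
Proof.
by move=> hj; apply: val_inj; rewrite val_opred !val_inord //=; lia.
Qed.
Lemma opred0 : opred (inord 0) = inord k :> 'I_n.
Proof. by apply: val_inj; rewrite val_opred !val_inord. Qed.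

Lemma om_sidx z j : (j.+1 < k)%N -> om q z \o sidx j.+1 =1 om q (z \o sidx j).
Proof.
move=> hj i; rewrite /om /comp.
have -> : (val (sidx j.+1 i) == 0%N) = (val i == 0%N).
  by rewrite val_sidx //; move: (val i) => x; do ?case: eqP; lia.
congr (_ * z _); apply: val_inj; rewrite !(val_sidx, val_opred) //; last by lia.
have : (val i < n)%N := ltn_ord i; move: (val i) => x hx; do ?case: eqP; lia.
Qed.

(** A version for points [om q z], which need not be generic: the coordinate multiplied by q may
    meet another one. Only the denominator that occurs is assumed nonzero. *)
Lemma ev_Top_z j f z : (j < k)%N -> (forall i : 'I_n, z i != 0) ->
  z (inord j) - z (inord j.+1) != 0 ->
  ev (Top s j f) z = s * ev f (z \o sidx j) +
    (s - s^-1) * z (inord j.+1) / (z (inord j) - z (inord j.+1))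
     * (ev f (z \o sidx j) - ev f z).
Proof.
move=> hj z0 d0; rewrite ev_Top //.
  by congr (_ + _ * _); rewrite /yratio; field; rewrite s0 z0 d0.
rewrite /yratio -subr_eq0 -[X in _ - X](divff (z0 (inord j.+1))) -mulrBl.
by rewrite mulf_neq0 ?invr_eq0.
Qed.

Lemma om_neq0 z : (forall i : 'I_n, z i != 0) -> forall i : 'I_n, om q z i != 0.
Proof. by move=> z0 i; rewrite /om mulf_neq0 //; case: ifP; rewrite ?oner_eq0. Qed.

Lemma omega_Top j f : (j.+1 < k)%N ->
  omega q (Top s j.+1 f) = Top s j (omega q f).
Proof.
move=> hj; have hj' : (j < k)%N by lia.
apply: LP_ext => z gz.
have o1 : om q z (inord j.+1) = z (inord j).
  by rewrite /om opredS // val_inord ?mul1r //; lia.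
have o2 : om q z (inord j.+2) = z (inord j.+1).
  by rewrite /om opredS // val_inord ?mul1r //; lia.
have d0 : z (inord j) - z (inord j.+1) != 0 by apply: generic_sub => //; lia.
have d0' : om q z (inord j.+1) - om q z (inord j.+2) != 0 by rewrite o1 o2.
rewrite ev_omega; apply: etrans (ev_Top_z f hj (om_neq0 gz.1) d0') _.
apply/esym/(etrans (ev_Top_gen (omega q f) hj' gz)).
by rewrite !ev_omega (eq_ev f (om_sidx z hj)) o1 o2.
Qed.

(** Conjugating the first generator by [omega] once gives the affine generator, which is not among
    the [Top s j]; conjugating twice lands on the last one. *)
Lemma omega2_Top f : (0 < k)%N ->
  omega q (omega q (Top s 0 f)) = Top s k.-1 (omega q (omega q f)).
Proof.
move=> k0; have hj : (k.-1 < k)%N by lia.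
apply: LP_ext => z gz.
have kk : k.-1.+1 = k by lia.
have d0 : z (inord k.-1) - z (inord k.-1.+1) != 0 by apply: generic_sub => //; lia.
have o0 : om q (om q z) (inord 0) = q * z (inord k.-1).
  rewrite /om opred0 !val_inord //=.
  have -> : opred (inord k) = inord k.-1 :> 'I_n.
    by apply: val_inj; rewrite val_opred !val_inord //; do ?case: eqP; lia.
  by case: eqP; rewrite ?mul1r //; lia.
have o1 : om q (om q z) (inord 1) = q * z (inord k.-1.+1).
  rewrite kk /om opredS // opred0 !val_inord //= mul1r //.
have n0 := om_neq0 (om_neq0 gz.1).
have d0' : om q (om q z) (inord 0) - om q (om q z) (inord 1) != 0.
  by rewrite o0 o1 -mulrBr mulf_neq0.
rewrite !ev_omega; apply: etrans (ev_Top_z f k0 n0 d0') _.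
apply/esym/(etrans (ev_Top_gen _ hj gz)); rewrite !ev_omega o0 o1.
have -> : ev f (om q (om q z) \o sidx 0) = ev f (om q (om q (z \o sidx k.-1))).
  apply: eq_ev => i; rewrite /om /comp !mulrA; congr (_ * z _); last first.
    apply: val_inj; rewrite !(val_sidx, val_opred) //.
    have : (val i < n)%N := ltn_ord i; case: (val i) => [|[|x]] hx /=; by do ?case: eqP; lia.
  have hi : (val i < n)%N := ltn_ord i.
  rewrite !(val_sidx, val_opred) //; move: (val i) hi => x hx.
  have kn0 : (k == 0%N) = false by lia.
  by case: x hx => [|[|x]] hx; rewrite //= ?kn0 ?mulr1 ?mul1r.
by field; rewrite s0 d0 -mulrBr mulf_neq0.
Qed.

Lemma omega_Xop j f : (j < k)%N ->
  omega q (Xop (inord j.+1) f) = Xop (inord j) (omega q f).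
Proof.
move=> hj; apply: LP_ext => z gz.
rewrite ev_omega; apply: etrans (ev_Xop _ (om_neq0 gz.1 _)) _.
apply/esym/(etrans (ev_Xop_gen _ _ gz)); rewrite ev_omega.
by rewrite /om opredS // val_inord // mul1r.
Qed.

Lemma omega_Xop0 f :
  omega q (Xop (inord 0) f) = q *: Xop (inord k) (omega q f).
Proof.
apply: LP_ext => z gz.
rewrite evZ ev_omega; apply: etrans (ev_Xop _ (om_neq0 gz.1 _)) _.
apply/esym/(etrans (congr1 _ (ev_Xop_gen _ _ gz))); rewrite ev_omega.
by rewrite /om opred0 // val_inord //= mulrA.
Qed.

Lemma omegaK f : omegainv q (omega q f) = f.
Proof.
apply: LP_ext => z _; rewrite ev_omegainv ev_omega; apply: eq_ev.
exact: omiK.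
Qed.

Lemma omegainvK f : omega q (omegainv q f) = f.
Proof.
apply: LP_ext => z _; rewrite ev_omega ev_omegainv; apply: eq_ev.
exact: omK.
Qed.

Lemma XopK (i : 'I_n) f : Xinv i (Xop i f) = f.
Proof.
by apply: LP_ext => z gz; rewrite ev_Xinv ?ev_Xop ?mulKf ?gz.1 //; apply: gz.1.
Qed.

Lemma XinvK (i : 'I_n) f : Xop i (Xinv i f) = f.
Proof.
by apply: LP_ext => z gz; rewrite ev_Xop ?ev_Xinv ?mulVKf ?gz.1 //; apply: gz.1.
Qed.

End HeckeRelations.

Lemma iota_cat m u : iota m u.+1 = iota m u ++ [:: (m + u)%N].
Proof. by rewrite -addn1 iotaD. Qed.

(** * Intertwiners in an abstract representation *)

Section YRelations.
Variables (F : fieldType) (V : lmodType F) (k : nat) (c q : F).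
Variables (T X : nat -> {linear V -> V}) (om : {linear V -> V}).
Implicit Types (f g : V) (i j m : nat).

Definition Tneg j f : V := T j f - c *: f.
Local Notation T' := Tneg.

Hypothesis T'K : forall j f, (j < k)%N -> T' j (T j f) = f.
Hypothesis TK : forall j f, (j < k)%N -> T j (T' j f) = f.
Hypothesis braid : forall j f, (j.+1 < k)%N ->
  T j (T j.+1 (T j f)) = T j.+1 (T j (T j.+1 f)).
Hypothesis T_comm : forall i j f, (i.+1 < j)%N -> (j < k)%N -> T i (T j f) = T j (T i f).
Hypothesis om_T : forall j f, (j.+1 < k)%N -> om (T j.+1 f) = T j (om f).
Hypothesis om2_T : forall f, (0 < k)%N -> om (om (T 0 f)) = T k.-1 (om (om f)).
Hypothesis TXT : forall j f, (j < k)%N -> T j (X j (T j f)) = X j.+1 f.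
Hypothesis X_T : forall i j f, (j < k)%N -> (i <= k)%N -> i != j -> i != j.+1 ->
  X i (T j f) = T j (X i f).
Hypothesis om_X : forall j f, (j < k)%N -> om (X j.+1 f) = X j (om f).
Hypothesis om_X0 : forall f, om (X 0 f) = q *: X k (om f).

Lemma Tneg_is_linear j : linear (T' j).
Proof.
move=> a f g; rewrite /Tneg linearP scalerDr opprD addrACA; congr (_ + _).
by rewrite scalerBr !scalerA mulrC.
Qed.
HB.instance Definition _ j := GRing.isLinear.Build F V V _ (T' j) (Tneg_is_linear j).

Definition Ynat i f : V :=
  foldr (fun j g => T j g) (om (foldr (fun j g => T' j g) f (iota 0 i))) (iota i (k - i)).

Lemma YnatS i f : (i < k)%N -> Ynat i f = T i (Ynat i.+1 (T i f)).
Proof.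
move=> hi; rewrite /Ynat iota_cat foldr_cat /= T'K //.
by rewrite -[in iota i _](subnSK hi).
Qed.

Lemma Ynat_succ i f : (i < k)%N -> Ynat i.+1 f = T' i (Ynat i (T' i f)).
Proof. by move=> hi; rewrite (YnatS (T' i f)) // TK // T'K. Qed.

Lemma Tneg_intertwine i j (A : {linear V -> V}) f :
  (forall g, A (T i g) = T j (A g)) -> A (T' i f) = T' j (A f).
Proof. by move=> h; rewrite /Tneg linearB linearZ /= h. Qed.

Lemma foldr_comm (A : V -> V) g (r : seq nat) :
  (forall m, m \in r -> forall f, A (T m f) = T m (A f)) ->
  A (foldr (fun j g => T j g) g r) = foldr (fun j g => T j g) (A g) r.
Proof.
elim: r => [//|m r IH] /= h; rewrite h ?mem_head // IH // => p hp.
by apply: h; rewrite in_cons hp orbT.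
Qed.

Lemma Top_far i j f : (i.+1 < j)%N || (j.+1 < i)%N -> (i < k)%N -> (j < k)%N ->
  T i (T j f) = T j (T i f).
Proof. by case/orP => h hi hj; [|symmetry]; apply: T_comm. Qed.

(** Moving right through T_0 ... T_{k-1}, the operator [T j] drops to index j - 1 at the braid
    relation and regains index j when it crosses [om]. *)
Lemma Ynat0_Top j f : (0 < j)%N -> (j < k)%N -> T j (Ynat 0 f) = Ynat 0 (T j f).
Proof.
case: j => [//|j] _ hj; rewrite /Ynat /= subn0.
have -> : iota 0 k = iota 0 j ++ [:: j, j.+1 & iota j.+2 (k - j.+2)].
  have e : k = (j + (k - j.+2).+2)%N by lia.
  by rewrite {1}e iotaD.
rewrite !foldr_cat /= foldr_comm; last first.
  by move=> m; rewrite mem_iota => hm g; apply: Top_far => //; lia.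
congr foldr; rewrite -braid //; congr (T _ (T _ _)).
rewrite foldr_comm; last first.
  by move=> m; rewrite mem_iota => hm g; apply: Top_far => //; lia.
by rewrite -om_T.
Qed.

Lemma braid_inv1 j f : (j.+1 < k)%N -> T j (T' j.+1 (T' j f)) = T' j.+1 (T' j (T j.+1 f)).
Proof.
move=> hj; have hj' : (j < k)%N by lia.
rewrite -{2}(TK f hj') -{2}(TK (T' j f) hj) -braid // T'K // T'K //.
Qed.

Lemma braid_inv2 j f : (j.+1 < k)%N -> T' j (T' j.+1 (T j f)) = T j.+1 (T' j (T' j.+1 f)).
Proof.
move=> hj; have hj' : (j < k)%N by lia.
rewrite -{1}(TK f hj) -{1}(TK (T' j.+1 f) hj') braid // T'K // T'K //.
Qed.

(** The induction peels T' factors off Y_i. In the case i = j + 2 two of them are peeled at once: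
    the mixed braid relations turn [T j] into [T j.+1], which commutes with Y_j, and then back. *)
Lemma Ynat_Top i j f : (i <= k)%N -> (j < k)%N -> j != i -> j.+1 != i ->
  T j (Ynat i f) = Ynat i (T j f).
Proof.
have [u] := ubnP i; elim: u i j f => // u IH [|i] j f hu hi hj ji ji1.
  by apply: Ynat0_Top => //; lia.
have [e|ne] := eqVneq j.+1 i; last first.
  have far g : T j (T' i g) = T' i (T j g).
    by apply: Tneg_intertwine => g'; apply: Top_far => //; lia.
  by rewrite !Ynat_succ // far IH ?far //; lia.
subst i; rewrite !(@Ynat_succ j.+1) // !(@Ynat_succ j) //.
by rewrite braid_inv1 // IH ?braid_inv2 //; lia.
Qed.

(** The affine intertwiner: it creates one degree, and on eigenvectors it realizes the rotation
    [pie] of the weight. *)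
Definition Pi f : V := X k (om f).

Lemma Pi_is_linear : linear Pi.
Proof. by move=> a f g; rewrite /Pi !linearP. Qed.
HB.instance Definition _ := GRing.isLinear.Build F V V _ Pi Pi_is_linear.

Lemma Top_Pi j f : (j.+1 < k)%N -> Pi (T j.+1 f) = T j (Pi f).
Proof. by move=> hj; rewrite /Pi om_T // X_T //; lia. Qed.

Lemma Tneg_Xop j f : (j < k)%N -> T' j (X j.+1 f) = X j (T j f).
Proof. by move=> hj; rewrite -TXT // T'K. Qed.

Lemma Xop_Tneg j f : (j < k)%N -> X j.+1 (T' j f) = T j (X j f).
Proof. by move=> hj; rewrite -TXT // TK. Qed.

Lemma foldr_Tneg_Xop m f : (m <= k)%N ->
  foldr (fun j g => T' j g) (X m f) (iota 0 m) =
  X 0 (foldr (fun j g => T j g) f (iota 0 m)).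
Proof.
elim: m f => [//|m IH] f hm; rewrite iota_cat !foldr_cat /= Tneg_Xop //.
by rewrite IH //; lia.
Qed.

Lemma Ynat_Pi_last f : Ynat k (Pi f) = q *: Pi (Ynat 0 f).
Proof.
rewrite {1}/Ynat subnn /= /Pi foldr_Tneg_Xop // om_X0 // /Ynat subn0 //.
Qed.

Lemma omega_foldr m f : (m < k)%N ->
  om (foldr (fun j g => T j g) f (iota 1 m)) = foldr (fun j g => T j g) (om f) (iota 0 m).
Proof.
elim: m f => [//|m IH] f hm; rewrite !iota_cat.
by rewrite !foldr_cat /= IH ?add1n ?add0n ?om_T //; lia.
Qed.

(** On the left the last factor T_{k-1} meets X_{k-1} and becomes X_k T'_{k-1}; by [om2_T] this
    T'_{k-1} crosses two copies of [om] and becomes the T'_0 inside Y_1. The other T factors commute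
    with X_k and shift their index across [om]. *)
Lemma Ynat_Pi0 f : (0 < k)%N -> Ynat 0 (Pi f) = Pi (Ynat 1 f).
Proof.
move=> k0; have kk : k = k.-1.+1 by lia.
rewrite /Ynat subn0 /= {2}/Pi subn1 omega_foldr; last by lia.
rewrite foldr_comm; last first.
  by move=> m; rewrite mem_iota => hm g; apply: X_T => //; lia.
have -> : om (om (T' 0 f)) = T' k.-1 (om (om f)).
    by rewrite /Tneg !linearB !linearZ /= om2_T.
rewrite {1}kk iota_cat foldr_cat /= add0n; congr foldr.
have -> : X k (T' k.-1 (om (om f))) = X k.-1.+1 (T' k.-1 (om (om f))) by rewrite -kk.
rewrite Xop_Tneg; last by lia.
have omX g : om (X k g) = X k.-1 (om g) by rewrite -om_X -?kk //; lia.
by rewrite /Pi omX.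
Qed.

Lemma Ynat_Pi i f : (i < k)%N -> Ynat i (Pi f) = Pi (Ynat i.+1 f).
Proof.
elim: i f => [|i IH] f hi; first exact: Ynat_Pi0.
have hi' : (i < k)%N by lia.
have TP g : Pi (T' i.+1 g) = T' i (Pi g).
  by apply: Tneg_intertwine => g'; apply: Top_Pi.
by rewrite Ynat_succ // -TP IH // -TP -Ynat_succ.
Qed.

Lemma foldr_linear (A : nat -> {linear V -> V}) (r : seq nat) :
  linear (fun g => foldr (fun j g => A j g) g r).
Proof. by move=> a f g; elim: r => [//|m r IH] /=; rewrite IH linearP. Qed.

Lemma Ynat_is_linear i : linear (Ynat i).
Proof.
move=> a f g; rewrite /Ynat (foldr_linear (fun j => Tneg j)) linearP.
exact: foldr_linear.
Qed.
HB.instance Definition _ i := GRing.isLinear.Build F V V _ (Ynat i) (Ynat_is_linear i).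

Definition Yeigen (y : nat -> F) f := forall i, (i <= k)%N -> Ynat i f = y i *: f.

Definition swn j i := if i == j then j.+1 else if i == j.+1 then j else i.

Lemma swn_l j : swn j j = j.+1. Proof. by rewrite /swn eqxx. Qed.
Lemma swn_r j : swn j j.+1 = j.
Proof. by rewrite /swn eqxx; case: eqP => //; lia. Qed.

Lemma quadratic j f : (j < k)%N -> T j (T j f) = c *: T j f + f.
Proof.
move=> hj; have := TK f hj; rewrite /Tneg linearB linearZ /= => /eqP.
by rewrite subr_eq addrC => /eqP.
Qed.

(** Since Y_j T_j f = y_{j+1} T_j f + c y_j f, the added multiple of f is the one that cancels the
    stray term c y_j f. *)
Lemma Yeigen_T y j f : (j < k)%N -> y j.+1 - y j != 0 -> Yeigen y f ->
  Yeigen (y \o swn j) (T j f + (c * y j / (y j.+1 - y j)) *: f).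
Proof.
move=> hj yy ef i hi; rewrite linearD linearZ /= ef //.
have yT g : Ynat j (T j g) = c *: Ynat j g + T j (Ynat j.+1 g).
  by rewrite !(YnatS _ hj) quadratic // !linearD !linearZ.
have [->|ij] := eqVneq i j.
  rewrite /comp swn_l yT !ef //; last by lia.
  rewrite [T j (_ *: _)]linearZ /= scalerDr !scalerA addrAC -scalerDl addrC.
  by congr (_ + _ *: _); field.
have [->|ij1] := eqVneq i j.+1.
  rewrite /comp swn_r Ynat_succ // T'K // ef; last by lia.
  have -> : T' j (y j *: f) = y j *: T j f - (y j * c) *: f.
    by rewrite linearZ /= /Tneg scalerBr scalerA.
  rewrite scalerDr !scalerA -addrA -scaleNr -scalerDl.
  by congr (_ + _ *: _); field.
rewrite /comp /swn (negPf ij) (negPf ij1) -Ynat_Top 1?eq_sym // ef // linearZ /=.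
by rewrite scalerDr !scalerA mulrC.
Qed.

Lemma Yeigen_Pi y f : (0 < k)%N -> Yeigen y f ->
  Yeigen (fun i => if i == k then q * y 0%N else y i.+1) (Pi f).
Proof.
move=> k0 ef i hi; case: eqP => [->|/eqP ne].
  by rewrite Ynat_Pi_last ef // linearZ /= scalerA.
by rewrite Ynat_Pi ?ef ?linearZ //; lia.
Qed.

Lemma Yeigen_Pi_inv y f : (0 < k)%N -> q != 0 -> injective Pi ->
  Yeigen (fun i => if i == k then q * y 0%N else y i.+1) (Pi f) -> Yeigen y f.
Proof.
move=> k0 q0 PiI ef [|i] hi; apply: PiI.
  have := ef k (leqnn k); rewrite eqxx Ynat_Pi_last -scalerA.
  by move=> /(scalerI q0) ->; rewrite linearZ.
rewrite -Ynat_Pi // ef ?linearZ; last by lia.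
by case: eqP => // e; lia.
Qed.

(* The intertwiners [T j + a] and [T j + b] below are mutually inverse up to
   the scalar [1 + a * b]. *)
Lemma intertwiner_comp j f a b : (j < k)%N -> a + b = - c ->
  T j (T j f + a *: f) + b *: (T j f + a *: f) = (1 + a * b) *: f.
Proof.
move=> hj ab; rewrite linearD linearZ /= quadratic // scalerDr scalerA scalerDl scale1r.
rewrite [b * a]mulrC addrA; congr (_ + _).
rewrite -addrA -scalerDl ab scaleNr addrC addrA addNr add0r //.
Qed.

End YRelations.

(** * Triangularity of the Y-operators *)

Section Dominance.
Variable k : nat.
Local Notation n := k.+1.
Local Notation expo := (expo n).
Implicit Types (a b mu lam nu : expo).

Definition pb (sigma : 'I_n -> 'I_n) a : expo := [ffun p => a (sigma p)].

Lemma psumB a b m : psum a m - psum b m = \sum_(j < n | (j < m)%N) (a j - b j).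
Proof. by rewrite /psum sumrB. Qed.

Lemma psum_all a m : (n <= m)%N -> psum a m = \sum_j a j.
Proof.
by move=> h; apply: eq_bigl => j; apply/idP; apply: leq_trans (ltn_ord j) h.
Qed.

Lemma dom_leP mu lam : reflect (\sum_j mu j = \sum_j lam j /\
   forall m : nat, psum mu m <= psum lam m) (dom_le mu lam).
Proof.
apply: (iffP andP); rewrite !psum_all // => -[e h].
  move/eqP: e => e; move/forallP: h => h; split=> // m; have [mn|mn] := leqP m n.
    exact: (h (Ordinal (mn : (m < n.+1)%N))).
  by rewrite !psum_all ?e // ltnW.
by split; [apply/eqP | apply/forallP => m].
Qed.

Lemma dom_le_trans b a lam : dom_le a b -> dom_le b lam -> dom_le a lam.
Proof.
move=> /dom_leP[e1 h1] /dom_leP[e2 h2]; apply/dom_leP; split; first by rewrite e1.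
by move=> m; apply: le_trans (h1 m) (h2 m).
Qed.

Lemma psumS a (i : 'I_n) : psum a i.+1 = psum a i + a i.
Proof.
rewrite /psum (bigD1 i) //= addrC; congr (_ + _); apply: eq_bigl => j.
by rewrite ltnS ltn_neqAle andbC.
Qed.

Lemma dom_le_anti a b : dom_le a b -> dom_le b a -> a = b.
Proof.
move=> /dom_leP[_ h1] /dom_leP[_ h2].
have e m : psum a m = psum b m by apply/le_anti; rewrite h1 h2.
apply/ffunP => i; have := psumS a i; rewrite !e psumS => /addrI //.
Qed.

Lemma dom_lt_trans b a lam : dom_lt a b -> dom_lt b lam -> dom_lt a lam.
Proof.
move=> /andP[h1 n1] /andP[h2 n2]; apply/andP; split; first exact: dom_le_trans h2.
by apply: contraNneq n1 => e; apply/eqP/dom_le_anti; rewrite // e.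
Qed.

Lemma dom_lt_irr a : dom_lt a a = false.
Proof. by rewrite /dom_lt eqxx andbF. Qed.

Lemma prec_irr a : prec a a = false.
Proof. by rewrite /prec !dom_lt_irr andbF. Qed.

Lemma prec_trans b a lam : prec a b -> prec b lam -> prec a lam.
Proof.
rewrite /prec; case/orP => [h1|/andP[/eqP e1 h1]]; case/orP => [h2|/andP[/eqP e2 h2]].
- by rewrite (dom_lt_trans h1 h2).
- by rewrite -e2 h1.
- by rewrite e1 h2.
- by rewrite e1 e2 eqxx (dom_lt_trans h1 h2) orbT.
Qed.

Definition ple a b := (a == b) || prec a b.

Lemma prec_ple_trans b a lam : prec a b -> ple b lam -> prec a lam.
Proof. by move=> h /orP[/eqP <-|] //; apply: prec_trans. Qed.
Lemma prec_ple a b : prec a b -> ple a b.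
Proof. by move=> h; rewrite /ple h orbT. Qed.
Lemma ple_trans b a lam : ple a b -> ple b lam -> ple a lam.
Proof.
by case/orP => [/eqP ->|h] // h'; apply: prec_ple; apply: prec_ple_trans h'.
Qed.

Let gez (x y : int) : bool := y <= x.
Let gez_total : total gez. Proof. by move=> x y; apply: le_total. Qed.
Let gez_trans : transitive gez. Proof. by move=> x y z h1 h2; apply: le_trans h2 h1. Qed.
Let gez_anti : antisymmetric gez. Proof. by move=> x y h; apply: le_anti; rewrite andbC. Qed.

Lemma dplusE a : codom (dplus a) = sort gez (codom a).
Proof.
have sz : size (sort gez (codom a)) = n by rewrite size_sort size_codom card_ord.
apply: (@eq_from_nth _ 0) => [|i]; rewrite size_codom card_ord ?sz // => hi.
by rewrite codomE (nth_map ord0) ?size_enum_ord // ffunE nth_enum_ord.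
Qed.

Lemma dplus_pb a sigma : injective sigma -> dplus (pb sigma a) = dplus a.
Proof.
move=> sI; have e : sort gez (codom (pb sigma a)) = sort gez (codom a).
  apply/(perm_sortP gez_total gez_trans gez_anti).
  have -> : codom (pb sigma a) = [seq a x | x <- [seq sigma x | x <- enum 'I_n]].
    by rewrite codomE -[RHS]map_comp; apply/eq_in_map => x _; rewrite /= ffunE.
  rewrite codomE; apply: perm_map; apply: uniq_perm.
  - by rewrite map_inj_uniq ?enum_uniq.
  - exact: enum_uniq.
  move=> x; rewrite mem_enum /=; apply/mapP; exists (invF sI x).
    by rewrite mem_enum.
  by rewrite f_invF.
by apply/ffunP => m; rewrite !ffunE e.
Qed.

Lemma sum_dplus (g : int -> int) a : \sum_i g (dplus a i) = \sum_i g (a i).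
Proof.
have cod b : \sum_i g (b i) = \sum_(x <- codom b) g x.
  by rewrite codomE big_map big_enum.
rewrite !cod dplusE; apply: perm_big; exact: permEl (perm_sort _ _).
Qed.

Lemma dplus_sorted a (i j : 'I_n) : (i <= j)%N -> dplus a j <= dplus a i.
Proof.
move=> ij; rewrite !ffunE.
apply: (@sorted_leq_nth _ gez gez_trans (fun x => lexx x) 0 _ (sort_sorted gez_total _)) => //;
  by rewrite inE size_sort size_codom card_ord.
Qed.

(* The partial sums of the sorted sequence are [min_c (m c + sum_i max(a_i - c, 0))]. *)
Lemma psum_dplus_le a m c :
  psum (dplus a) m <= \sum_(j < n | (j < m)%N) c + \sum_i Num.max (a i - c) 0.
Proof.
rewrite -(sum_dplus (fun x => Num.max (x - c) 0)) [X in _ <= _ + X](bigID (fun j : 'I_n => (j < m)%N)) /=.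
rewrite addrA -big_split /= -[psum _ _]addr0; apply: lerD.
  by apply: ler_sum => j _; lia.
by apply: sumr_ge0 => j _; lia.
Qed.

Lemma psum_dplus_eq a m : exists c,
  psum (dplus a) m = \sum_(j < n | (j < m)%N) c + \sum_i Num.max (a i - c) 0.
Proof.
pose m' : 'I_n := inord (minn m k.+1).-1; exists (dplus a m').
have vm : val m' = (minn m k.+1).-1 by rewrite /m' /= inordK //; lia.
set c := dplus a m'.
rewrite -(sum_dplus (fun x => Num.max (x - c) 0)) [X in _ = _ + X](bigID (fun j : 'I_n => (j < m)%N)) /=.
rewrite addrA -big_split /= [X in _ = _ + X]big1 ?addr0; last first.
  move=> j jm; have : dplus a j <= c by apply: dplus_sorted; move: jm vm; rewrite /=; lia.
  lia.
apply: eq_bigr => j jm; have : c <= dplus a j.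
  by apply: dplus_sorted; move: (ltn_ord j) jm vm; rewrite /=; lia.
lia.
Qed.

(** Moving two entries towards each other does not increase the convex sums of max(x - c, 0), which
    control the partial sums of the sorted weight. Strictness comes from the sum of squares, which
    changes. *)
Lemma robin_hood a b (p r : 'I_n) : p != r ->
  (forall i, i != p -> i != r -> b i = a i) -> b p + b r = a p + a r ->
  `|b p - b r| < `|a p - a r| -> dom_lt (dplus b) (dplus a).
Proof.
move=> pr eqo eqs lt.
have rp : r != p by rewrite eq_sym.
have sumE (g : int -> int) : \sum_i g (b i) + (g (a p) + g (a r)) =
    \sum_i g (a i) + (g (b p) + g (b r)).
  rewrite (bigD1 p) //= (bigD1 r) //= [in RHS](bigD1 p) //= [in RHS](bigD1 r) //=.
  rewrite (eq_bigr (fun i => g (a i))); first by ring.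
  by move=> i /andP[h1 h2]; rewrite eqo.
apply/andP; split; last first.
  apply/eqP => e; have := sumE (fun x => x * x).
  rewrite -(sum_dplus (fun x => x * x) b) -(sum_dplus (fun x => x * x) a) e.
  move/addrI; move: eqs lt; move: (a p) (a r) (b p) (b r) => x y z w.
  by move=> e1 lt e2; nia.
apply/dom_leP; split.
  rewrite (sum_dplus id) (sum_dplus id); have := sumE id; rewrite /= eqs.
  by move/addIr.
move=> m; have [c ->] := psum_dplus_eq a m.
apply: le_trans (psum_dplus_le b m c) _; rewrite lerD2l.
have := sumE (fun x => Num.max (x - c) 0); move: eqs lt.
move: (\sum_i _) (\sum_i _) (a p) (a r) (b p) (b r) => u v x y z w; lia.
Qed.

Lemma dom_lt_swap a b (p r : 'I_n) : (p < r)%N -> a r < a p ->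
  b p = a r -> b r = a p -> (forall i, i != p -> i != r -> b i = a i) -> dom_lt b a.
Proof.
move=> pr lt bp br eqo; have rp : r != p by rewrite -val_eqE /=; lia.
have key m : psum a m - psum b m = (if (p < m)%N then a p - a r else 0)
                                 + (if (r < m)%N then a r - a p else 0).
  rewrite psumB big_mkcond (bigD1 p) //= (bigD1 r) //= bp br big1 ?addr0 //.
  by move=> i /andP[h1 h2]; rewrite eqo // subrr if_same.
apply/andP; split; last first.
  by apply/eqP => e; move: lt; rewrite -bp e ltxx.
apply/dom_leP; split.
  apply/eqP; rewrite eq_sym -subr_eq0 -!(psum_all _ (leqnn n)) key !ltn_ord.
  by rewrite addrC subrKA subrr.
move=> m; rewrite -subr_ge0 key; do 2![case: ifP => /=] => *; lia.
Qed.

End Dominance.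

(** * The terms of T_j and its inverse on a monomial *)

Section Strings.
Variables (F : fieldType) (k : nat).
Local Notation n := k.+1.
Local Notation LP := (LP F n).
Local Notation expo := (expo n).
Implicit Types (f g : LP) (a b mu : expo) (j : nat).

(** The strictly interior points of the segment from [a] to [sw_expo j a]. Their sorted weight is
    strictly smaller than that of [a], so they are lower terms whatever the labelling of the
    positions. *)
Definition inside j b a :=
  (forall i : 'I_n, val i != j -> val i != j.+1 -> b i = a i) /\
  b (inord j) + b (inord j.+1) = a (inord j) + a (inord j.+1) /\
  `|b (inord j) - b (inord j.+1)| < `|a (inord j) - a (inord j.+1)|.

Lemma neq_inord j (i : 'I_n) : (j < n)%N -> (i != inord j) = (val i != j).
Proof.
move=> hj; congr negb; apply/eqP/eqP => [->|e]; first exact: val_inord.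
by apply: val_inj; rewrite e val_inord.
Qed.

Lemma inside_prec j b a sigma tau : (j < k)%N -> injective sigma -> injective tau ->
  inside j b a -> prec (pb sigma b) (pb tau a).
Proof.
move=> hj sI tI [h1 [h2 h3]]; rewrite /prec !dplus_pb //.
rewrite (robin_hood (p := inord j) (r := inord j.+1)) //.
  by rewrite eq_sym inord_neqS.
by move=> i; rewrite !neq_inord; [exact: h1 | lia | lia].
Qed.

Lemma yshift_l j a m : (j < k)%N -> yshift a j m (inord j) = a (inord j) + m.
Proof. by move=> hj; rewrite ffunE val_inord ?eqxx //; lia. Qed.
Lemma yshift_r j a m : (j < k)%N -> yshift a j m (inord j.+1) = a (inord j.+1) - m.
Proof.
by move=> hj; rewrite ffunE val_inord ?eqxx // (_ : j.+1 == j = false) //; lia.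
Qed.
Lemma yshift_o j a m (i : 'I_n) : val i != j -> val i != j.+1 -> yshift a j m i = a i.
Proof. by move=> h1 h2; rewrite ffunE (negPf h1) (negPf h2). Qed.

Lemma sw_l j a : (j < k)%N -> sw_expo j a (inord j) = a (inord j.+1).
Proof. by move=> hj; rewrite ffunE sidx_l ?val_inord //; lia. Qed.
Lemma sw_r j a : (j < k)%N -> sw_expo j a (inord j.+1) = a (inord j).
Proof. by move=> hj; rewrite ffunE sidx_r ?val_inord //; lia. Qed.
Lemma sw_o j a (i : 'I_n) : val i != j -> val i != j.+1 -> sw_expo j a i = a i.
Proof. by move=> h1 h2; rewrite ffunE sidx_far. Qed.

Lemma expo_eqP j a b : (j < k)%N ->
  a (inord j) = b (inord j) -> a (inord j.+1) = b (inord j.+1) ->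
  (forall i : 'I_n, val i != j -> val i != j.+1 -> a i = b i) -> a = b.
Proof.
move=> hj e1 e2 e3; apply/ffunP => i.
have [e|h1] := eqVneq i (inord j); first by rewrite e.
have [e|h2] := eqVneq i (inord j.+1); first by rewrite e.
by apply: e3; rewrite -neq_inord //; lia.
Qed.

Lemma swK j a : (j < k)%N -> sw_expo j (sw_expo j a) = a.
Proof. by move=> hj; apply/ffunP => i; rewrite !ffunE sidxK. Qed.

Lemma yshift_sw j a : (j < k)%N ->
  yshift a j (a (inord j.+1) - a (inord j)) = sw_expo j a.
Proof.
move=> hj; apply: (expo_eqP hj); rewrite ?yshift_l ?yshift_r ?sw_l ?sw_r //.
- by rewrite addrC subrK.
- by rewrite opprB addrC subrK.
by move=> i h1 h2; rewrite yshift_o ?sw_o.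
Qed.

Lemma yshift_inside j a m : (j < k)%N ->
  `|a (inord j) - a (inord j.+1) + m *+ 2| < `|a (inord j) - a (inord j.+1)| ->
  inside j (yshift a j m) a.
Proof.
move=> hj lt; split; first by move=> i; apply: yshift_o.
rewrite yshift_l ?yshift_r //; split; first by rewrite addrACA subrr addr0.
by move: lt; move: (a _) (a _) => x y; congr (`|_| < _); ring.
Qed.

Lemma mcoeff_Dmono j a b : (j < k)%N ->
  (Dmono F j a)@_b = let d := a (inord j) - a (inord j.+1) in
  if 0 < d then - \sum_(m < absz d) (yshift a j (- (m.+1)%:Z) == b)%:R
  else \sum_(m < absz d) (yshift a j m%:Z == b)%:R.
Proof.
move=> hj; rewrite /Dmono !avE //=; last by lia.
by case: ifP => _; rewrite ?mcoeffN mcoeff_sum; [congr (- _)|];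
  apply: eq_bigr => m _; rewrite mcoeff_mono.
Qed.

Lemma sum_bool_neq0 (u : nat) (P : pred 'I_u) :
  \sum_(m < u) (P m)%:R != 0 :> F -> exists m, P m.
Proof.
move=> h; apply/existsP; apply: contraNT h => /existsPn h.
by rewrite big1 // => m _; rewrite (negPf (h m)).
Qed.

Lemma Dmono_supp j a b : (j < k)%N -> (Dmono F j a)@_b != 0 ->
  [\/ b = sw_expo j a /\ a (inord j.+1) < a (inord j),
      b = a /\ a (inord j) < a (inord j.+1) | inside j b a].
Proof.
move=> hj; rewrite mcoeff_Dmono //=; case: ifP => pos.
  rewrite oppr_eq0 => /sum_bool_neq0[m /eqP <-].
  have [e|ne] := eqVneq m.+1%:Z (a (inord j) - a (inord j.+1)).
    by constructor 1; rewrite e opprB yshift_sw //; split => //; lia.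
  constructor 3; apply: yshift_inside => //; have hm := ltn_ord m; move: pos ne hm.
  by move: (nat_of_ord m) => u; move: (a _) (a _) => x y; lia.
move=> /sum_bool_neq0[m /eqP <-]; have [e|ne] := eqVneq (nat_of_ord m) 0%N.
  constructor 2; rewrite e; split; last by move: (ltn_ord m) pos; lia.
  apply: (expo_eqP hj); rewrite ?yshift_l ?yshift_r ?addr0 ?subr0 // => i.
  exact: yshift_o.
constructor 3; apply: yshift_inside => //; have hm := ltn_ord m; move: pos ne hm.
by move: (nat_of_ord m) => u; move: (a _) (a _) => x y; lia.
Qed.

Lemma Dmono_sw j a : (j < k)%N ->
  (Dmono F j a)@_(sw_expo j a) = if a (inord j.+1) < a (inord j) then -1 else 0.
Proof.
move=> hj; rewrite mcoeff_Dmono //= subr_gt0; case: ifP => pos; last first.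
  rewrite big1 // => m _; case: eqP => // e; have := congr1 (fun u : expo => u (inord j)) e.
  by rewrite yshift_l // sw_l // => h; move: (ltn_ord m); lia.
have [D eD] : exists D : nat, a (inord j) - a (inord j.+1) = D.+1%:Z.
  by exists `|a (inord j) - a (inord j.+1)|.-1%N; lia.
rewrite eD absz_nat big_ord_recr /= -eD opprB yshift_sw // eqxx big1 ?add0r //.
move=> m _; case: eqP => // e; have := congr1 (fun u : expo => u (inord j)) e.
by rewrite yshift_l // sw_l // => h; move: (ltn_ord m); lia.
Qed.

Lemma Dmono_self j a : (j < k)%N ->
  (Dmono F j a)@_a = if a (inord j) < a (inord j.+1) then 1 else 0.
Proof.
move=> hj; rewrite mcoeff_Dmono //= subr_gt0; case: ifP => pos.
  have -> : (a (inord j) < a (inord j.+1)) = false by lia.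
  rewrite big1 ?oppr0 // => m _; case: eqP => // e.
  by have := congr1 (fun u : expo => u (inord j)) e; rewrite yshift_l //; lia.
case: ifP => neg; last first.
  have -> : a (inord j) - a (inord j.+1) = 0 by lia.
  by rewrite big_ord0.
have [D eD] : exists D : nat, a (inord j) - a (inord j.+1) = - D.+1%:Z.
  by exists `|a (inord j) - a (inord j.+1)|.-1%N; lia.
rewrite eD abszN absz_nat big_ord_recl /= big1 ?addr0.
  rewrite (_ : yshift a j 0 = a) ?eqxx //.
  apply: (expo_eqP hj); rewrite ?yshift_l ?yshift_r ?addr0 ?subr0 // => i.
  exact: yshift_o.
move=> m _; case: eqP => // e; have := congr1 (fun u : expo => u (inord j)) e.
by rewrite yshift_l // /bump /=; lia.
Qed.

Lemma mcoeff_Top_mono (s : F) j a b :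
  (Top s j (mono F a))@_b = s * (sw_expo j a == b)%:R + (s - s^-1) * (Dmono F j a)@_b.
Proof. by rewrite /Top linext_mono mcoeffD !mcoeffZ mcoeff_mono. Qed.

Lemma Top_mono_supp (s : F) j a b : (j < k)%N -> (Top s j (mono F a))@_b != 0 ->
  [\/ b = sw_expo j a, b = a /\ a (inord j) < a (inord j.+1) | inside j b a].
Proof.
move=> hj; rewrite mcoeff_Top_mono; case: (sw_expo j a =P b) => [<-|_]; first by constructor 1.
rewrite mulr0 add0r mulf_eq0 negb_or => /andP[_ /(Dmono_supp hj)[[-> _]|?|?]];
  by [constructor 1 | constructor 2 | constructor 3].
Qed.

Lemma Top_mono_sw (s : F) j a : (j < k)%N -> (Top s j (mono F a))@_(sw_expo j a) =
  if a (inord j) <= a (inord j.+1) then s else s^-1.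
Proof.
move=> hj; rewrite mcoeff_Top_mono eqxx Dmono_sw //.
by case: ltgtP => _ /=; ring.
Qed.

(** The monomial itself survives under the opposite inequality to that for [Top]. This asymmetry is
    what keeps both halves of a Y-operator triangular. *)
Lemma Tinv_mono_supp (s : F) j a b : (j < k)%N -> (Tinv s j (mono F a))@_b != 0 ->
  [\/ b = sw_expo j a, b = a /\ a (inord j.+1) < a (inord j) | inside j b a].
Proof.
move=> hj; rewrite mcoeffB mcoeffZ mcoeff_Top_mono mcoeff_mono.
case: (sw_expo j a =P b) => [<-|nsw]; first by constructor 1.
rewrite mulr0 add0r; case: (a =P b) => [e|na]; first subst b.
  rewrite Dmono_self //; case: ltgtP => h; rewrite ?mulr1 ?subrr ?eqxx //.
    by constructor 2.
  by case: nsw; apply: (expo_eqP hj); rewrite ?sw_l ?sw_r ?h // => i; apply: sw_o.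
rewrite mulr0 subr0 mulf_eq0 negb_or => /andP[_ /(Dmono_supp hj)[[e _]|[e _]|?]].
- by case: nsw.
- by case: na.
by constructor 3.
Qed.

Lemma Tinv_mono_sw (s : F) j a : (j < k)%N -> (Tinv s j (mono F a))@_(sw_expo j a) =
  if a (inord j) < a (inord j.+1) then s else s^-1.
Proof.
move=> hj; rewrite mcoeffB mcoeffZ Top_mono_sw // mcoeff_mono.
case: (altP (a =P sw_expo j a)) => [e|ne].
  have {}e : a (inord j) = a (inord j.+1) by rewrite {1}e sw_l.
  by rewrite e ltxx lexx /=; ring.
have {}ne : a (inord j.+1) != a (inord j).
  apply: contraNneq ne => e; apply/eqP/(expo_eqP hj); rewrite ?sw_l ?sw_r ?e // => i h1 h2.
  by rewrite sw_o.
by rewrite mulr0 subr0; case: ltgtP ne.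
Qed.

End Strings.

(** * Leading coefficients of the Y-operators *)

Section Triangularity.
Variables (F : fieldType) (k : nat).
Local Notation n := k.+1.
Local Notation LP := (LP F n).
Local Notation expo := (expo n).
Implicit Types (f g : LP) (a b mu : expo) (i j m : nat) (sigma : 'I_n -> 'I_n).
Variables (s q : F).

(* [f] is [c] times the monomial [a o sigma'] plus terms that become smaller
   than [a] after undoing the relabelling [sigma'] of the variables. *)
Definition Tri sigma sigma' f a (c : F) :=
  f@_(pb sigma' a) = c /\ forall mu, mu \in msupp f -> ple (pb sigma mu) a.

Lemma pb_comp sigma tau a : pb sigma (pb tau a) = pb (tau \o sigma) a.
Proof. by apply/ffunP => i; rewrite !ffunE. Qed.

Lemma pb_sw sigma j a : pb sigma (sw_expo j a) = pb (sidx j \o sigma) a.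
Proof. by apply/ffunP => i; rewrite !ffunE. Qed.

Lemma pbK sigma sigma' : cancel sigma sigma' -> cancel (@pb k sigma') (pb sigma).
Proof. by move=> sK a; apply/ffunP => i; rewrite !ffunE sK. Qed.

Lemma eq_pb sigma tau a : sigma =1 tau -> pb sigma a = pb tau a.
Proof. by move=> e; apply/ffunP => i; rewrite !ffunE e. Qed.

Lemma eq_Tri sigma sigma' tau tau' f a c : sigma =1 tau -> sigma' =1 tau' ->
  Tri sigma sigma' f a c -> Tri tau tau' f a c.
Proof.
move=> e e' [h1 h2]; split; first by rewrite -(eq_pb a e').
by move=> mu /h2; rewrite (eq_pb mu e).
Qed.

Lemma mcoeff_linear (A : {linear LP -> LP}) f b :
  (A f)@_b = \sum_(mu <- msupp f) f@_mu * (A (mono F mu))@_b.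
Proof.
rewrite {1}(LP_monoE f) linear_sum mcoeff_sum; apply: eq_bigr => mu _.
by rewrite linearZ mcoeffZ.
Qed.

Lemma linear_supp (A : {linear LP -> LP}) f b : b \in msupp (A f) ->
  exists2 mu, mu \in msupp f & (A (mono F mu))@_b != 0.
Proof.
rewrite -mcoeff_neq0 mcoeff_linear => h; apply/hasP.
apply: contraNT h => /hasPn h; rewrite big_seq big1 // => mu /h.
by rewrite negbK => /eqP ->; rewrite mulr0.
Qed.

(** Back in the original labelling the larger of the two entries comes first, so swapping them goes
    down in dominance order. *)
Definition lowers sigma' j mu :=
  ((sigma' (inord j) < sigma' (inord j.+1))%N && (mu (inord j.+1) < mu (inord j)))
  || ((sigma' (inord j.+1) < sigma' (inord j))%N && (mu (inord j) < mu (inord j.+1))).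

Lemma prec_lowers sigma sigma' j mu : (j < k)%N -> cancel sigma sigma' ->
  cancel sigma' sigma -> lowers sigma' j mu ->
  prec (pb (sidx j \o sigma) mu) (pb sigma mu).
Proof.
move=> hj sK s'K low; have sI := can_inj sK.
rewrite /prec !dplus_pb //; last exact: inj_comp (can_inj (sidxK hj)) sI.
rewrite eqxx; apply/orP; right.
have out p : p != sigma' (inord j) -> p != sigma' (inord j.+1) ->
    pb (sidx j \o sigma) mu p = pb sigma mu p.
  move=> h1 h2; rewrite !ffunE /= sidx_far //.
    by rewrite -neq_inord; [apply: contra_neq h1 => <-; rewrite sK | lia].
  by rewrite -neq_inord; [apply: contra_neq h2 => <-; rewrite sK | lia].
have vl : sidx j (inord j) = inord j.+1 :> 'I_n by rewrite sidx_l ?val_inord //; lia.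
have vr : sidx j (inord j.+1) = inord j :> 'I_n by rewrite sidx_r ?val_inord //; lia.
case/orP: low => /andP[lt1 lt2].
  apply: (dom_lt_swap lt1); rewrite ?ffunE /= ?s'K ?vl ?vr //.
apply: (dom_lt_swap lt1); rewrite ?ffunE /= ?s'K ?vl ?vr // => p h1 h2.
exact: out.
Qed.

(** One factor of a Y-operator. The swapped monomial carries the leading term, and the swap is
    absorbed into the relabelling. An unswapped monomial is allowed only where, in the new
    labelling, it counts as a lower term. *)
Lemma Tri_step (A : {linear LP -> LP}) (w : expo -> F) j sigma sigma' f a c :
  (j < k)%N -> cancel sigma sigma' -> cancel sigma' sigma ->
  (forall mu b, (A (mono F mu))@_b != 0 ->
     [\/ b = sw_expo j mu, b = mu /\ lowers sigma' j mu | inside j b mu]) ->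
  (forall mu, (A (mono F mu))@_(sw_expo j mu) = w mu) ->
  Tri sigma sigma' f a c ->
  Tri (sidx j \o sigma) (sigma' \o sidx j) (A f) a (c * w (pb sigma' a)).
Proof.
move=> hj sK s'K Asupp Asw [fa fsupp]; set b0 := pb sigma' a.
have tI : injective (sidx j \o sigma) := inj_comp (can_inj (sidxK hj)) (can_inj sK).
have pb0 : pb sigma b0 = a by rewrite pbK.
split.
  have -> : pb (sigma' \o sidx j) a = sw_expo j b0 by apply/ffunP => i; rewrite !ffunE.
  rewrite mcoeff_linear (bigID (pred1 b0)) /= [X in _ + X]big_seq_cond.
  rewrite [X in _ + X]big1 ?addr0 => [|mu /andP[mf ne]]; last first.
    apply/eqP; rewrite mulf_eq0; apply/orP; right; apply/negPn/negP => /Asupp[e|[e low]|ins].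
    - by case/eqP: ne; rewrite -(swK mu hj) -e swK.
    - have := prec_lowers hj sK s'K low; rewrite -pb_sw (_ : sw_expo j mu = b0) ?pb0 => [h|]; last by rewrite -e swK.
      by have := prec_ple_trans h (fsupp _ mf); rewrite prec_irr.
    - have := inside_prec hj tI (can_inj sK) ins; rewrite -pb_sw swK // pb0 => h.
      by have := prec_ple_trans h (fsupp _ mf); rewrite prec_irr.
  rewrite -big_filter; case: (boolP (b0 \in msupp f)) => b0f.
    rewrite (_ : [seq _ <- _ | _] = [:: b0]) ?big_seq1 ?Asw ?fa //.
    by apply: filter_pred1_uniq => //; apply: fset_uniq.
  rewrite -fa mcoeff_outdom // mul0r big1_seq // => mu /=.
  by rewrite mem_filter => /andP[/eqP -> h]; rewrite h in b0f.
move=> b /linear_supp[mu /fsupp mua /Asupp[->|[-> low]|ins]]; apply: ple_trans mua.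
- rewrite -pb_sw swK // /ple eqxx //.
- by apply/prec_ple/(prec_lowers hj sK s'K low).
by apply/prec_ple/(inside_prec hj tI (can_inj sK) ins).
Qed.

Lemma Tri_omega sigma sigma' f a c : Tri sigma sigma' f a c ->
  Tri (@opred k \o sigma) (sigma' \o @osucc k) (omega q f) a (c * q ^ (a (sigma' ord0))).
Proof.
move=> [fa fsupp].
have om_mono mu b : (omega q (mono F mu))@_b = (pb (@osucc k) mu == b)%:R * q ^ (mu ord0).
  rewrite /omega linext_mono mcoeffZ mcoeff_mono avE // mulrC; congr (_ * q ^ mu _).
  by apply: val_inj; rewrite val_inord.
have pbs mu nu : pb (@osucc k) mu = pb (@osucc k) nu -> mu = nu.
  by move=> e; rewrite -(pbK (@opredK k) mu) e pbK //; apply: opredK.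
split.
  rewrite -pb_comp mcoeff_linear (bigID (pred1 (pb sigma' a))) /=.
  rewrite [X in _ + X]big1 ?addr0 => [|mu ne]; last first.
    by rewrite om_mono; case: eqP => [/pbs e|_]; [rewrite e eqxx in ne | rewrite mul0r mulr0].
  rewrite -big_filter; case: (boolP (pb sigma' a \in msupp f)) => b0f.
    rewrite (_ : [seq _ <- _ | _] = [:: pb sigma' a]) ?big_seq1 ?om_mono ?eqxx ?mul1r ?fa ?ffunE //.
    by apply: filter_pred1_uniq => //; apply: fset_uniq.
  rewrite -fa mcoeff_outdom // mul0r big1_seq // => mu /=.
  by rewrite mem_filter => /andP[/eqP -> h]; rewrite h in b0f.
move=> b /linear_supp[mu /fsupp mua]; rewrite om_mono; case: (pb _ mu =P b) => [<- _|_].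
  by rewrite pb_comp (eq_pb (tau := sigma)) // => p /=; rewrite opredK.
by rewrite mul0r eqxx.
Qed.

(* [mv i m] moves position [i] to [m] and keeps the order of the other positions. *)
Definition mvn i m p := if p == i then m else if (i < p <= m)%N then p.-1
  else if (m <= p < i)%N then p.+1 else p.
Definition mv i m (p : 'I_n) : 'I_n := inord (mvn i m p).

Lemma mvnP i m p :
  (p = i /\ mvn i m p = m) \/ ((i < p)%N /\ (p <= m)%N /\ mvn i m p = p.-1) \/
  ((m <= p)%N /\ (p < i)%N /\ mvn i m p = p.+1) \/
  (p <> i /\ ((p < i)%N \/ (m < p)%N) /\ ((p < m)%N \/ (i < p)%N) /\ mvn i m p = p).
Proof.
rewrite /mvn; have [->|pi] := eqVneq p i; first by left.
case: ifP => h1; first by right; left; lia.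
case: ifP => h2; first by right; right; left; lia.
by right; right; right; lia.
Qed.

Lemma mvn_lt i m p : (i < n)%N -> (m < n)%N -> (p < n)%N -> (mvn i m p < n)%N.
Proof. by have := mvnP i m p; lia. Qed.

Lemma val_mv i m (p : 'I_n) : (i < n)%N -> (m < n)%N -> val (mv i m p) = mvn i m (val p).
Proof. by move=> hi hm; rewrite val_inord //; apply: mvn_lt. Qed.

Lemma mvnK i m p : mvn m i (mvn i m p) = p.
Proof. by have := mvnP i m p; have := mvnP m i (mvn i m p); lia. Qed.

Lemma mvK i m : (i < n)%N -> (m < n)%N -> cancel (mv i m) (mv m i).
Proof. by move=> hi hm p; apply: val_inj; rewrite !val_mv // mvnK. Qed.

Lemma sidx_mv i m : (i < n)%N -> (m < k)%N -> sidx m \o mv i m.+1 =1 mv i m.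
Proof.
move=> hi hm p; apply: val_inj; rewrite val_sidx // !val_mv //; last by lia.
move: (val p) => x; have := mvnP i m x; have := mvnP i m.+1 x.
by case: eqP => h1; [|case: eqP => h2]; lia.
Qed.

Lemma mv_sidx i m : (i < n)%N -> (m < k)%N -> mv m.+1 i \o sidx m =1 mv m i.
Proof.
move=> hi hm; have hm' : (m < n)%N by lia.
move=> p /=; rewrite -{1}(mvK hm' hi p) -(sidx_mv hi hm) /= sidxK //.
exact: mvK.
Qed.

Lemma opred_mv i : (i < n)%N -> @opred k \o mv i 0 =1 mv i k.
Proof.
move=> hi p; apply: val_inj; rewrite val_opred !val_mv //.
have := ltn_ord p; rewrite -[nat_of_ord p]/(val p); move: (val p) => x hx.
by have := mvnP i 0 x; have := mvnP i k x; case: eqP; lia.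
Qed.

Lemma mv_osucc i : (i < n)%N -> mv 0 i \o @osucc k =1 mv k i.
Proof.
move=> hi p /=; rewrite -{1}(mvK (ltnSn k) hi p) -(opred_mv hi) /= opredK.
exact: mvK.
Qed.

Lemma mv_id i : mv i i =1 id.
Proof.
by move=> p; apply: val_inj; rewrite /mv /=; have := mvnP i i p => h;
  rewrite inordK; have := ltn_ord p; lia.
Qed.

Definition ahead a (i p : 'I_n) := (a i < a p) || ((a p == a i) && (p < i)%N).
(** The coefficient picked up when position [i] crosses position [m]. *)
Definition wt a (i : 'I_n) m : F := if ahead a i (inord m) then s^-1 else s.

(** The factors of Y_i carry position [i] around a circle: the inverse T factors bring it to the
    front, [omega] moves it to the end with a factor q^(a_i), and the T factors of the second phase
    bring it home. Every other position is crossed exactly once. *)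
Lemma Tri_phase1 (i : 'I_n) a f m : (m <= i)%N -> Tri (mv i i) (mv i i) f a 1 ->
  Tri (mv i m) (mv m i) (foldr (fun j g => Tinv s j g) f (iota m (i - m))) a
    (\prod_(m <= p < i) wt a i p).
Proof.
move=> + tri0; move e : (i - m)%N => u; elim: u m e => [|u IH] m e mi.
  have -> : m = i by lia.
  by rewrite big_geq.
have mi' : (m < i)%N by lia.
have hi := ltn_ord i; have hmk : (m < k)%N by lia.
rewrite big_ltn // mulrC; have {}IH := IH m.+1 ltac:(lia) mi'.
apply: (eq_Tri (sidx_mv hi hmk) (mv_sidx hi hmk)).
have vl : val (mv m.+1 i (inord m)) = m.
  by rewrite val_mv ?val_inord //; try lia; have := mvnP m.+1 i m; lia.
have vr : val (mv m.+1 i (inord m.+1)) = i.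
  by rewrite val_mv ?val_inord //; try lia; have := mvnP m.+1 i m.+1; lia.
pose w (mu : expo) : F := if mu (inord m) < mu (inord m.+1) then s else s^-1.
have -> : wt a i m = w (pb (mv m.+1 i) a).
  have el : mv m.+1 i (inord m) = inord m :> 'I_n.
    by apply: val_inj; rewrite vl val_inord //; lia.
  have er : mv m.+1 i (inord m.+1) = i by exact: val_inj.
  rewrite /w !ffunE el er /wt /ahead; have -> : (nat_of_ord (inord m : 'I_n) < i)%N by rewrite inordK; lia.
  by rewrite andbT; case: ltgtP.
apply: (Tri_step (A := Tinv s m) (w := w)) => //.
- by apply: mvK; lia.
- by apply: mvK; lia.
- move=> mu b /(Tinv_mono_supp hmk)[->|[-> lt]|ins]; first by constructor 1.
    by constructor 2; split => //; rewrite /lowers vl vr mi' lt.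
  by constructor 3.
by move=> mu; rewrite Tinv_mono_sw.
Qed.

Lemma Tri_phase2 (i : 'I_n) a f c m : (i <= m)%N -> (m <= k)%N -> Tri (mv i k) (mv k i) f a c ->
  Tri (mv i m) (mv m i) (foldr (fun j g => Top s j g) f (iota m (k - m))) a
    (c * \prod_(m <= p < k) wt a i p.+1).
Proof.
move=> + + tri0; move e : (k - m)%N => u; elim: u m e => [|u IH] m e im mk.
  have -> : m = k by lia.
  by rewrite big_geq // mulr1.
have hi := ltn_ord i; have hmk : (m < k)%N by lia.
rewrite big_ltn // [wt _ _ _ * _]mulrC mulrA.
have {}IH := IH m.+1 ltac:(lia) ltac:(lia) hmk.
apply: (eq_Tri (sidx_mv hi hmk) (mv_sidx hi hmk)).
have vl : val (mv m.+1 i (inord m)) = m.+1.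
  by rewrite val_mv ?val_inord //; try lia; have := mvnP m.+1 i m; lia.
have vr : val (mv m.+1 i (inord m.+1)) = i.
  by rewrite val_mv ?val_inord //; try lia; have := mvnP m.+1 i m.+1; lia.
pose w (mu : expo) : F := if mu (inord m) <= mu (inord m.+1) then s else s^-1.
have -> : wt a i m.+1 = w (pb (mv m.+1 i) a).
  have el : mv m.+1 i (inord m) = inord m.+1 :> 'I_n.
    by apply: val_inj; rewrite vl val_inord //; lia.
  have er : mv m.+1 i (inord m.+1) = i by exact: val_inj.
  rewrite /w !ffunE el er /wt /ahead.
  have -> : (nat_of_ord (inord m.+1 : 'I_n) < i)%N = false by rewrite inordK; lia.
  by rewrite andbF orbF; case: ltgtP.
apply: (Tri_step (A := Top s m) (w := w)) => //.
- by apply: mvK; lia.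
- by apply: mvK; lia.
- move=> mu b /(Top_mono_supp hmk)[->|[-> lt]|ins]; first by constructor 1.
    by constructor 2; split => //; rewrite /lowers vl vr lt ltnS im orbT.
  by constructor 3.
by move=> mu; rewrite Top_mono_sw.
Qed.

Hypothesis s0 : s != 0.

Lemma rk_ahead a (i : 'I_n) : rk a i = #|[pred j : 'I_n | ahead a i j]|.
Proof. by []. Qed.

(** Of the k crossings, [rk a i] contribute s^-1 and the others s. *)
Lemma prod_wt a (i : 'I_n) : (\prod_(0 <= p < i) wt a i p) * \prod_(i <= p < k) wt a i p.+1
  = s ^ (k%:Z - 2 * (rk a i)%:Z).
Proof.
have -> : \prod_(i <= p < k) wt a i p.+1 = \prod_(i.+1 <= p < n) wt a i p.
  by rewrite big_add1.
have notself : ahead a i i = false by rewrite /ahead ltxx ltnn andbF.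
have all : \prod_(p < n) (if ahead a i p then s^-1 else s) =
    s * ((\prod_(0 <= p < i) wt a i p) * \prod_(i.+1 <= p < n) wt a i p).
  have -> : \prod_(p < n) (if ahead a i p then s^-1 else s) = \prod_(0 <= p < n) wt a i p.
    by rewrite big_mkord; apply: eq_bigr => p _; rewrite /wt inord_val.
  rewrite (@big_cat_nat _ _ _ i 0 n) //=; last by apply: ltnW; apply: ltn_ord.
  by rewrite (@big_ltn _ _ _ i n) //= {2}/wt inord_val notself mulrCA.
apply: (mulfI s0); rewrite -all.
rewrite (bigID (ahead a i)) /= (eq_bigr (fun=> s^-1)) => [|p ->] //.
rewrite [X in _ * X](eq_bigr (fun=> s)) => [|p /negPf ->] //.
rewrite !prodr_const; have := cardC (ahead a i); rewrite card_ord.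
have -> : #|(fun p : 'I_n => ahead a i p)| = rk a i by [].
have -> : #|[predC ahead a i]| = #|(fun p : 'I_n => ~~ ahead a i p)| by [].
move: (#|(fun p : 'I_n => ~~ ahead a i p)|) => u e.
have -> x : s * s ^ x = s ^ (1 + x) by rewrite expfzDr // expr1z.
rewrite exprVn exprnN -[s ^+ u]/(s ^ u%:Z) -expfzDr //; congr (_ ^ _).
by move: e; move: (rk a i) => v; lia.
Qed.

Lemma Tri_Yop (i : 'I_n) a : Tri id id (Yop s q i (mono F a)) a (eig s q a i).
Proof.
have t0 : Tri (mv i i) (mv i i) (mono F a) a 1.
  split; first by rewrite (eq_pb a (mv_id i)) mcoeff_mono (_ : pb id a = a) ?eqxx //; apply/ffunP => p; rewrite ffunE.
  move=> mu; rewrite -mcoeff_neq0 mcoeff_mono; case: (a =P mu) => [<- _|]; last by rewrite eqxx.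
  by rewrite (eq_pb a (mv_id i)) /ple (_ : pb id a = a) ?eqxx //; apply/ffunP => p; rewrite ffunE.
have := Tri_omega (Tri_phase1 (leq0n i) t0); rewrite subn0.
have hi := ltn_ord i.
move/(eq_Tri (opred_mv hi) (mv_osucc hi)).
have -> : mv 0 i ord0 = i.
  by apply: val_inj; rewrite val_mv //; have := mvnP 0 i 0; rewrite /=; lia.
have ik : (i <= k)%N by [].
move/(Tri_phase2 (leqnn i) ik)/(eq_Tri (mv_id i) (mv_id i)).
by rewrite mulrAC prod_wt.
Qed.

End Triangularity.

(** * Weights and ranks *)

Section Ranks.
Variable (k : nat).
Local Notation n := k.+1.
Local Notation expo := (expo n).
Implicit Types (a lam mu : expo) (i p : 'I_n) (j : nat).

Lemma rk_sum a i : rk a i = (\sum_p ahead a i p)%N.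
Proof. by rewrite rk_ahead -sum1_card big_mkcond /=; apply: eq_bigr => p _; rewrite inE; case: ahead. Qed.

Lemma ahead_trans a : transitive (fun x y => ahead a y x).
Proof. by move=> y x z; rewrite /ahead; lia. Qed.
Lemma ahead_irr a i : ahead a i i = false.
Proof. by rewrite /ahead ltxx ltnn andbF. Qed.
Lemma ahead_total a i p : i != p -> ahead a i p || ahead a p i.
Proof. by rewrite -val_eqE /ahead /=; lia. Qed.

Lemma rk_lt a i : (rk a i <= k)%N.
Proof.
have e : #|predC1 i| = k by rewrite cardC1 card_ord.
rewrite -[X in (_ <= X)%N]e rk_ahead; apply/subset_leq_card/subsetP => p.
by rewrite !inE; apply: contraTneq => ->; rewrite -/(ahead a i i) ahead_irr.
Qed.

Lemma rk_ltn a i p : ahead a i p -> (rk a p < rk a i)%N.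
Proof.
move=> h; rewrite !rk_ahead; apply/proper_card/properP; split.
  by apply/subsetP => x; rewrite !inE => hx; apply: ahead_trans hx h.
by exists p; rewrite !inE ?h ?ahead_irr.
Qed.

Lemma rk_inj a : injective (rk a).
Proof.
move=> i p e; apply/eqP; apply: contraT => /(ahead_total a) /orP[] /rk_ltn;
  by rewrite e ltnn.
Qed.

Lemma rk_surj a (m : nat) : (m <= k)%N -> exists i, rk a i = m.
Proof.
move=> hm; pose r i : 'I_n := inord (rk a i).
have rI : injective r.
  by move=> i p /(congr1 val); rewrite !val_inord ?ltnS ?rk_lt // => /rk_inj.
exists (invF rI (inord m)); have := f_invF rI (inord m) => /(congr1 val).
by rewrite !val_inord ?ltnS ?rk_lt.
Qed.

Lemma rk_sw lam j i : (j < k)%N -> lam (inord j) != lam (inord j.+1) ->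
  rk (sw_expo j lam) i = rk lam (sidx j i).
Proof.
move=> hj ne; rewrite !rk_sum [RHS](reindex_inj (can_inj (sidxK hj))) /=.
apply: eq_bigr => p _; congr nat_of_bool; rewrite /ahead !ffunE.
case: (altP (lam (sidx j p) =P lam (sidx j i))) => //= e; rewrite ?orbF //.
have [->|pi] := eqVneq p i; first by rewrite !ltnn.
congr (_ || _); rewrite -![nat_of_ord _]/(val _).
have pi' : val p != val i by [].
have sl : sidx j (inord j) = inord j.+1 :> 'I_n by rewrite sidx_l ?val_inord //; lia.
have sr : sidx j (inord j.+1) = inord j :> 'I_n by rewrite sidx_r ?val_inord.
have np : (val p = j /\ val i = j.+1 -> False) /\ (val p = j.+1 /\ val i = j -> False).
  have vj (x : 'I_n) (m : nat) : (m < n)%N -> val x = m -> x = inord m.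
    by move=> hm e1; apply: val_inj; rewrite val_inord.
  split=> -[/vj e1 /vj e2]; move: e ne; rewrite e1 ?e2; try lia;
    by rewrite !(sl, sr) => ->; rewrite eqxx.
rewrite !val_sidx //; move: pi' np; move: (val p) (val i) => x y.
by do ?case: eqP; lia.
Qed.

Lemma rk_next lam j : (j < k)%N -> lam (inord j) = lam (inord j.+1) ->
  rk lam (inord j.+1) = (rk lam (inord j)).+1.
Proof.
move=> hj e; rewrite !rk_sum (bigD1 (inord j)) //= [in RHS](bigD1 (inord j)) //=.
rewrite ahead_irr add0n.
have -> : ahead lam (inord j.+1) (inord j).
  by rewrite /ahead e ltxx eqxx /= !inordK; lia.
rewrite add1n; congr S; apply: eq_bigr => p pj; congr nat_of_bool.
rewrite /ahead e; have : nat_of_ord p != j by move: pj; rewrite neq_inord //; lia.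
by rewrite !inordK; lia.
Qed.

(** The exponent of x_n omega(x^lam) up to a scalar: (l_0, ..., l_k) becomes (l_1, ..., l_k, l_0 +
    1). *)
Definition pie lam : expo := ebump (pb (@osucc k) lam) (inord k) 1.

Lemma pieE lam i : pie lam i = lam (osucc i) + (val i == k)%:Z.
Proof.
rewrite !ffunE -val_eqE /= inordK //; case: eqP => _; rewrite ?addr0 //.
Qed.

(** The first entry wins its ties and the last one loses them. Adding 1 to the moved entry
    compensates, because x + 1 > y is equivalent to x >= y for integers. *)
Lemma rk_pie lam i : rk (pie lam) i = rk lam (osucc i).
Proof.
rewrite !rk_sum [RHS](reindex_inj (can_inj (@osuccK k))) /=.
apply: eq_bigr => p _; congr nat_of_bool; rewrite /ahead !pieE.
rewrite -![nat_of_ord _]/(val _) !val_osucc -![nat_of_ord _]/(val _).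
have : (val p < n)%N := ltn_ord p; have : (val i < n)%N := ltn_ord i.
have : val i = val p -> osucc i = osucc p by move/val_inj ->.
move: (val i) (val p) => x y; move=> h hx hy.
have [exy|nxy] := eqVneq x y.
  by rewrite exy (h exy) !ltxx !ltnn !andbF.
move: (lam _) (lam _) => u v {h}.
by case: (altP (x =P k)) => hk1; case: (altP (y =P k)) => hk2; rewrite /= ?addr0; lia.
Qed.

Lemma sum_pie (g : int -> int) lam :
  \sum_i g (pie lam i) + g (lam ord0) = \sum_i g (lam i) + g (lam ord0 + 1).
Proof.
have omax : osucc ord_max = ord0 :> 'I_n by apply: val_inj; rewrite val_osucc eqxx.
rewrite [in RHS](reindex_inj (can_inj (@osuccK k))) [in LHS](bigD1 ord_max) //.
rewrite [in RHS](bigD1 ord_max) // pieE omax eqxx.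
have -> : \sum_(i < n | i != ord_max) g (pie lam i) = \sum_(i < n | i != ord_max) g (lam (osucc i)).
  apply: eq_bigr => i ne.
  by rewrite pieE (_ : (val i == k) = false) ?addr0 //; apply: negbTE ne.
by rewrite /=; ring.
Qed.

Definition pieinv lam : expo := [ffun i => if i == ord0 then lam ord_max - 1 else lam (opred i)].

Lemma pieinvK : cancel pieinv pie.
Proof.
move=> lam; apply/ffunP => i; rewrite pieE ffunE.
have -> : (osucc i == ord0) = (val i == k) by rewrite -[LHS]/(val (osucc i) == 0%N) val_osucc; case: (val i == k).
case: eqP => [e|_]; last by rewrite osuccK addr0.
by rewrite subrK; congr (lam _); apply: val_inj; rewrite e.
Qed.

(* Any weight is reached from 0 by rotations [pie^(+-1)] and swaps putting the
   larger of two neighbouring entries first. *)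
Lemma expo_ind (Q : expo -> Prop) :
  Q 0 -> (forall lam, Q lam -> Q (pie lam)) -> (forall lam, Q (pie lam) -> Q lam) ->
  (forall lam j, (j < k)%N -> lam (inord j) < lam (inord j.+1) -> Q lam -> Q (sw_expo j lam)) ->
  forall lam, Q lam.
Proof.
move=> Q0 Qpi Qpi' Qsw.
pose sq (x : int) := x * x.
have sq0 x : 0 <= sq x by rewrite /sq; nia.
(* The induction is lexicographic in [N] and [V]. Undoing a descent preserves [N] and lowers [V],
   the squared distance to (0, 1, ..., k). For an ascending weight, rotating a positive last entry
   back or a negative first entry forward lowers [N]; if neither exists the weight is 0. *)
pose N lam : int := \sum_i sq (lam i).
pose V lam : int := \sum_i sq (lam i - (val i)%:Z).
have N0 lam : 0 <= N lam by apply: sumr_ge0.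
have V0 lam : 0 <= V lam by apply: sumr_ge0.
suff main (u v : nat) lam : N lam < u%:Z -> V lam < v%:Z -> Q lam.
  move=> lam; apply: (main (`|N lam|.+1) (`|V lam|.+1)).
    by have := N0 lam; lia.
  by have := V0 lam; lia.
elim: u v lam => [|u IHu] v lam; first by have := N0 lam; lia.
elim: v lam => [|v IHv] lam; first by have := V0 lam; lia.
move=> hN hV.
case: (boolP [exists j : 'I_k, lam (inord j.+1) < lam (inord j)]) => [/existsP[j lt]|asc].
  have hj := ltn_ord j; rewrite -(swK lam hj); apply: Qsw => //.
    by rewrite sw_l // sw_r.
  apply: IHv.
    rewrite /N (eq_bigr (fun i => sq (lam (sidx j i)))); last by move=> i _; rewrite ffunE.
    by move: hN; rewrite /N (reindex_inj (can_inj (sidxK hj))).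
  apply: lt_le_trans (_ : V lam <= _); last by lia.
  rewrite /V (bigD1 (inord j)) //= (bigD1 (inord j.+1)) ?inord_neqS //=.
  rewrite [in X in _ < X](bigD1 (inord j)) //= [in X in _ < X](bigD1 (inord j.+1)) ?inord_neqS //=.
  rewrite sw_l // sw_r // !inordK //; last by lia.
  rewrite (eq_bigr (fun i => sq (lam i - i%:Z))); last first.
    move=> i; rewrite !neq_inord; try lia.
    by move=> /andP[h1 h2]; rewrite sw_o.
  rewrite !addrA ltrD2r /sq; move: lt; move: (lam _) (lam _) => x y; nia.
have {}asc (j : nat) : (j < k)%N -> lam (inord j) <= lam (inord j.+1).
  move=> hj; have := existsPn asc (Ordinal hj); rewrite /= -leNgt //.
have mono_ (i p : nat) : (i <= p)%N -> (p <= k)%N -> lam (inord i) <= lam (inord p).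
  elim: p => [|p IHp] ip pk; first by rewrite (_ : i = 0%N) //; lia.
  have [->//|ne] := eqVneq i p.+1.
  by apply: le_trans (asc _ pk); apply: IHp; lia.
have lk : lam ord_max = lam (inord k) by congr (lam _); apply: val_inj; rewrite val_inord.
have l0 : lam ord0 = lam (inord 0) by congr (lam _); apply: val_inj; rewrite val_inord.
have [pos|npos] := ltrP 0 (lam ord_max).
  rewrite -(pieinvK lam); apply: Qpi; apply: (IHu (`|V (pieinv lam)|.+1)); last first.
    by have := V0 (pieinv lam); lia.
  have := sum_pie sq (pieinv lam); rewrite pieinvK -/(N lam) -/(N (pieinv lam)).
  rewrite ffunE eqxx subrK; move: hN; move: (N _) (N _) => x y; rewrite /sq.
  by move: pos; move: (lam _) => z; nia.
have [neg|nneg] := ltrP (lam ord0) 0.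
  apply: Qpi'; apply: (IHu (`|V (pie lam)|.+1)); last by have := V0 (pie lam); lia.
  have := sum_pie sq lam; rewrite -/(N lam) -/(N (pie lam)).
  move: hN; move: (N _) (N _) => x y; rewrite /sq.
  by move: neg; move: (lam _) => z; nia.
suff -> : lam = 0 by [].
apply/ffunP => i; rewrite ffunE; apply/le_anti; have hi := ltn_ord i.
have h1 := mono_ i k ltac:(lia) (leqnn k); have h2 := mono_ 0%N i isT ltac:(lia).
by rewrite !inord_val -lk -l0 in h1 h2; rewrite (le_trans h1) // (le_trans nneg).
Qed.

End Ranks.

(** * Eigenvectors *)

Section Family.
Variables (F : fieldType) (k : nat) (s q : F).
Local Notation n := k.+1.
Local Notation LP := (LP F n).
Local Notation expo := (expo n).
Implicit Types (f g : LP) (a lam mu : expo) (i p : 'I_n) (j : nat).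

(* The last clause makes the Y-spectrum simple: the quotient of two Y-eigenvalues is
   [s ^ (2 * a) * q ^ b] with [a] a difference of two ranks. *)
Definition qt_generic :=
  [/\ forall m, m.+1%:R != 0 :> F, s != 0, q != 0, (0 < k)%N &
      forall a b : int, `|a| <= k%:Z -> s ^ (2 * a) * q ^ b = 1 -> a = 0 /\ b = 0].

Hypothesis nd : qt_generic.
Let ch0 : forall m, m.+1%:R != 0 :> F. Proof. by case: nd. Qed.
Let s0 : s != 0. Proof. by case: nd. Qed.
Let q0 : q != 0. Proof. by case: nd. Qed.
Let k0 : (0 < k)%N. Proof. by case: nd. Qed.
Let N : forall a b : int, `|a| <= k%:Z -> s ^ (2 * a) * q ^ b = 1 -> a = 0 /\ b = 0.
Proof. by case: nd. Qed.

Lemma eig_neq0 lam i : eig s q lam i != 0.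
Proof. by rewrite /eig mulf_neq0 ?expfz_neq0. Qed.

Lemma eig_ratio lam mu i p : eig s q lam i / eig s q mu p =
  s ^ (2 * ((rk mu p)%:Z - (rk lam i)%:Z)) * q ^ (lam i - mu p).
Proof.
rewrite /eig invfM mulrACA !invr_expz -!expfzDr //; congr (s ^ _ * _).
by rewrite /=; ring.
Qed.

Lemma eig_eq lam mu i p : eig s q lam i = eig s q mu p ->
  rk lam i = rk mu p /\ lam i = mu p.
Proof.
move=> e; have := eig_ratio lam mu i p; rewrite e divff ?eig_neq0 // => /esym /N.
have := rk_lt lam i; have := rk_lt mu p; move=> h1 h2 h; case: h; lia.
Qed.

Lemma eig_sub_neq0 lam i p : i != p -> eig s q lam i - eig s q lam p != 0.
Proof.
move=> ne; rewrite subr_eq0; apply: contraNneq ne => /eig_eq[/rk_inj -> _].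
exact: eqxx.
Qed.

Lemma eig_inj lam mu : (forall i, eig s q lam i = eig s q mu i) -> lam = mu.
Proof. by move=> e; apply/ffunP => i; case: (eig_eq (e i)). Qed.

Lemma eig_sw lam j i : (j < k)%N -> lam (inord j) != lam (inord j.+1) ->
  eig s q (sw_expo j lam) i = eig s q lam (sidx j i).
Proof. by move=> hj ne; rewrite /eig rk_sw // ffunE. Qed.

Lemma eig_pie lam i :
  eig s q (pie lam) i = (if val i == k then q else 1) * eig s q lam (osucc i).
Proof.
rewrite /eig rk_pie pieE (expfzDr _ _ q0).
have -> (b : bool) : q ^ b%:Z = if b then q else 1.
  by case: b; [exact: expr1 | exact: expr0].
by case: eqP => _; rewrite ?mul1r ?mulr1 // !mulrA mulrC mulrA.
Qed.

Definition YEigen (y : 'I_n -> F) f := forall i, Yop s q i f = y i *: f.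

Let T j : {linear LP -> LP} := Top s j.
Let X j : {linear LP -> LP} := Xop (inord j).
Let om : {linear LP -> LP} := @omega F n q.
Let Y := Ynat k (s - s^-1) T om.

Let YopY i f : Yop s q i f = Y i f. Proof. by []. Qed.

Let hT'K j f : (j < k)%N -> Tneg (s - s^-1) T j (T j f) = f.
Proof. exact: (TinvK ch0 s0). Qed.
Let hTK j f : (j < k)%N -> T j (Tneg (s - s^-1) T j f) = f.
Proof. exact: (TopK ch0 s0). Qed.
Let hbraid j f : (j.+1 < k)%N -> T j (T j.+1 (T j f)) = T j.+1 (T j (T j.+1 f)).
Proof. exact: (braid ch0 s0). Qed.
Let hcomm (i j : nat) f : (i.+1 < j)%N -> (j < k)%N -> T i (T j f) = T j (T i f).
Proof. exact: (Top_comm ch0 s0). Qed.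
Let homT j f : (j.+1 < k)%N -> om (T j.+1 f) = T j (om f).
Proof. exact: (omega_Top ch0 s0 q0). Qed.
Let hom2T f : (0 < k)%N -> om (om (T 0%N f)) = T k.-1 (om (om f)).
Proof. exact: (omega2_Top ch0 s0 q0). Qed.
Let hTXT j f : (j < k)%N -> T j (X j (T j f)) = X j.+1 f.
Proof. exact: (TXT ch0 s0). Qed.
Let hXT (i j : nat) f : (j < k)%N -> (i <= k)%N -> i != j -> i != j.+1 -> X i (T j f) = T j (X i f).
Proof. exact: (Xop_Top ch0 s0). Qed.
Let homX j f : (j < k)%N -> om (X j.+1 f) = X j (om f).
Proof. exact: (omega_Xop ch0 s0 q0). Qed.
Let homX0 f : om (X 0%N f) = q *: X k (om f).
Proof. exact: (omega_Xop0 ch0 q0). Qed.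

Definition PiL f := Xop (inord k) (omega q f).
Definition PiLinv f := omegainv q (Xinv (inord k) f).

Lemma PiLinvK f : PiL (PiLinv f) = f.
Proof. by rewrite /PiL /PiLinv omegainvK // XinvK. Qed.
Lemma PiLK f : PiLinv (PiL f) = f.
Proof. by rewrite /PiL /PiLinv XopK // omegaK. Qed.

Lemma YEigenE y f : YEigen y f <-> Yeigen k (s - s^-1) T om (fun m : nat => y (inord m)) f.
Proof.
split=> h; first by move=> i hi; have := h (inord i); rewrite YopY inordK.
by move=> i; rewrite YopY /Y h ?inord_val // -ltnS.
Qed.

Lemma YEigen_ext y y' f : (forall i, y i = y' i) -> YEigen y f -> YEigen y' f.
Proof. by move=> e h i; rewrite -e. Qed.

Lemma Yeigen_ext (y y' : nat -> F) f : (forall m, (m <= k)%N -> y m = y' m) ->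
  Yeigen k (s - s^-1) T om y f -> Yeigen k (s - s^-1) T om y' f.
Proof. by move=> e h i hi; rewrite -e ?h. Qed.

Lemma YEigen_Top y j f : (j < k)%N -> y (inord j.+1) - y (inord j) != 0 -> YEigen y f ->
  YEigen (y \o sidx j)
   (Top s j f + ((s - s^-1) * y (inord j) / (y (inord j.+1) - y (inord j))) *: f).
Proof.
move=> hj yy /YEigenE h; apply/YEigenE.
have := Yeigen_T hT'K hTK hbraid hcomm homT hj yy h; apply: Yeigen_ext => i hi.
congr (y _); apply: val_inj; rewrite val_sidx // !val_inord //.
rewrite /swn; case: ifP => _; first by rewrite /=; lia.
by case: ifP => _; rewrite /=; lia.
Qed.

Lemma rotE (y : 'I_n -> F) m : (m <= k)%N ->
  (if val (inord m : 'I_n) == k then q else 1) * y (osucc (inord m)) =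
  (if m == k then q * y (inord 0) else y (inord m.+1)).
Proof.
move=> hm; rewrite val_inord //; have osE : val (osucc (inord m : 'I_n)) = if m == k then 0%N else m.+1.
  by rewrite val_osucc val_inord // inordK.
case: eqP osE => [_|ne] e; [congr (_ * y _)|rewrite mul1r; congr (y _)];
  by apply: val_inj; rewrite val_inord //; lia.
Qed.

Lemma YEigen_Pi y f : YEigen y f ->
  YEigen (fun i => (if val i == k then q else 1) * y (osucc i)) (PiL f).
Proof.
move=> /YEigenE h; apply/YEigenE.
have := Yeigen_Pi hT'K hTK homT hom2T hTXT hXT homX homX0 k0 h.
by apply: Yeigen_ext => m hm; rewrite rotE.
Qed.

Lemma YEigen_Pi_inv y f :
  YEigen (fun i => (if val i == k then q else 1) * y (osucc i)) (PiL f) -> YEigen y f.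
Proof.
move=> /YEigenE h; apply/YEigenE.
apply: (Yeigen_Pi_inv hT'K hTK homT hom2T hTXT hXT homX homX0 k0 q0 (can_inj PiLK)).
by apply: Yeigen_ext h => m hm; rewrite rotE.
Qed.

Lemma Yop_is_linear i : linear (@Yop F n s q i).
Proof. by move=> c f g; rewrite !YopY /Y linearP. Qed.
HB.instance Definition _ i := GRing.isLinear.Build F LP LP _ (Yop s q i) (Yop_is_linear i).

Lemma Yop_mono_supp i a b : (Yop s q i (mono F a))@_b != 0 -> ple b a.
Proof.
case: (Tri_Yop q s0 i a) => _ h; rewrite mcoeff_neq0 => /h.
by rewrite (_ : pb id b = b) //; apply/ffunP => x; rewrite ffunE.
Qed.

Lemma Yop_mono_diag i a : (Yop s q i (mono F a))@_a = eig s q a i.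
Proof.
case: (Tri_Yop q s0 i a) => <- _; congr mcoeff.
by apply/ffunP => x; rewrite ffunE.
Qed.

Lemma exists_maximal (r : seq expo) nu : nu \in r ->
  exists mu, [/\ mu \in r, ple nu mu & forall x, x \in r -> ~~ prec mu x].
Proof.
have [m] := ubnP (count (prec nu) r); elim: m nu => // m IH nu hm nur.
case: (boolP (has (prec nu) r)) => [/hasP[x xr nx]|/hasPn h]; last first.
  by exists nu; split => //; rewrite /ple eqxx.
have lt : (count (prec x) r < count (prec nu) r)%N.
  have sub y : y \in r -> prec x y -> prec nu y by move=> _; apply: prec_trans.
  elim: r xr {IH hm nur} sub => [//|y r IHr]; rewrite in_cons /= => /orP[/eqP e|xr] sub.
    rewrite -e prec_irr nx add0n add1n ltnS.
    by apply: sub_count => z; apply: prec_trans.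
  have h1 : (prec x y <= prec nu y)%N.
    by case: (boolP (prec x y)) => // /(prec_trans nx) ->.
  have h2 : (count (prec x) r < count (prec nu) r)%N.
    by apply: IHr => // z zr; apply: prec_trans.
  by rewrite -addnS leq_add.
have [mu [mur xmu mumax]] := IH x (leq_trans lt hm) xr.
exists mu; split => //; apply: prec_ple; exact: prec_ple_trans nx xmu.
Qed.

(** At an exponent mu maximal in the support, triangularity lets only the term of exponent mu
    contribute to that coefficient of [Yop i f], so [y i] must be the diagonal entry. *)
Lemma YEigen_maximal y f nu : YEigen y f -> nu \in msupp f ->
  exists mu, [/\ mu \in msupp f, ple nu mu & forall i, y i = eig s q mu i].
Proof.
move=> ef /exists_maximal[mu [muf numu mumax]]; exists mu; split => // i.
have /(congr1 (mcoeff mu)) := ef i; rewrite mcoeffZ mcoeff_linear.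
rewrite (big_fsetD1 mu muf) big_seq big1 ?addr0; last first.
  move=> x; rewrite in_fsetD1 => /andP[xmu xf]; apply/eqP; rewrite mulf_eq0.
  apply/orP; right; apply/negPn/negP => /Yop_mono_supp.
  by rewrite /ple eq_sym (negPf xmu) (negPf (mumax x xf)).
by rewrite /= Yop_mono_diag addr0 mulrC => /mulIf e; rewrite e // mcoeff_neq0.
Qed.

(** The counterpart of [isE] over an arbitrary field with parameters s and q, so that it applies
    both before and after specialization. *)
Definition isEg lam f := [/\ f@_lam = 1, forall mu, mu \in msupp f -> ple mu lam &
  YEigen (eig s q lam) f].

(** Triangularity is automatic: above any exponent of f lies a maximal one with the same Y-spectrum,
    and by simplicity of the spectrum that is lam. *)
Lemma isEg_intro lam f : f@_lam = 1 -> YEigen (eig s q lam) f -> isEg lam f.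
Proof.
move=> f1 ef; split => // mu /(YEigen_maximal ef)[nu [_ h e]].
by rewrite (eig_inj e).
Qed.

Lemma isEg_uniq lam f g : isEg lam f -> isEg lam g -> f = g.
Proof.
move=> [f1 _ ef] [g1 _ eg]; apply/eqP; rewrite -subr_eq0; apply: contraT => fg.
have efg : YEigen (eig s q lam) (f - g).
  by move=> i; rewrite linearB /= ef eg scalerBr.
have [nu nufg] : exists nu, nu \in msupp (f - g).
  apply/fset0Pn; apply: contraNneq fg => e; apply/eqP/malgP => a.
  by rewrite mcoeff0 mcoeff_outdom // e.
have [mu [muf _ e]] := YEigen_maximal efg nufg.
move: muf; rewrite -(eig_inj e) -mcoeff_neq0 mcoeffB f1 g1 subrr eqxx //.
Qed.

Lemma YEigen_eq0 y f : YEigen y f -> (forall mu, ~ forall i, y i = eig s q mu i) -> f = 0.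
Proof.
move=> ef h; apply/malgP => a; rewrite mcoeff0; apply: mcoeff_outdom.
by apply/negP => /(YEigen_maximal ef)[mu [_ _ /h]].
Qed.

End Family.

(** * The recursion for the eigenvectors *)

Section Recursion.
Variables (F : fieldType) (k : nat) (s q : F).
Local Notation n := k.+1.
Local Notation LP := (LP F n).
Local Notation expo := (expo n).
Implicit Types (f g : LP) (a lam mu : expo) (i p : 'I_n) (j : nat).

Hypothesis nd : qt_generic k s q.
Let ch0 : forall m, m.+1%:R != 0 :> F. Proof. by case: nd. Qed.
Let s0 : s != 0. Proof. by case: nd. Qed.
Let q0 : q != 0. Proof. by case: nd. Qed.
Let k0 : (0 < k)%N. Proof. by case: nd. Qed.
Let N : forall a b : int, `|a| <= k%:Z -> s ^ (2 * a) * q ^ b = 1 -> a = 0 /\ b = 0.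
Proof. by case: nd. Qed.

Lemma s2_neq1 : s ^+ 2 - 1 != 0.
Proof.
rewrite subr_eq0; apply/negP => /eqP e.
have [] := N (a := 1) (b := 0); rewrite ?normr1 ?expr0z ?mulr1 //; lia.
Qed.

Lemma Top_mono0 j : (j < k)%N -> Top s j (mono F 0) = s *: mono F (0 : expo).
Proof.
move=> hj; rewrite /Top linext_mono Dmono_eq //; last by rewrite !avE ?ffunE //; lia.
by rewrite scaler0 addr0; congr (_ *: mono _ _); apply/ffunP => i; rewrite !ffunE.
Qed.

Lemma Tinv_mono0 j : (j < k)%N -> Tinv s j (mono F 0) = s^-1 *: mono F (0 : expo).
Proof. by move=> hj; rewrite /Tinv Top_mono0 // -scalerBl opprB addrC subrK. Qed.

Lemma omega_mono a : omega q (mono F a) = q ^ (a ord0) *: mono F (pb (@osucc k) a).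
Proof.
rewrite /omega linext_mono (avE a (ltn0Sn k)); congr (q ^ a _ *: _).
by apply: val_inj; rewrite val_inord.
Qed.

Lemma Yop_mono0 i : exists c, Yop s q i (mono F 0) = c *: mono F (0 : expo).
Proof.
have fold (A : nat -> {linear LP -> LP}) (r : seq nat) f :
    (forall j, j \in r -> exists c, A j (mono F 0) = c *: mono F (0 : expo)) ->
    (exists c, f = c *: mono F (0 : expo)) ->
    exists c, foldr (fun j g => A j g) f r = c *: mono F (0 : expo).
  move=> + [c0 ->]; elim: r => [|j r IH] h; first by exists c0.
  have [|c /= ->] := IH; first by move=> u ur; apply: h; rewrite in_cons ur orbT.
  have [d e] := h j (mem_head _ _); exists (c * d).
  by rewrite linearZ /= e scalerA.
have hi := ltn_ord i; apply: (fold (fun j => Top s j)).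
  by move=> j; rewrite mem_iota => hj; exists s; apply: Top_mono0; move: hj => /=; lia.
have [| |c ->] := fold (fun j => Tinv s j) (iota 0 i) (mono F 0).
- by move=> j; rewrite mem_iota => hj; exists s^-1; apply: Tinv_mono0; lia.
- by exists 1; rewrite scale1r.
exists c; rewrite linearZ /= omega_mono ffunE expr0z scale1r.
by congr (_ *: mono _ _); apply/ffunP => p; rewrite !ffunE.
Qed.

Lemma isEg_0 : isEg s q 0 (mono F (0 : expo)).
Proof.
apply: (isEg_intro nd); first by rewrite mcoeff_mono eqxx.
move=> i; have [c e] := Yop_mono0 i; rewrite e; congr (_ *: _).
have := Yop_mono_diag nd i (0 : expo); rewrite e mcoeffZ mcoeff_mono eqxx mulr1 //.
Qed.

Definition icoef lam j := (s - s^-1) * eig s q lam (inord j) /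
  (eig s q lam (inord j.+1) - eig s q lam (inord j)).

Lemma YEigen_scale y c f : YEigen s q y f -> YEigen s q y (c *: f).
Proof. by move=> h i; rewrite linearZ /= h !scalerA mulrC. Qed.

Lemma prec_sw lam j : (j < k)%N -> lam (inord j) < lam (inord j.+1) -> prec lam (sw_expo j lam).
Proof.
move=> hj lt; have e : dplus (sw_expo j lam) = dplus lam.
  rewrite (_ : sw_expo j lam = pb (sidx j) lam); last by apply/ffunP => i; rewrite !ffunE.
  by rewrite dplus_pb //; apply: can_inj (sidxK hj).
rewrite /prec e eqxx; apply/orP; right.
apply: (@dom_lt_swap _ _ _ (inord j) (inord j.+1)); rewrite ?sw_l ?sw_r //.
  by rewrite !inordK; lia.
by move=> i; rewrite !neq_inord; try lia; move=> h1 h2; rewrite sw_o.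
Qed.

(** The normalization is s^-1 because on an ascent the swapped monomial has coefficient s in T_j,
    and no term of f below lam can reach it. *)
Lemma isEg_up lam j f : (j < k)%N -> lam (inord j) < lam (inord j.+1) ->
  isEg s q lam f -> isEg s q (sw_expo j lam) (s^-1 *: (Top s j f + icoef lam j *: f)).
Proof.
move=> hj lt [f1 fsupp ef]; have jj : inord j.+1 != inord j :> 'I_n by exact: inord_neqS.
apply: (isEg_intro nd); last first.
  apply: YEigen_scale; have := YEigen_Top nd hj (eig_sub_neq0 nd lam jj) ef.
  by apply: YEigen_ext => i /=; rewrite eig_sw // lt_eqF.
have pl := prec_sw hj lt.
have fsw : f@_(sw_expo j lam) = 0.
  apply: mcoeff_outdom; apply/negP => /fsupp h.
  by have := prec_ple_trans pl h; rewrite prec_irr.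
rewrite mcoeffZ mcoeffD mcoeffZ fsw mulr0 addr0 mcoeff_linear.
have lf : lam \in msupp f by rewrite -mcoeff_neq0 f1 oner_eq0.
rewrite (big_fsetD1 lam lf) big_seq big1; first by rewrite /= addr0 f1 mul1r Top_mono_sw // (ltW lt) mulVf.
move=> mu; rewrite in_fsetD1 => /andP[ne /fsupp mul]; apply/eqP; rewrite mulf_eq0.
apply/orP; right; apply/negPn/negP => /(Top_mono_supp hj)[e|[e _]|ins].
- by case/eqP: ne; rewrite -(swK mu hj) -e swK.
- by move: mul; rewrite -e => /(prec_ple_trans pl); rewrite prec_irr.
- have idI : injective (@id 'I_n) by [].
  have := inside_prec hj idI idI ins.
  have pbid nu : pb id nu = nu by apply/ffunP => i; rewrite ffunE.
  rewrite !pbid => h; have := prec_trans pl (prec_ple_trans h mul).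
  by rewrite prec_irr.
Qed.

(** Equal neighbouring entries have consecutive ranks, so the ratio of their eigenvalues is s^-2. *)
Lemma icoef_eq lam j : (j < k)%N -> lam (inord j) = lam (inord j.+1) -> icoef lam j = - s.
Proof.
move=> hj e; rewrite /icoef.
have -> : eig s q lam (inord j.+1) = eig s q lam (inord j) * s ^- 2.
  rewrite /eig rk_next // -e mulrAC; congr (_ * _).
  rewrite exprnN -expfzDr //; congr (s ^ _); lia.
set y := eig _ _ _ _; have y0 : y != 0 by apply: (eig_neq0 nd).
have s21 := s2_neq1; field.
rewrite s0 (_ : y + - y * s ^+ 2 = - (y * (s ^+ 2 - 1))); last by ring.
by rewrite oppr_eq0 mulf_neq0.
Qed.

(** The intertwiner is here [Top s j - s], and its image would carry the spectrum of lam with two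
    values exchanged. The entries would force this to be the spectrum of lam itself, but the ranks
    differ; so the image is 0. *)
Lemma isEg_eq lam j f : (j < k)%N -> lam (inord j) = lam (inord j.+1) ->
  isEg s q lam f -> Top s j f = s *: f.
Proof.
move=> hj e [_ _ ef]; have jj : inord j.+1 != inord j :> 'I_n by exact: inord_neqS.
have := YEigen_Top nd hj (eig_sub_neq0 nd lam jj) ef; rewrite -/(icoef lam j) icoef_eq //.
move=> /(YEigen_eq0 nd) h; apply/eqP; rewrite -subr_eq0 -scaleNr; apply/eqP/h => mu emu.
have sl : sidx j (inord j) = inord j.+1 :> 'I_n by rewrite sidx_l ?val_inord //; lia.
have sr : sidx j (inord j.+1) = inord j :> 'I_n by rewrite sidx_r ?val_inord.
have lm : lam = mu.
  apply/ffunP => i; have [_ <-] := eig_eq nd (emu i).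
  have [->|h1] := eqVneq i (inord j); first by rewrite sl.
  have [->|h2] := eqVneq i (inord j.+1); first by rewrite sr.
  by rewrite sidx_far // -neq_inord //; lia.
by have [] := eig_eq nd (emu (inord j)); rewrite /= sl -lm => /rk_inj/eqP; rewrite (negPf jj).
Qed.

Lemma pie_inj : injective (@pie k).
Proof.
move=> lam mu e; apply/ffunP => i; have := congr1 (fun a : expo => a (opred i)) e.
by rewrite !pieE opredK => /addIr.
Qed.

Lemma mcoeff_PiL f lam : (PiL q f)@_(pie lam) = q ^ (lam ord0) * f@_lam.
Proof.
have Pm a : Xop (inord k) (omega q (mono F a)) = q ^ (a ord0) *: mono F (pie a).
  by rewrite omega_mono linearZ /= /Xop linext_mono.
have -> : (PiL q f)@_(pie lam) = \sum_(mu <- msupp f) f@_mu * (q ^ (mu ord0) *: mono F (pie mu))@_(pie lam).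
  rewrite (_ : PiL q f = (Xop (inord k) \o omega q) f) // mcoeff_linear.
  by apply: eq_bigr => mu _; rewrite /= Pm.
rewrite (bigID (pred1 lam)) /= [X in _ + X]big1 ?addr0 => [|mu ne]; last first.
  rewrite mcoeffZ mcoeff_mono; case: eqP => [/pie_inj e|]; last by rewrite !mulr0.
  by rewrite e eqxx in ne.
rewrite -big_filter; case: (boolP (lam \in msupp f)) => lf.
  rewrite (_ : [seq _ <- _ | _] = [:: lam]) ?big_seq1 ?mcoeffZ ?mcoeff_mono ?eqxx ?mulr1 1?mulrC //.
  by apply: filter_pred1_uniq => //; apply: fset_uniq.
rewrite (mcoeff_outdom lf) mulr0 big1_seq // => mu /=.
by rewrite mem_filter => /andP[/eqP -> h]; rewrite h in lf.
Qed.

Lemma isEg_pie lam f : isEg s q lam f -> isEg s q (pie lam) (q ^ (- lam ord0) *: PiL q f).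
Proof.
move=> [f1 _ ef]; apply: (isEg_intro nd).
  by rewrite mcoeffZ mcoeff_PiL f1 mulr1 -expfzDr // addNr expr0z.
apply: YEigen_scale; have := YEigen_Pi nd ef; apply: YEigen_ext => i.
by rewrite eig_pie.
Qed.

Lemma isEg_pie_inv lam g : isEg s q (pie lam) g -> isEg s q lam (q ^ (lam ord0) *: PiLinv q g).
Proof.
move=> [g1 _ eg]; apply: (isEg_intro nd).
  by rewrite mcoeffZ -mcoeff_PiL (PiLinvK nd).
apply: YEigen_scale; apply: (YEigen_Pi_inv nd); rewrite (PiLinvK nd).
by apply: YEigen_ext eg => i; rewrite eig_pie.
Qed.

End Recursion.

(** * Evaluation at spectral points *)

Section Duality.
Variables (F : fieldType) (k d : nat) (s q : F).
Local Notation n := k.+1.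
Local Notation LP := (LP F n).
Local Notation expo := (expo n).
Implicit Types (f g : LP) (a lam mu : expo) (i p : 'I_n) (j : nat) (c : F).

Hypothesis nd : qt_generic k s q.
Hypothesis d0 : (0 < d)%N.
Hypothesis lattice : forall a b : int,
  s ^ (2 * a) * q ^ b = 1 <-> exists m : int, a = m * n%:Z /\ b = m * d%:Z.
Let ch0 : forall m, m.+1%:R != 0 :> F. Proof. by case: nd. Qed.
Let s0 : s != 0. Proof. by case: nd. Qed.
Let q0 : q != 0. Proof. by case: nd. Qed.
Let k0 : (0 < k)%N. Proof. by case: nd. Qed.

Variable e : expo -> LP.
Hypothesis he : forall lam, isEg s q lam (e lam).

Local Notation cc := (icoef s q).

Lemma e_0 : e 0 = mono F (0 : expo).
Proof. exact: (isEg_uniq nd (he 0) (isEg_0 nd)). Qed.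

Lemma e_sw lam j : (j < k)%N -> lam (inord j) < lam (inord j.+1) ->
  e (sw_expo j lam) = s^-1 *: (Top s j (e lam) + cc lam j *: e lam).
Proof. by move=> hj lt; apply: (isEg_uniq nd (he _)); apply: isEg_up. Qed.

Lemma Top_e_up lam j : (j < k)%N -> lam (inord j) < lam (inord j.+1) ->
  Top s j (e lam) = s *: e (sw_expo j lam) - cc lam j *: e lam.
Proof. by move=> hj lt; rewrite e_sw // scalerA mulfV // scale1r addrK. Qed.

Lemma Top_e_eq lam j : (j < k)%N -> lam (inord j) = lam (inord j.+1) ->
  Top s j (e lam) = s *: e lam.
Proof. by move=> hj h; apply: (isEg_eq nd hj h). Qed.

(** Two successive intertwiners compose to a scalar, which supplies the coefficient of [e lam]. *)
Lemma Top_e_down lam j : (j < k)%N -> lam (inord j) < lam (inord j.+1) ->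
  Top s j (e (sw_expo j lam)) = (s^-1 * (1 - cc lam j * (s - s^-1 + cc lam j))) *: e lam
    + (s - s^-1 + cc lam j) *: e (sw_expo j lam).
Proof.
move=> hj lt; set b := s - s^-1 + cc lam j.
have eb : cc lam j + - b = - (s - s^-1) by rewrite /b; ring.
have := @intertwiner_comp _ _ k (s - s^-1) (fun j => Top s j) (TopK ch0 s0) j (e lam)
   (cc lam j) (- b) hj eb.
rewrite e_sw // linearZ /=; move: (b) => {eb}b.
set u := Top s j (e lam) + _; move: (Top s j u) => w /eqP.
rewrite scaleNr subr_eq => /eqP ->; clearbody u; move: (e lam) => e0.
by rewrite mulrN scalerDr !scalerA [s^-1 * b]mulrC.
Qed.

Lemma Pi_e lam : PiL q (e lam) = q ^ (lam ord0) *: e (pie lam).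
Proof.
rewrite (isEg_uniq nd (he (pie lam)) (isEg_pie nd (he lam))) scalerA -expfzDr //.
by rewrite subrr expr0z scale1r.
Qed.

(** Inverting the eigenvalues makes [yratio] at this point the ratio that occurs in [icoef]; thus
    the weight of the point and the weight of an eigenvector obey the same formulas. *)
Definition zpt c mu i := c / eig s q mu i.

Lemma zpt_neq0 c mu i : c != 0 -> zpt c mu i != 0.
Proof. by move=> c0; rewrite mulf_neq0 // invr_eq0; apply: (eig_neq0 nd). Qed.

Lemma zpt_sw c mu j : (j < k)%N -> mu (inord j) != mu (inord j.+1) ->
  zpt c mu \o sidx j =1 zpt c (sw_expo j mu).
Proof. by move=> hj ne i; rewrite /zpt /= eig_sw. Qed.

Lemma om_zpt c mu : om q (zpt c (pie mu)) =1 zpt c mu.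
Proof.
move=> i; rewrite /om /zpt eig_pie // opredK val_opred.
have -> : ((if val i == 0%N then k else (val i).-1) == k) = (val i == 0%N).
  have : (val i < n)%N := ltn_ord i; by case: (altP (val i =P 0%N)) => h; case: eqP => //=; lia.
have en := eig_neq0 nd mu i.
by case: ifP => _; field; rewrite ?q0 ?en.
Qed.

Lemma yratio_zpt c mu j : c != 0 ->
  yratio (zpt c mu) j = eig s q mu (inord j.+1) / eig s q mu (inord j).
Proof.
move=> c0; have e1 := eig_neq0 nd mu (inord j); have e2 := eig_neq0 nd mu (inord j.+1).
by rewrite /yratio /zpt; field; rewrite e1 e2 c0.
Qed.

Lemma ccE mu j : (j < k)%N ->
  cc mu j = (s - s^-1) / (eig s q mu (inord j.+1) / eig s q mu (inord j) - 1).
Proof.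
move=> hj; rewrite /icoef.
have e1 := eig_neq0 nd mu (inord j); have e2 := eig_neq0 nd mu (inord j.+1).
have e3 := eig_sub_neq0 nd mu (inord_neqS hj).
move: e1 e2 e3; move: (eig _ _ _ _) (eig _ _ _ _) => x y x0 y0 xy.
by field; rewrite mulN1r s0 ?x0 ?y0 xy.
Qed.

Lemma ev_Top_zpt c mu j f : c != 0 -> (j < k)%N -> ev (Top s j f) (zpt c mu) =
  (s + cc mu j) * ev f (zpt c mu \o sidx j) - cc mu j * ev f (zpt c mu).
Proof.
move=> c0 hj; have e3 := eig_sub_neq0 nd mu (inord_neqS hj).
have e1 := eig_neq0 nd mu (inord j).
rewrite ev_Top //; last 2 first.
- by move=> i; apply: zpt_neq0.
- rewrite yratio_zpt // -subr_eq0 -[X in _ - X](divff e1) -mulrBl.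
  by rewrite mulf_neq0 ?invr_eq0.
by rewrite yratio_zpt // -ccE //; ring.
Qed.

(** Here the point with swapped coordinates is not of the form [zpt], but its coefficient
    [s + icoef] is 0. *)
Lemma ev_Top_zpt_eq c mu j f : c != 0 -> (j < k)%N -> mu (inord j) = mu (inord j.+1) ->
  ev (Top s j f) (zpt c mu) = s * ev f (zpt c mu).
Proof. by move=> c0 hj h; rewrite ev_Top_zpt // (icoef_eq nd hj h) subrr mul0r sub0r mulNr opprK. Qed.

(* For [n = k + 1] a neighbourhood of type [(k + 1, r - 1)] joins the positions of rank 0
   and k, i.e. the extreme entries of the weight; here [d = r - 1]. *)
Definition S_ mu := forall i p, mu i - mu p < d%:Z \/ (mu i - mu p = d%:Z /\ (p < i)%N).

Lemma S_0 : S_ 0.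
Proof. by move=> i p; left; rewrite !ffunE subrr. Qed.

(** A gap of exactly [d] is tolerated only with the larger entry on the right, so swapping an ascent
    leaves S just when the ascent itself has gap [d]. *)
Lemma S_sw lam j : (j < k)%N -> lam (inord j) < lam (inord j.+1) ->
  S_ (sw_expo j lam) <-> S_ lam /\ lam (inord j.+1) - lam (inord j) <> d%:Z.
Proof.
move=> hj lt.
have vj : nat_of_ord (inord j : 'I_n) = j by rewrite inordK //; lia.
have vj1 : nat_of_ord (inord j.+1 : 'I_n) = j.+1 by rewrite inordK //; lia.
split=> [h|[h ne]].
  have hne : lam (inord j.+1) - lam (inord j) <> d%:Z.
    by move=> hd; have := h (inord j) (inord j.+1); rewrite sw_l // sw_r // vj vj1; lia.
  split=> // i p; have := h (sidx j i) (sidx j p); rewrite !ffunE !sidxK //.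
  case=> [|[hd lt']]; first by left.
  right; split=> //; move: lt'; rewrite -![nat_of_ord _]/(val _) !val_sidx //.
  have vv (x : 'I_n) (m : nat) : (m < n)%N -> val x = m -> x = inord m.
    by move=> hm e1; apply: val_inj; rewrite val_inord.
  have [ij|ij] := eqVneq (val i) j; have [pj|pj] := eqVneq (val p) j;
   have [ij1|ij1] := eqVneq (val i) j.+1; have [pj1|pj1] := eqVneq (val p) j.+1; try lia.
  by move: hd; rewrite (vv _ _ _ ij) ?(vv _ _ _ pj1); lia.
move=> i p; have := h (sidx j i) (sidx j p); rewrite !ffunE.
case=> [|[hd lt']]; first by left.
right; split=> //; move: lt'; rewrite -![nat_of_ord _]/(val _) !val_sidx //.
have [ij|ij] := eqVneq (val i) j; have [pj|pj] := eqVneq (val p) j;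
   have [ij1|ij1] := eqVneq (val i) j.+1; have [pj1|pj1] := eqVneq (val p) j.+1; try lia.
by move: hd; rewrite sidx_l // sidx_r //; lia.
Qed.

Lemma S_pie lam : S_ (pie lam) <-> S_ lam.
Proof.
split=> h i p.
  have := h (opred i) (opred p); rewrite !pieE !opredK -![nat_of_ord _]/(val _) !val_opred.
  have : (val i < n)%N := ltn_ord i; have : (val p < n)%N := ltn_ord p.
  have : val i = val p -> i = p by move/val_inj.
  have [<-|nip] := eqVneq i p.
    by move=> *; left; rewrite subrr.
  have : val i != val p by [].
  move: (lam i) (lam p) (val i) (val p) => u v x y.
  case: (altP (x =P 0%N)) => hx; case: (altP (y =P 0%N)) => hy /=; rewrite ?eqxx;
   do ?[case: (altP (_ =P k)) => ?]; rewrite /= ?addr0; lia.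
have := h (osucc i) (osucc p); rewrite !pieE -![nat_of_ord _]/(val _) !val_osucc -![nat_of_ord _]/(val _).
have : (val i < n)%N := ltn_ord i; have : (val p < n)%N := ltn_ord p.
have [<-|nip] := eqVneq i p.
  by move=> *; left; rewrite subrr.
have : val i != val p by [].
move: (lam _) (lam _) (val i) (val p) => u v x y.
by case: (altP (x =P k)) => hx; case: (altP (y =P k)) => hy /=; rewrite ?addr0; lia.
Qed.

Lemma s_cc_eq0 lam j : (j < k)%N -> (s + cc lam j == 0) =
  (s ^ (2 * (1 + (rk lam (inord j))%:Z - (rk lam (inord j.+1))%:Z))
     * q ^ (lam (inord j.+1) - lam (inord j)) == 1).
Proof.
move=> hj; have e3 := eig_sub_neq0 nd lam (inord_neqS hj).
have e1 := eig_neq0 nd lam (inord j).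
have -> : 2 * (1 + (rk lam (inord j))%:Z - (rk lam (inord j.+1))%:Z) =
  2 + 2 * ((rk lam (inord j))%:Z - (rk lam (inord j.+1))%:Z) :> int by ring.
rewrite (expfzDr 2 _ s0) -mulrA -(eig_ratio nd) -[s ^ 2]/(s ^+ 2).
set R := eig _ _ _ _ / _.
have R1 : R - 1 != 0.
  by rewrite /R -[X in _ - X](divff e1) -mulrBl mulf_neq0 ?invr_eq0.
have -> : s + cc lam j = (s ^+ 2 * R - 1) / (s * (R - 1)).
  by rewrite ccE // -/R; field; rewrite s0 R1.
rewrite -[RHS]subr_eq0 mulf_eq0 invr_eq0 mulf_eq0 (negPf s0) (negPf R1) !orbF //.
Qed.

(* By the lattice condition the factor can vanish only if the ranks of the two positions
   differ by the maximum [k]; on the wall, membership in S forces this. *)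
Lemma wall lam j : (j < k)%N -> lam (inord j) < lam (inord j.+1) -> S_ lam ->
  (s + cc lam j == 0) = (lam (inord j.+1) - lam (inord j) == d%:Z).
Proof.
move=> hj lt hS; rewrite s_cc_eq0 //.
have h1 := rk_lt lam (inord j); have h2 := rk_lt lam (inord j.+1).
apply/eqP/eqP => [/lattice[m [ea eb]]|eb].
  (* The gap m d is positive, and m n is 1 plus a difference of ranks, hence at most n. *)
  have m1 : m = 1 by nia.
  by rewrite eb m1 mul1r.
apply/lattice; exists 1; rewrite !mul1r; split => //.
have r0 : rk lam (inord j.+1) = 0%N.
  rewrite rk_sum big1 // => p _; apply/eqP; rewrite eqb0 /ahead; apply/negP.
  have := hS p (inord j); have := hS p (inord j.+1).
  have vj : nat_of_ord (inord j : 'I_n) = j by rewrite inordK //; lia.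
  have vj1 : nat_of_ord (inord j.+1 : 'I_n) = j.+1 by rewrite inordK //; lia.
  have [->|/eqP pj] := eqVneq (p : 'I_n) (inord j); first by rewrite vj; lia.
  have : nat_of_ord p <> j by move=> e1; apply: pj; apply: val_inj; rewrite val_inord //; lia.
  by rewrite vj vj1; lia.
have rk' : rk lam (inord j) = k.
  have e1 : #|predC1 (inord j : 'I_n)| = k by rewrite cardC1 card_ord.
  rewrite -[RHS]e1 rk_ahead; apply: eq_card => p; rewrite !inE.
  have [->|pj] := eqVneq p (inord j); first by rewrite -/(ahead lam _ _) ahead_irr.
  have := hS (inord j.+1) p; have := hS p (inord j).
  have vj : nat_of_ord (inord j : 'I_n) = j by rewrite inordK //; lia.
  have vj1 : nat_of_ord (inord j.+1 : 'I_n) = j.+1 by rewrite inordK //; lia.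
  have : nat_of_ord p <> j by move/eqP: pj => pj e2; apply: pj; apply: val_inj; rewrite val_inord //; lia.
  by rewrite /ahead vj vj1; lia.
by rewrite r0 rk'; lia.
Qed.

Lemma ev_e_pie lam z : (forall i, z i != 0) ->
  z (inord k) * ev (e lam) (om q z) = q ^ (lam ord0) * ev (e (pie lam)) z.
Proof.
move=> z0; have := congr1 (fun f => ev f z) (Pi_e lam).
by rewrite evZ /PiL ev_Xop // ev_omega.
Qed.

Lemma ev_foldr_zpt0 c f m : c != 0 -> (m <= k)%N ->
  ev (foldr (fun j g => Top s j g) f (iota 0 m)) (zpt c 0) = s ^+ m * ev f (zpt c 0).
Proof.
move=> c0; elim: m f => [|m IH] f hm; first by rewrite expr0 mul1r.
rewrite iota_cat foldr_cat IH; last by lia.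
by rewrite [foldr _ _ [:: _]]/= ev_Top_zpt_eq ?ffunE // mulrA -exprSr.
Qed.

Lemma ev_e_zpt0 lam c : c != 0 -> (ev (e lam) (zpt c 0) != 0) <-> S_ lam.
Proof.
move=> c0; have z0 i : zpt c 0 i != 0 by apply: zpt_neq0.
(* All entries of the weight 0 agree, so each T_j acts at this point as the scalar s. The eigenvalue
   equation for the first Y-operator then ties the value of [e mu] to its value at [om q] of the
   point, and [Pi_e] ties that to [e (pie mu)]. *)
have pierel mu : (ev (e mu) (zpt c 0) != 0) = (ev (e (pie mu)) (zpt c 0) != 0).
  have [_ _ ef] := he mu; have := congr1 (fun f => ev f (zpt c 0)) (ef ord0).
  rewrite evZ /Yop /= subn0 ev_foldr_zpt0 // ev_omega => h.
  have := ev_e_pie mu z0; move: h.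
  have := eig_neq0 nd mu ord0; move: (eig s q mu ord0) => y y0.
  move: (ev (e mu) (om q (zpt c 0))) (ev (e mu) (zpt c 0)) (ev (e (pie mu)) (zpt c 0)) => u v w h1 h2.
  have un : (u != 0) = (v != 0).
    by apply/idP/idP => [u0|v0]; [have : y * v != 0 by rewrite -h1 mulf_neq0 ?expf_neq0 //
      | have : s ^+ k * u != 0 by rewrite h1 mulf_neq0]; rewrite mulf_eq0 negb_or => /andP[].
  rewrite -un; apply/idP/idP => [u0|w0].
    have : q ^ mu ord0 * w != 0 by rewrite -h2 mulf_neq0.
    by rewrite mulf_eq0 negb_or => /andP[].
  have : zpt c 0 (inord k) * u != 0 by rewrite h2 mulf_neq0 ?expfz_neq0.
  by rewrite mulf_eq0 negb_or => /andP[].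
elim/(@expo_ind k): lam => [|mu IH|mu IH|mu j hj lt IH].
- split=> _; first exact: S_0.
  rewrite e_0 ev_mono; exact: monoval_neq0.
- by rewrite S_pie -pierel.
- by rewrite -S_pie pierel.
rewrite S_sw // -IH e_sw // evZ evD evZ ev_Top_zpt_eq ?ffunE // -mulrDl.
split.
  rewrite !mulf_eq0 !negb_or => /andP[_ /andP[h1 h2]]; split=> //.
  by move/eqP: h1 => h1 /eqP; rewrite -wall //; [move/eqP | apply/IH].
move=> [h1 h2]; rewrite !mulf_neq0 ?invr_eq0 //.
by rewrite wall //; [apply/eqP | apply/IH].
Qed.

Lemma ev_e_zpt lam mu c : c != 0 -> S_ mu -> ~ S_ lam -> ev (e lam) (zpt c mu) = 0.
Proof.
move=> c0 Smu; elim/(@expo_ind k): mu Smu lam => [|mu IH|mu IH|mu j hj lt IH] Smu lam nS.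
- by apply/eqP; apply: contra_notT nS => /(ev_e_zpt0 _ c0).
- have nS' : ~ S_ (pieinv lam) by rewrite -S_pie pieinvK.
  have z0 i : zpt c (pie mu) i != 0 by apply: zpt_neq0.
  have := ev_e_pie (pieinv lam) z0; rewrite pieinvK (eq_ev _ (om_zpt c mu)).
  rewrite (IH ((S_pie mu).1 Smu) _ nS') mulr0 => /esym/eqP; rewrite mulf_eq0.
  by rewrite (negPf (expfz_neq0 _ q0)) => /eqP.
- have nS' : ~ S_ (pie lam) by rewrite S_pie.
  have z0 i : zpt c (pie mu) i != 0 by apply: zpt_neq0.
  have := ev_e_pie lam z0; rewrite (eq_ev _ (om_zpt c mu)).
  rewrite (IH ((S_pie mu).2 Smu) _ nS') mulr0 => /eqP; rewrite mulf_eq0.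
  by rewrite (negPf (z0 _)) => /eqP.
have [Smu' nw] := (S_sw hj lt).1 Smu.
(* The induction on the point treats all lam outside S at once, which is needed here: T_j mixes
   [e lam] with the swapped eigenvector. Once this value is 0, the evaluation formula leaves the
   value at the swapped point times a nonzero factor. *)
have Te0 : ev (Top s j (e lam)) (zpt c mu) = 0.
  case: (ltgtP (lam (inord j)) (lam (inord j.+1))) => h.
  - by rewrite Top_e_up // evB !evZ !IH ?mulr0 ?subrr //; move/(S_sw hj h) => [].
  - have h' : sw_expo j lam (inord j) < sw_expo j lam (inord j.+1) by rewrite sw_l // sw_r.
    have := Top_e_down hj h'; rewrite swK // => ->; rewrite evD !evZ (IH _ lam) // mulr0 addr0.
    have [Ssw|nSsw] := Classical_Prop.classic (S_ (sw_expo j lam)); last by rewrite IH ?mulr0.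
    (* The swapped weight is in S while lam is not, so the swap crosses the wall; there [icoef] is
       -s and the coefficient of the eigenvector from S vanishes. *)
    have /eqP w : s + cc (sw_expo j lam) j == 0.
      rewrite wall //; apply/negP => /negP hne; apply: nS; rewrite -(swK lam hj).
      by apply/(S_sw hj h'); split => //; apply/eqP.
    have -> : cc (sw_expo j lam) j = - s by apply/eqP; rewrite -addr_eq0 addrC w.
    by rewrite addrAC subrr add0r mulrNN mulfV // subrr mulr0 mul0r.
  - by rewrite Top_e_eq // evZ IH // mulr0.
have := ev_Top_zpt mu (e lam) c0 hj; rewrite Te0 (IH _ lam) // mulr0 subr0.
rewrite (eq_ev _ (zpt_sw c hj _)); last by rewrite lt_eqF.
move=> /esym/eqP; rewrite mulf_eq0 wall // => /orP[/eqP //|/eqP //].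
Qed.

(** These weights satisfy the bound on the s_a in the definition of Z. Unlike S, they are stable
    under every swap, but a rotation may lead out of them. *)
Definition thin mu := forall i p, mu i - mu p < d%:Z.

Lemma thin_0 : thin 0.
Proof. by move=> i p; rewrite !ffunE subrr. Qed.

Lemma thin_S mu : thin mu -> S_ mu.
Proof. by move=> h i p; left. Qed.

Lemma thin_sw mu j : thin mu -> thin (sw_expo j mu).
Proof. by move=> h i p; rewrite !ffunE. Qed.

(* Adding [d] to a minimal first entry cyclically rotates the ranks, and the
   relation [t^n q^d = 1] turns this into a rescaling of the point. *)
Lemma om_zpt_thin c mu : thin mu -> exists kappa nu,
  [/\ thin nu, kappa = 1 \/ kappa = s ^- 2 & om q (zpt c mu) =1 zpt (c * kappa) nu].
Proof.
move=> hmu; pose nu := pieinv mu.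
have muE i : mu i = nu (osucc i) + (val i == k)%:Z by rewrite -pieE /nu pieinvK.
have omE : om q (zpt c mu) =1 zpt c nu by move=> i; rewrite -om_zpt /nu pieinvK.
case: (boolP [forall i, forall p, nu i - nu p < d%:Z]) => [/forallP h|].
  exists 1, nu; split; [|by left|by move=> i; rewrite mulr1].
  by move=> i p; apply: (forallP (h i)).
move=> /forallPn[i0 /forallPn[p0]]; rewrite -leNgt => big.
have nuE i p : nu i - nu p = mu (opred i) - mu (opred p) - (i == ord0)%:Z + (p == ord0)%:Z.
  have e0 m : (val (opred m : 'I_n) == k) = (m == ord0).
    rewrite val_opred -[RHS]/(val m == 0%N); have : (val m < n)%N := ltn_ord m.
    by case: (val m) => [|x] /=; rewrite ?eqxx // => hx; case: eqP => //; lia.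
  by rewrite !muE !opredK !e0; ring.
(* Only the first entry is lowered by the inverse rotation, so a gap that became too large must end
   there. *)
have bound i p : nu i - nu p < d%:Z - (i == ord0)%:Z + (p == ord0)%:Z.
  by rewrite nuE; have := hmu (opred i) (opred p); lia.
have p00 : p0 = ord0.
  by apply/eqP; apply: contraT => ne; have := bound i0 p0; rewrite (negPf ne); lia.
subst p0.
have i00 : i0 != ord0 by apply: contraTneq big => ->; rewrite subrr; lia.
have nui0 : nu i0 = nu ord0 + d%:Z.
  by have := bound i0 ord0; rewrite (negPf i00) eqxx; lia.
have lt0 i : i != ord0 -> nu ord0 < nu i.
  by move=> ne; have := bound i0 i; rewrite (negPf i00) (negPf ne); lia.
have le0 i : i != ord0 -> nu i <= nu ord0 + d%:Z.
  by move=> ne; have := bound i ord0; rewrite (negPf ne) eqxx; lia.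
pose nu' : expo := [ffun i => if i == ord0 then nu ord0 + d%:Z else nu i].
have nu'0 : nu' ord0 = nu ord0 + d%:Z by rewrite ffunE eqxx.
have nu'E i : i != ord0 -> nu' i = nu i by move=> ne; rewrite ffunE (negPf ne).
have rk0 : rk nu' ord0 = 0%N.
  rewrite rk_sum big1 // => p _; apply/eqP; rewrite eqb0 /ahead ltn0 andbF orbF.
  have [->|ne] := eqVneq p ord0; first by rewrite ltxx.
  by rewrite -leNgt nu'0 nu'E // le0.
have rkk : rk nu ord0 = k.
  have e1 : #|predC1 (ord0 : 'I_n)| = k by rewrite cardC1 card_ord.
  rewrite -[RHS]e1 rk_ahead; apply: eq_card => p; rewrite !inE.
  have [->|pj] := eqVneq p ord0; first by rewrite -/(ahead nu _ _) ahead_irr.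
  by rewrite /ahead lt0.
have rkS i : i != ord0 -> rk nu' i = (rk nu i).+1.
  move=> ne; rewrite !rk_sum (bigD1 ord0) //= [in RHS](bigD1 ord0) //=.
  have i0' : (0 < i)%N by rewrite lt0n; exact: ne.
  have -> : ahead nu' i ord0.
    by rewrite /ahead nu'0 nu'E //= i0'; have := le0 i ne; lia.
  have -> : ahead nu i ord0 = false.
    by rewrite /ahead; have := lt0 i ne; lia.
  rewrite add1n add0n; congr S; apply: eq_bigr => p pne.
  by rewrite /ahead !nu'E.
have eigE i : eig s q nu' i = eig s q nu i * s ^- 2.
  rewrite exprnN mulrC /eig mulrA -expfzDr //.
  have [->|ne] := eqVneq i ord0; last first.
    by rewrite rkS // nu'E //; congr (s ^ _ * _); lia.
  rewrite rk0 rkk nu'0 (expfzDr _ _ q0) [q ^ _ * _]mulrC mulrA.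
  have /lattice e1 : exists m : int, (n%:Z : int) = m * n%:Z /\ d%:Z = m * d%:Z.
    by exists 1; rewrite !mul1r.
  (* The rank drops from k to 0; splitting off s^(2n), which cancels q^d, leaves the factor s^-2
     common to all positions. *)
  have -> : s ^ (k%:Z - 2 * 0%:Z) = s ^ (- 2%:Z + (k%:Z - 2 * k%:Z)) * s ^ (2 * n%:Z).
    by rewrite -expfzDr //; congr (s ^ _); lia.
  by rewrite -[_ * s ^ _ * q ^ _]mulrA e1 mulr1.
exists (s ^- 2), nu'; split; last 2 first.
- by right.
- by move=> i; rewrite omE /zpt eigE -mulf_div mulfV ?mulr1 // invr_eq0 expf_neq0.
move=> i p; have [->|ni] := eqVneq i ord0; have [->|np] := eqVneq p ord0;
  rewrite ?nu'0 ?nu'E ?subrr //.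
- by rewrite -nui0; have := bound i0 p; rewrite (negPf i00) (negPf np); lia.
- by have := le0 i ni; lia.
by have := bound i p; rewrite (negPf ni) (negPf np); lia.
Qed.

(** Of the two factors only the first can vanish: [icoef] equal to s^-1 would give s^(2a) q^b = 1
    with b the positive gap and a, a rank difference minus 1, too small for a resonance. *)
Lemma icoef_neq_sV lam j : (j < k)%N -> lam (inord j) < lam (inord j.+1) ->
  1 - cc lam j * (s - s^-1 + cc lam j) = - ((s + cc lam j) * (cc lam j - s^-1)) /\
  cc lam j - s^-1 != 0.
Proof.
move=> hj lt; split; first by field; rewrite s0.
have e3 := eig_sub_neq0 nd lam (inord_neqS hj).
have e1 := eig_neq0 nd lam (inord j).
have := eig_ratio nd lam lam (inord j.+1) (inord j).
rewrite ccE //; set R := eig _ _ _ _ / _ => RE.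
have R1 : R - 1 != 0.
  by rewrite /R -[X in _ - X](divff e1) -mulrBl mulf_neq0 ?invr_eq0.
rewrite (_ : _ - _ = (s ^+ 2 - R) / (s * (R - 1))); last by field; rewrite s0 R1.
rewrite mulf_neq0 ?invr_eq0 ?mulf_neq0 // subr_eq0; apply/negP => /eqP e2.
have [_ _ _ _ N] := nd.
have ah : ahead lam (inord j) (inord j.+1) by rewrite /ahead lt.
have hrk := rk_ltn ah; have hk := rk_lt lam (inord j).
have [] := N ((rk lam (inord j))%:Z - (rk lam (inord j.+1))%:Z - 1)
             (lam (inord j.+1) - lam (inord j)); last by lia.
  by lia.
set A := (rk lam (inord j))%:Z - (rk lam (inord j.+1))%:Z.
rewrite (_ : 2 * (A - 1) = 2 * A + (- 2%:Z)); last by ring.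
by rewrite (expfzDr _ _ s0) mulrAC -RE -e2 -exprnN mulfV ?expf_neq0.
Qed.

End Duality.

(** * Specialization *)

Section Specialization.
Variables (k r : nat).
Local Notation tofrac := FracField.tofrac.

Let cLr : {rmorphism C -> Lf} := (tofrac (R := _) \o (@polyC C))%FUN.
Let ev1r : {rmorphism {poly C} -> Lf} := (horner_eval (sL k r) \o map_poly cLr)%FUN.
Let ev2r : {rmorphism {poly {poly C}} -> Lf} := (horner_eval (qL k r) \o map_poly ev1r)%FUN.

Lemma ev1E p : ev1 k r p = ev1r p.
Proof.
rewrite /ev1 /ev1r /= horner_evalE (@horner_coef_wide _ (size p)) ?size_poly //.
by apply: eq_bigr => i _; rewrite coef_map.
Qed.

Lemma ev2E P : ev2 k r P = ev2r P.
Proof.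
rewrite /ev2 /ev2r /= horner_evalE (@horner_coef_wide _ (size P)) ?size_poly //.
by apply: eq_bigr => i _; rewrite coef_map ev1E.
Qed.

Lemma ev2D P Q : ev2 k r (P + Q) = ev2 k r P + ev2 k r Q.
Proof. by rewrite !ev2E rmorphD. Qed.
Lemma ev2M P Q : ev2 k r (P * Q) = ev2 k r P * ev2 k r Q.
Proof. by rewrite !ev2E rmorphM. Qed.
Lemma ev2_0 : ev2 k r 0 = 0. Proof. by rewrite !ev2E rmorph0. Qed.
Lemma ev2_1 : ev2 k r 1 = 1. Proof. by rewrite !ev2E rmorph1. Qed.
Lemma ev2_N1 : ev2 k r (-1) = -1. Proof. by rewrite !ev2E rmorphN1. Qed.

Local Opaque ev2 FracField.tofrac.

Lemma ev2_tofrac_neq0 b : ev2 k r b != 0 -> tofrac b != 0 :> Kt.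
Proof. by apply: contraNneq => /eqP; rewrite tofrac_eq0 => /eqP ->; rewrite ev2_0. Qed.

(** Cross-multiplying two fractions for x gives an identity of polynomials, which survives
    specialization; hence the value does not depend on the fraction. *)
Lemma is_spec_uniq x c c' : is_spec k r x c -> is_spec k r x c' -> c = c'.
Proof.
move=> [a [b [-> [hb ->]]]] [a' [b' [e [hb' ->]]]].
have tb := ev2_tofrac_neq0 hb; have tb' := ev2_tofrac_neq0 hb'.
move/eqP: e; rewrite eqr_div // -!tofracM tofrac_eq => /eqP e.
by apply/eqP; rewrite eqr_div // -!ev2M e.
Qed.

Lemma is_specD x y c d : is_spec k r x c -> is_spec k r y d -> is_spec k r (x + y) (c + d).
Proof.
move=> [a [b [-> [hb ->]]]] [a' [b' [-> [hb' ->]]]].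
have tb := ev2_tofrac_neq0 hb; have tb' := ev2_tofrac_neq0 hb'.
exists (a * b' + a' * b), (b * b'); rewrite !tofracD !tofracM !ev2D !ev2M.
split; first exact: (addf_div _ _ tb tb').
by split; [exact: (mulf_neq0 hb hb') | exact: (addf_div _ _ hb hb')].
Qed.

Lemma is_specM x y c d : is_spec k r x c -> is_spec k r y d -> is_spec k r (x * y) (c * d).
Proof.
move=> [a [b [-> [hb ->]]]] [a' [b' [-> [hb' ->]]]].
exists (a * a'), (b * b'); rewrite !tofracM !ev2M.
by split; [exact: mulf_div | split; [exact: (mulf_neq0 hb hb') | exact: mulf_div]].
Qed.

Lemma is_spec_poly a : is_spec k r (tofrac a) (ev2 k r a).
Proof. by exists a, 1; rewrite ev2_1 tofrac1 !divr1 oner_eq0. Qed.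

Lemma is_spec0 : is_spec k r 0 0.
Proof. by have := is_spec_poly 0; rewrite ev2_0 tofrac0. Qed.
Lemma is_spec1 : is_spec k r 1 1.
Proof. by have := is_spec_poly 1; rewrite ev2_1 tofrac1. Qed.

Lemma is_specN x c : is_spec k r x c -> is_spec k r (- x) (- c).
Proof.
move=> h; have := is_specM (is_spec_poly (-1)) h.
by rewrite ev2_N1 tofracN tofrac1 !mulN1r.
Qed.

Lemma is_specB x y c d : is_spec k r x c -> is_spec k r y d -> is_spec k r (x - y) (c - d).
Proof. by move=> h1 h2; apply: is_specD h1 (is_specN h2). Qed.

Lemma is_specV x c : is_spec k r x c -> c != 0 -> is_spec k r x^-1 c^-1.
Proof.
move=> [a [b [-> [hb ->]]]]; rewrite mulf_eq0 invr_eq0 negb_or => /andP[ha _].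
by exists b, a; rewrite !invf_div.
Qed.

Lemma is_spec_neq0 x c : is_spec k r x c -> c != 0 -> x != 0.
Proof.
by move=> h; apply: contraNneq => x0; rewrite x0 in h; rewrite (is_spec_uniq h is_spec0).
Qed.

Lemma is_spec_X x c m : is_spec k r x c -> is_spec k r (x ^+ m) (c ^+ m).
Proof.
move=> h; elim: m => [|m IH]; first by rewrite !expr0; exact: is_spec1.
by rewrite !exprS; apply: is_specM.
Qed.

Lemma is_spec_expz x c (m : int) : is_spec k r x c -> c != 0 -> is_spec k r (x ^ m) (c ^ m).
Proof.
move=> h c0; case: m => m; first exact: is_spec_X.
by apply: is_specV; rewrite ?expf_neq0 //; apply: is_spec_X.
Qed.

Lemma is_spec_s : is_spec k r sK (sL k r).
Proof.
have := is_spec_poly (polyC 'X).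
by rewrite ev2E /ev2r /= map_polyC horner_evalE hornerC /= map_polyX horner_evalE hornerX.
Qed.

Lemma is_spec_q : is_spec k r qK (qL k r).
Proof.
by have := is_spec_poly 'X; rewrite ev2E /ev2r /= map_polyX horner_evalE hornerX.
Qed.

Lemma inK_is_spec x c : is_spec k r x c -> inK k r c. Proof. by exists x. Qed.
Lemma inK0 : inK k r 0. Proof. exact: inK_is_spec is_spec0. Qed.
Lemma inK1 : inK k r 1. Proof. exact: inK_is_spec is_spec1. Qed.
Lemma inKD c d : inK k r c -> inK k r d -> inK k r (c + d).
Proof. by move=> [x hx] [y hy]; exists (x + y); apply: is_specD. Qed.
Lemma inKM c d : inK k r c -> inK k r d -> inK k r (c * d).
Proof. by move=> [x hx] [y hy]; exists (x * y); apply: is_specM. Qed.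
Lemma inKN c : inK k r c -> inK k r (- c).
Proof. by move=> [x hx]; exists (- x); apply: is_specN. Qed.
Lemma inKB c d : inK k r c -> inK k r d -> inK k r (c - d).
Proof. by move=> h1 h2; apply: inKD h1 (inKN h2). Qed.
Lemma inKV c : inK k r c -> inK k r c^-1.
Proof.
have [->|c0] := eqVneq c 0; first by rewrite invr0.
by move=> [x hx]; exists x^-1; apply: is_specV.
Qed.
Lemma inK_sum (I : Type) (s : seq I) (P : pred I) (f : I -> Lf) :
  (forall i, P i -> inK k r (f i)) -> inK k r (\sum_(i <- s | P i) f i).
Proof. by move=> h; apply: big_ind => //; [exact: inK0 | exact: inKD]. Qed.

Lemma C_char0 m : m.+1%:R != 0 :> C.
Proof. exact: (negbT (@pnatr_eq0 (complex Rdefinitions.R) m.+1)). Qed.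

Lemma Lf_char0 m : m.+1%:R != 0 :> Lf.
Proof. by rewrite -(rmorph_nat cLr) fmorph_eq0 C_char0. Qed.

Lemma Kt_char0 m : m.+1%:R != 0 :> Kt.
Proof.
rewrite -(rmorph_nat (tofrac (R := _))) tofrac_eq0 -(rmorph_nat polyC) polyC_eq0.
by rewrite -(rmorph_nat polyC) polyC_eq0 C_char0.
Qed.

Lemma wL_neq0 : wL != 0.
Proof. by rewrite /wL tofrac_eq0 polyX_eq0. Qed.

End Specialization.

(** * The root of unity tau *)

Section RootOfUnity.
Import Rdefinitions Raxioms RIneq Rtrigo_def Rtrigo1.
Local Notation R2 := (IZR 2%Z).

Definition cis (x : R) : C := Complex (cos x) (sin x).

Lemma cisD x y : cis (Rplus x y) = cis x * cis y.
Proof.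
apply/eqP; rewrite eq_complex /=; apply/andP; split; apply/eqP.
  exact: cos_plus.
by rewrite sin_plus [RHS]addrC; congr (_ + _); exact: Rmult_comm.
Qed.

Lemma cis0 : cis R0 = 1.
Proof. by rewrite /cis cos_0 sin_0. Qed.

Lemma cisX x m : cis x ^+ m = cis (Rmult (INR m) x).
Proof.
elim: m => [|m IH]; first by rewrite expr0 Rmult_0_l cis0.
rewrite exprSr IH -cisD S_INR Rmult_plus_distr_r Rmult_1_l //.
Qed.

Lemma cis_2PI : cis (Rmult R2 PI) = 1.
Proof. by rewrite /cis cos_2PI sin_2PI. Qed.

(** From cos x = 1 - 2 sin(x/2)^2, with x/2 strictly between 0 and pi. *)
Lemma cis_neq1 x : Rlt R0 x -> Rlt x (Rmult R2 PI) -> cis x != 1.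
Proof.
move=> x0 x2; apply/eqP => /(congr1 (@complex.Re R)) h0.
have h : cos x = R1 := h0.
have e : x = Rmult R2 (Rdiv x R2) by Lra.lra.
have sp : Rlt R0 (sin (Rdiv x R2)) by apply: sin_gt_0; Lra.lra.
have := cos_2a_sin (Rdiv x R2); rewrite -e h => h'.
have : Rlt R0 (Rmult (sin (Rdiv x R2)) (sin (Rdiv x R2))) by exact: Rmult_lt_0_compat.
by move: h'; move: (sin _) => u h' u2; Lra.nra.
Qed.

Lemma tau_prim r : leq 2 r -> (subn r 1).-primitive_root (tau r).
Proof.
move=> hr; set d := subn r 1; have d0 : leq 1 d by rewrite /d; lia.
have dR : Rlt R0 (INR d) by apply: lt_0_INR; apply/ssrnat.ltP.
set x := Rdiv (Rmult R2 PI) (INR d).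
have tauX m : tau r ^+ m = cis (Rmult (INR m) x) by rewrite -cisX.
have PI0 := PI_RGT_0.
have x0 : Rlt R0 x by apply: Rdiv_lt_0_compat; Lra.lra.
have dx : Rmult (INR d) x = Rmult R2 PI.
  rewrite /x /Rdiv (Rmult_comm (Rmult R2 PI)) -Rmult_assoc Rinv_r ?Rmult_1_l //.
  by move=> e; rewrite e in dR; Lra.lra.
apply/andP; split=> //; apply/forallP => i; apply/eqP; rewrite unity_rootE tauX.
have [->|ne] := eqVneq i.+1 d; first by rewrite dx cis_2PI eqxx.
apply/negbTE/cis_neq1.
  by apply: Rmult_lt_0_compat => //; apply: lt_0_INR; apply/ssrnat.ltP.
rewrite -dx; apply: Rmult_lt_compat_r => //; apply: lt_INR; apply/ssrnat.ltP.
by have := ltn_ord i; lia.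
Qed.

End RootOfUnity.

(** * Multiplicative relations between s and q *)

Section Lattice.
Variables (k r : nat).
Hypothesis hk : leq 1 k.
Hypothesis hr : leq 2 r.
Local Notation n := k.+1.
Local Notation d := (r - 1)%N.

Lemma tau_neq0 : tau r != 0.
Proof.
have := prim_expr_order (tau_prim hr); apply: contra_eqN => /eqP ->.
by rewrite expr0n (_ : (d == 0%N) = false) ?(eq_sym 0) ?oner_eq0 //; lia.
Qed.

Lemma cL_eq0 c : (cL c == 0) = (c == 0).
Proof. by rewrite /cL tofrac_eq0 polyC_eq0. Qed.

Lemma cL_is_wLX c u : cL c = wL ^+ u -> u = 0%N /\ c = 1.
Proof.
rewrite /cL /wL -tofracXn => /eqP; rewrite tofrac_eq => /eqP e.
have := congr1 (fun p : {poly C} => size p) e; rewrite size_polyXn size_polyC => u0.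
have {}u0 : u = 0%N by case: (c != 0) u0 => /=; lia.
split=> //; move: e; rewrite u0 expr0 -[1 in RHS]/(1%:P) => /eqP.
by rewrite -subr_eq0 -polyCB polyC_eq0 subr_eq0 => /eqP.
Qed.

Lemma cL_V c : (cL c)^-1 = cL c^-1.
Proof.
have [ce|c0] := eqVneq c 0.
  have /eqP -> : cL c == 0 by rewrite cL_eq0 ce.
  by apply/esym/eqP; rewrite invr0 cL_eq0 invr_eq0 ce.
have cc0 : cL c != 0 by rewrite cL_eq0.
apply: (mulfI cc0); rewrite mulfV //.
by rewrite /cL -tofracM -polyCM mulfV // polyC1 tofrac1.
Qed.

Lemma cL_expz c (m : int) : cL c ^ m = cL (c ^ m).
Proof.
have cX u : cL c ^+ u = cL (c ^+ u) by rewrite /cL -tofracXn -polyC_exp.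
case: m => u; first exact: cX.
exact: etrans (congr1 (@GRing.inv _) (cX _)) (cL_V _).
Qed.

Lemma cL_wL c (m : int) : cL c * wL ^ m = 1 -> m = 0 /\ c = 1.
Proof.
have w0 := wL_neq0; move=> e.
have cc0 : cL c != 0 by apply: contra_eq_neq e => ->; rewrite mul0r eq_sym oner_eq0.
have wE : wL ^ m = cL c^-1 by rewrite -cL_V; apply: (mulfI cc0); rewrite e mulfV.
case: (intP m) wE => [|u|u] wE.
- have [|_ c1] := @cL_is_wLX c^-1 0; first by rewrite -wE.
  by rewrite -[c]invrK c1 invr1.
- by have [] := @cL_is_wLX c^-1 u.+1; rewrite -?wE.
- have [] := @cL_is_wLX c u.+1 => //.
  by rewrite -[c]invrK -cL_V -wE -exprnN invrK.
Qed.

(** Comparing powers of w gives (d/g) a = (n/g) b, whose solutions form a lattice with step d/g in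
    b. The primitive root tau then forces d to divide b and leaves only the multiples of (n, d). *)
Lemma lattice (a b : int) : sL k r ^ (2 * a) * qL k r ^ b = 1 <->
  exists m : int, a = m * n%:Z /\ b = m * d%:Z.
Proof.
have w0 := wL_neq0; have t0 := tau_neq0; have ct0 : cL (tau r) != 0 by rewrite cL_eq0.
have d0 : (0 < d)%N by lia.
set g := gg k r; have g0 : (0 < g)%N by rewrite /g /gg gcdn_gt0.
have dg : (g %| d)%N by apply: dvdn_gcdr.
have ng : (g %| n)%N by apply: dvdn_gcdl.
have [A eA] : exists A, d = (A * g)%N by exists (d %/ g)%N; rewrite divnK.
have [B eB] : exists B, n = (B * g)%N by exists (n %/ g)%N; rewrite divnK.
have -> : sL k r ^ (2 * a) * qL k r ^ b = cL (tau r ^ b) * wL ^ (2 * (A%:Z * a - B%:Z * b)).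
  have e1 : sL k r ^ (2 * a) = wL ^ (A%:Z * (2 * a)).
    by rewrite /sL -/g {1}eA mulnK // exprnP exprz_exp.
  have e2 : qL k r ^ b = cL (tau r ^ b) * wL ^ (- (2 * B)%N%:Z * b).
    by rewrite /qL -/g {1}eB mulnK // expfzMl cL_expz exprnN exprz_exp.
  by rewrite e1 e2 mulrCA -expfzDr // PoszM; congr (_ * wL ^ _); ring.
have tauX (m : nat) : (tau r ^+ m == 1) = (d %| m)%N by rewrite -(prim_order_dvd (tau_prim hr)).
have eAB : (A * n = B * d)%N by rewrite eA eB mulnCA.
split=> [h|[m [-> ->]]].
  have [h0 h1] := cL_wL h.
  have [m em] : exists m : int, b = m * d%:Z.
    case: b h1 {h h0} => u h1.
      have /dvdnP[v ->] : (d %| u)%N by rewrite -tauX; apply/eqP; exact: h1.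
      by exists v%:Z; rewrite PoszM.
    have /dvdnP[v ev] : (d %| u.+1)%N.
      by rewrite -tauX -invr_eq1; apply/eqP; exact: h1.
    by exists (- v%:Z); rewrite NegzE ev PoszM mulNr.
  exists m; split=> //; have A0 : A != 0%N by apply: contraTneq d0 => A0; rewrite eA A0.
  by move: h0; rewrite em; nia.
have -> : A%:Z * (m * n%:Z) - B%:Z * (m * d%:Z) = 0 by nia.
rewrite mulr0 expr0z mulr1 mulrC -exprz_exp -[tau r ^ d]/(tau r ^+ d).
by rewrite (prim_expr_order (tau_prim hr)) exp1rz /cL polyC1 tofrac1.
Qed.

Lemma qt_generic_Lf : qt_generic k (sL k r) (qL k r).
Proof.
split=> //; [exact: Lf_char0| | |].
- by apply: expf_neq0; exact: wL_neq0.
- apply: mulf_neq0; first by rewrite cL_eq0 tau_neq0.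
  by rewrite invr_eq0; apply: expf_neq0; exact: wL_neq0.
move=> a b ha /lattice[m [ea eb]]; have m0 : m = 0 by nia.
by split; [rewrite ea m0 mul0r | rewrite eb m0 mul0r].
Qed.

(** A relation between s and q before specialization would specialize to one afterwards. *)
Lemma qt_generic_Kt : qt_generic k sK qK.
Proof.
have [_ sL0 qL0 _ N] := qt_generic_Lf.
have hs := is_spec_s k r; have hq := is_spec_q k r.
split=> //; [exact: Kt_char0|exact: is_spec_neq0 hs _|exact: is_spec_neq0 hq _|].
move=> a b ha e; apply: N => //.
have h := is_specM (is_spec_expz (2 * a) hs sL0) (is_spec_expz b hq qL0).
by rewrite e in h; apply: is_spec_uniq h (is_spec1 k r).
Qed.

End Lattice.

(** * Specialization of the eigenvectors *)

Section SpecializedFamily.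
Variables (k r : nat).
Hypothesis hk : leq 1 k.
Hypothesis hr : leq 2 r.
Local Notation n := k.+1.
Local Notation expo := (expo n).
Local Notation is_spec := (is_spec k r).
Implicit Types (a lam mu : expo) (f : LP Kt n) (g : LP Lf n) (j : nat).

Definition specrel f g := forall a, is_spec f@_a g@_a.

Lemma is_spec_sum (I : Type) (s : seq I) (u : I -> Kt) (v : I -> Lf) :
  (forall i : I, is_spec (u i) (v i)) -> is_spec (\sum_(i <- s) u i) (\sum_(i <- s) v i).
Proof.
by move=> h; apply: (big_ind2 is_spec); [exact: is_spec0 | move=> *; exact: is_specD | move=> *; exact: h].
Qed.

Lemma specrelD f f' g g' : specrel f g -> specrel f' g' -> specrel (f + f') (g + g').
Proof. by move=> h h' a; rewrite !mcoeffD; apply: is_specD. Qed.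

Lemma specrelN f g : specrel f g -> specrel (- f) (- g).
Proof. by move=> h a; rewrite !mcoeffN; apply: is_specN. Qed.

Lemma specrelZ x c f g : is_spec x c -> specrel f g -> specrel (x *: f) (c *: g).
Proof. by move=> hx h a; rewrite !mcoeffZ; apply: is_specM. Qed.

Lemma specrel_sum (I : Type) (s : seq I) (u : I -> LP Kt n) (v : I -> LP Lf n) :
  (forall i, specrel (u i) (v i)) -> specrel (\sum_(i <- s) u i) (\sum_(i <- s) v i).
Proof. by move=> h a; rewrite !mcoeff_sum; apply: is_spec_sum => i; apply: h. Qed.

Lemma specrel_mono a : specrel (mono Kt a) (mono Lf a).
Proof.
by move=> b; rewrite !mcoeff_mono; case: eqP => _; [exact: is_spec1 | exact: is_spec0].
Qed.

Lemma specrel_linext phi phi' f g : (forall a, specrel (phi a) (phi' a)) ->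
  specrel f g -> specrel (linext phi f) (linext phi' g).
Proof.
move=> h hfg; set d := msupp f `|` msupp g.
rewrite (linextEw phi (fsubsetUl _ _ : msupp f `<=` d)).
rewrite (linextEw phi' (fsubsetUr _ _ : msupp g `<=` d)).
by apply: specrel_sum => a; apply: specrelZ.
Qed.

Let nL := qt_generic_Lf hk hr.
Let nK := qt_generic_Kt hk hr.
Let sL0 : sL k r != 0. Proof. by case: nL. Qed.
Let qL0 : qL k r != 0. Proof. by case: nL. Qed.
Let hs : is_spec sK (sL k r) := is_spec_s k r.
Let hq : is_spec qK (qL k r) := is_spec_q k r.

Lemma is_spec_ss : is_spec (sK - sK^-1) (sL k r - (sL k r)^-1).
Proof. by apply: is_specB hs _; apply: is_specV. Qed.

Lemma specrel_Dmono j a : specrel (Dmono Kt j a) (Dmono Lf j a).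
Proof.
rewrite /Dmono; case: ifP => _; [apply: specrelN|]; apply: specrel_sum => m;
  exact: specrel_mono.
Qed.

Lemma specrel_Top j f g : specrel f g -> specrel (Top sK j f) (Top (sL k r) j g).
Proof.
apply: specrel_linext => a; apply: specrelD; apply: specrelZ.
- exact: hs.
- exact: specrel_mono.
- exact: is_spec_ss.
- exact: specrel_Dmono.
Qed.

Lemma specrel_PiL f g : specrel f g -> specrel (PiL qK f) (PiL (qL k r) g).
Proof.
move=> h; apply: specrel_linext => [a|]; first exact: specrel_mono.
apply: specrel_linext h => a; apply: specrelZ; last exact: specrel_mono.
exact: is_spec_expz hq qL0.
Qed.

Lemma specrel_PiLinv f g : specrel f g -> specrel (PiLinv qK f) (PiLinv (qL k r) g).
Proof.
move=> h; apply: specrel_linext => [a|].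
  by apply: specrelZ; [exact: is_spec_expz hq qL0 | exact: specrel_mono].
by apply: specrel_linext h => a; exact: specrel_mono.
Qed.

Lemma is_spec_eig lam (i : 'I_n) : is_spec (eig sK qK lam i) (eig (sL k r) (qL k r) lam i).
Proof. by apply: is_specM; apply: is_spec_expz. Qed.

Lemma is_spec_icoef lam j : (j < k)%N ->
  is_spec (icoef sK qK lam j) (icoef (sL k r) (qL k r) lam j).
Proof.
move=> hj; apply: is_specM; first by apply: is_specM; [exact: is_spec_ss | exact: is_spec_eig].
apply: is_specV; first by apply: is_specB; exact: is_spec_eig.
by apply: (eig_sub_neq0 nL); exact: inord_neqS.
Qed.

(** Both families are carried through one induction. The denominators of [icoef] are differences of
    eigenvalues that stay distinct over [Lf], so each step preserves [specrel]. *)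
Lemma specialized_family lam : exists f g,
  [/\ isEg sK qK lam f, isEg (sL k r) (qL k r) lam g & specrel f g].
Proof.
elim/(@expo_ind k): lam => [|lam [f [g [hf hg hfg]]]|lam [f [g [hf hg hfg]]]|lam j hj lt [f [g [hf hg hfg]]]].
- exists (mono Kt (0 : expo)), (mono Lf (0 : expo)); split; [exact: isEg_0 | exact: isEg_0 |].
  exact: specrel_mono.
- exists (qK ^ (- lam ord0) *: PiL qK f), (qL k r ^ (- lam ord0) *: PiL (qL k r) g).
  split; [exact: isEg_pie | exact: isEg_pie |].
  by apply: specrelZ; [exact: is_spec_expz hq qL0 | exact: specrel_PiL].
- exists (qK ^ (lam ord0) *: PiLinv qK f), (qL k r ^ (lam ord0) *: PiLinv (qL k r) g).
  split; [exact: isEg_pie_inv | exact: isEg_pie_inv |].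
  by apply: specrelZ; [exact: is_spec_expz hq qL0 | exact: specrel_PiLinv].
exists (sK^-1 *: (Top sK j f + icoef sK qK lam j *: f)),
  ((sL k r)^-1 *: (Top (sL k r) j g + icoef (sL k r) (qL k r) lam j *: g)).
split; [exact: isEg_up | exact: isEg_up |].
apply: specrelZ; first exact: is_specV.
by apply: specrelD; [exact: specrel_Top | apply: specrelZ => //; exact: is_spec_icoef].
Qed.

Lemma isE_isEg lam f : isE lam f <-> isEg sK qK lam f.
Proof.
split=> [[h1 [h2 h3]]|[h1 h2 h3]].
  by split=> // mu /h2 [->|h]; rewrite /ple ?eqxx // h orbT.
by split=> //; split=> // mu /h2 /orP[/eqP|]; [left|right].
Qed.

Lemma specE x c : is_spec x c -> spec k r x = c.
Proof.
move=> h; apply: (is_spec_uniq _ h).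
exact: (ClassicalEpsilon.epsilon_spec (inhabits 0) _ (ex_intro _ c h)).
Qed.

Lemma E_specialized lam : isEg (sL k r) (qL k r) lam (Ebar k r lam) /\
  specrel (E lam) (Ebar k r lam).
Proof.
have [f [g [hf hg hfg]]] := specialized_family lam.
have eE : E lam = f.
  apply: (isEg_uniq nK _ hf); apply/isE_isEg.
  apply: (ClassicalEpsilon.epsilon_spec (inhabits 0) _).
  by exists f; apply/isE_isEg.
have eg : Ebar k r lam = g.
  apply/malgP => a; rewrite /Ebar eE mcoeffE; case: ifP => [_|/negbT /mcoeff_outdom fa].
    exact: specE.
  by apply: (is_spec_uniq _ (hfg a)); rewrite fa; apply: is_spec0.
by rewrite eg eE.
Qed.

Lemma E_regular lam a : regular k r (E lam)@_a.
Proof. by have [_ h] := E_specialized lam; exists (Ebar k r lam)@_a; apply: h. Qed.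

Lemma inV_Ebar lam : inV k r (Ebar k r lam).
Proof. by move=> a; have [_ h] := E_specialized lam; exists (E lam)@_a; apply: h. Qed.

End SpecializedFamily.

(** Recasts the m-th point of a chain in Z as a coordinate of [zpt] with rank m and weight entry -u;
    the normalizing power s^k moves into the scalar. *)
Lemma monomial_split (F : fieldType) (s q x : F) (k m u : nat) : s != 0 -> q != 0 ->
  x * s ^+ (2 * m) * q ^+ u = x * s ^+ k / (s ^ (k%:Z - 2 * m%:Z) * q ^ (- u%:Z)).
Proof.
move=> s0 q0; apply: (canRL (mulfK _)); first by rewrite mulf_neq0 ?expfz_neq0.
rewrite mulrACA -mulrA [q ^+ u]exprnP -(expfzDr _ _ q0) subrr expr0z mulr1.
by rewrite -mulrA !exprnP -(expfzDr _ _ s0) PoszM addrC subrK.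
Qed.

(** * The zero set *)

Section Zeros.
Variables (k r : nat).
Hypothesis hk : leq 1 k.
Hypothesis hr : leq 2 r.
Local Notation n := k.+1.
Local Notation d := (r - 1)%N.
Local Notation expo := (expo n).
Local Notation s := (sL k r).
Local Notation q := (qL k r).
Local Notation zpt := (zpt s q).
Local Notation inZ := (@inZ k r n).
Implicit Types (lam mu : expo) (f g : LP Lf n) (j : nat) (i p : 'I_n) (c : Lf).

Let nd := qt_generic_Lf hk hr.
Let lat := lattice hk hr.
Let s0 : s != 0. Proof. by case: nd. Qed.
Let q0 : q != 0. Proof. by case: nd. Qed.
Let d0 : (0 < d)%N. Proof. lia. Qed.

Local Opaque sL qL Defs.inK Defs.is_spec.

Lemma rk_eq0 mu i p : rk mu i = 0%N -> ~~ ahead mu i p.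
Proof. by move=> h; apply/negP => /rk_ltn; rewrite h. Qed.

Lemma rk_eqk mu i p : rk mu i = k -> p != i -> ahead mu i p.
Proof.
move=> h /(ahead_total mu)/orP[/rk_ltn|//]; rewrite h => hp.
by have := rk_lt mu p; lia.
Qed.

Lemma inS_S lam : inS k r lam <-> S_ d lam.
Proof.
split=> [[i [j [hrk hij]]] x y|h].
  have hj := rk_lt lam j.
  have ri : rk lam i = 0%N by lia.
  have rj : rk lam j = k by lia.
  have {}hij : lam i - lam j <= r%:Z - 2 \/ (lam i - lam j = r%:Z - 1 /\ (j < i)%N) := hij.
  have := rk_eq0 x ri; rewrite /ahead => hx.
  have hy : y = j \/ ahead lam j y.
    by have [->|/(rk_eqk rj)] := eqVneq y j; [left | right].
  have hxi : lam x <= lam i /\ (lam x = lam i -> (i <= x)%N) by lia.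
  have hyj : lam j <= lam y /\ (lam y = lam j -> (y <= j)%N).
    by case: hy => [->|]; rewrite /ahead; lia.
  lia.
have [i hi] := rk_surj lam (leq0n k); have [j hj] := rk_surj lam (leqnn k).
exists i, j; rewrite hi hj; split=> //; rewrite /ltn /=.
by have := h i j; lia.
Qed.

Local Notation thin := (@thin k d).

Lemma inK_s : inK k r s. Proof. exact: inK_is_spec (is_spec_s k r). Qed.
Lemma inK_q : inK k r q. Proof. exact: inK_is_spec (is_spec_q k r). Qed.
Lemma inK_eig mu i : inK k r (eig s q mu i).
Proof. exact: inK_is_spec (is_spec_eig hk hr mu i). Qed.

(** The chain lists the positions by rank and takes for s_a the drops between consecutive entries,
    which telescope to max - min. The tie rule of the rank is the order condition at s_a = 0. *)
Lemma zpt_inZ c mu : inK k r c -> c != 0 -> thin mu -> inZ (zpt c mu).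
Proof.
move=> cK c0 hmu; split.
  move=> i; split; first by apply: inKM cK (inKV (inK_eig mu i)).
  exact: zpt_neq0.
pose ro i : 'I_n := inord (rk mu i).
have vro i : val (ro i) = rk mu i by rewrite val_inord // ltnS rk_lt.
have roI : injective ro by move=> i p /(congr1 val); rewrite !vro => /rk_inj.
pose idx : 'I_n -> 'I_n := invF roI.
have rkidx m : rk mu (idx m) = m by rewrite -vro /idx f_invF.
pose w (a : 'I_k) := idx (widen_ord (leqnSn k) a); pose l (a : 'I_k) := idx (lift ord0 a).
have ah a : ahead mu (l a) (w a).
  have wl : l a != w a.
    by apply/eqP => /(congr1 (rk mu)); rewrite /l /w !rkidx /= /bump; lia.
  case/orP: (ahead_total mu wl) => // /rk_ltn; rewrite /l /w !rkidx /= /bump; lia.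
have mono_ a : 0 <= mu (w a) - mu (l a) by have := ah a; rewrite /ahead; lia.
exists idx, (fun a => `|mu (w a) - mu (l a)|%N); split; first exact: can_inj (f_invF roI).
split.
  have : (\sum_(a < k) `|mu (w a) - mu (l a)|)%N%:Z = mu (idx ord0) - mu (idx ord_max).
    rewrite -(natz (\sum_(a < k) _)) natr_sum.
    pose u m := mu (idx (inord m)).
    have -> : mu (idx ord0) - mu (idx ord_max) = - (u k - u 0%N).
      rewrite opprB /u; congr (mu (idx _) - mu (idx _)); apply: val_inj; rewrite val_inord //.
    rewrite -(telescope_sumr u (leq0n k)) -sumrN big_mkord; apply: eq_bigr => a _.
    rewrite natz gez0_abs // opprB /u /w /l.
    by congr (mu (idx _) - mu (idx _)); apply: val_inj; rewrite val_inord //=; have := ltn_ord a; rewrite /bump; lia.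
  by have := hmu (idx ord0) (idx ord_max); lia.
move=> a; rewrite -/(w a) -/(l a); split; last first.
  move=> h0; change ((w a < l a)%N); move: h0 (mono_ a) (ah a); rewrite /ahead.
  by move: (mu _) (mu _) => x y; lia.
have := eig_ratio nd mu mu (w a) (l a); rewrite /w /l !rkidx -/(w a) -/(l a).
have -> : (lift ord0 a : nat)%:Z - (widen_ord (leqnSn k) a : nat)%:Z = 1 by rewrite /= /bump; lia.
rewrite mulr1 -[s ^ 2]/(s ^+ 2) => e.
have -> : q ^+ `|mu (w a) - mu (l a)| = q ^ (mu (w a) - mu (l a)).
  by rewrite exprnP gez0_abs.
rewrite -mulrA -e /zpt.
move: (eig_neq0 nd mu (w a)); move: (eig s q mu (w a)) (eig s q mu (l a)) => x y x0.
by rewrite mulrA divfK.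
Qed.

(** As n = k + 1, the chain visits every position. The weight is minus the partial sums of the s_a
    along it, and the order condition at s_a = 0 makes the m-th visited position have rank m. *)
Lemma inZ_zpt z : inZ z -> exists c mu, [/\ inK k r c, c != 0, thin mu & z =1 zpt c mu].
Proof.
move=> [zK [idx [sa [idxI [hsum hz]]]]].
pose sg (m : nat) := (\sum_(a < k | (a < m)%N) sa a)%N.
have sgS (a : 'I_k) : sg a.+1 = (sg a + sa a)%N.
  rewrite /sg (bigD1 a) //= addnC; congr (_ + _)%N; apply: eq_bigl => b.
  by rewrite ltnS ltn_neqAle andbC.
have sg_le m : (sg m <= r - 2)%N.
  by apply: leq_trans hsum; rewrite /sg big_mkcond; apply: leq_sum => a _; case: ifP.
pose mu : expo := [ffun p => - (sg (invF idxI p))%:Z].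
have muE m : mu (idx m) = - (sg m)%:Z by rewrite ffunE invF_f.
have step (a : 'I_k) : ahead mu (idx (lift ord0 a)) (idx (widen_ord (leqnSn k) a)).
  have [_ h] := hz a; rewrite /ahead !muE.
  have el : sg (lift ord0 a) = (sg a + sa a)%N by rewrite -sgS /= /bump add1n.
  have ew : sg (widen_ord (leqnSn k) a) = sg a by [].
  rewrite el ew; move: (h); move: (sg a) (sa a) => x y {}h.
  have {}h : y = 0%N -> (idx (widen_ord (leqnSn k) a) < idx (lift ord0 a))%N := h.
  by case: (posnP y) => [y0|]; [rewrite y0 h //|]; lia.
have chain (m m' : 'I_n) : (m' < m)%N -> ahead mu (idx m) (idx m').
  case: m => m; elim: m => [//|m IH] hm lt.
  have hm' : (m < k)%N by [].
  have e1 : Ordinal hm = lift ord0 (Ordinal hm') by apply: val_inj.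
  have := step (Ordinal hm'); rewrite -e1 => h.
  have [e|ne] := eqVneq (val m') m.
    by rewrite (_ : m' = widen_ord (leqnSn k) (Ordinal hm')) //; apply: val_inj.
  have lt' : (m' < m)%N by move: ne lt; rewrite /=; lia.
  have := IH (leq_trans hm' (leqnSn k)) lt'.
  rewrite (_ : Ordinal _ = widen_ord (leqnSn k) (Ordinal hm')); last exact: val_inj.
  by move=> h'; exact: ahead_trans h' h.
have rkE (m : 'I_n) : rk mu (idx m) = m.
  rewrite rk_sum (reindex_inj idxI) /= (eq_bigr (fun m' : 'I_n => ((m' < m)%N : nat))).
    by rewrite -big_mkcond /= -(big_ord_widen n (fun=> 1%N) (ltnW (ltn_ord m))) sum1_card card_ord.
  move=> m' _; congr nat_of_bool; case: (ltngtP m' m) => h; first exact: chain.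
    by apply/negP => h'; have := ahead_trans h' (chain _ _ h); rewrite ahead_irr.
  by rewrite (val_inj h) ahead_irr.
have zE (m : 'I_n) : z (idx m) = z (idx ord0) * s ^+ (2 * m) * q ^+ sg m.
  case: m => m; elim: m => [|m IH] hm.
    rewrite (_ : Ordinal hm = ord0); last exact: val_inj.
    by rewrite muln0 /sg big1 // !expr0 !mulr1.
  have hm' : (m < k)%N by [].
  have := (hz (Ordinal hm')).1; rewrite (_ : lift ord0 _ = Ordinal hm); last exact: val_inj.
  rewrite (_ : widen_ord _ _ = Ordinal (leq_trans hm' (leqnSn k))); last exact: val_inj.
  move=> ->; rewrite IH; set z0 := z (idx ord0).
  have e1 : sg (Ordinal hm) = (sg m + sa (Ordinal hm'))%N := sgS (Ordinal hm').
  rewrite e1; change (z0 * s ^+ (2 * m) * q ^+ sg m * s ^+ 2 * q ^+ sa (Ordinal hm') =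
    z0 * s ^+ (2 * m.+1) * q ^+ (sg m + sa (Ordinal hm'))).
  have -> : (2 * m.+1 = 2 * m + 2)%N by lia.
  rewrite (exprD s (2 * m) 2) (exprD q (sg m)) !mulrA; congr (_ * _).
  move: (z0 * _) (q ^+ _) => x y; by rewrite -!mulrA; congr (_ * _); rewrite mulrC -mulrA.
exists (z (idx ord0) * s ^+ k), mu; split.
- exact: inKM (zK _).1 (inK_is_spec (is_spec_X _ (is_spec_s k r))).
- exact: (mulf_neq0 (zK (idx ord0)).2 (expf_neq0 k s0)).
- by move=> i p; rewrite !ffunE; have := sg_le (invF idxI i); have := sg_le (invF idxI p); lia.
move=> p; rewrite -[p](f_invF idxI) zE /zpt /eig rkE muE.
move: (invF idxI p) => m; move: (sg m) (z (idx ord0)) => u z0.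
exact: monomial_split.
Qed.

End Zeros.

(** * The quotient representation *)

Section Quotient.
Variables (F : fieldType) (k d : nat) (s q : F).
Local Notation n := k.+1.
Local Notation LP := (LP F n).
Local Notation expo := (expo n).
Implicit Types (f g h : LP) (lam mu : expo) (j m : nat) (i p : 'I_n) (c : F).

Hypothesis nd : qt_generic k s q.
Hypothesis d0 : (0 < d)%N.
Hypothesis lattice : forall a b : int,
  s ^ (2 * a) * q ^ b = 1 <-> exists m : int, a = m * n%:Z /\ b = m * d%:Z.
Let ch0 : forall m, m.+1%:R != 0 :> F. Proof. by case: nd. Qed.
Let s0 : s != 0. Proof. by case: nd. Qed.
Let q0 : q != 0. Proof. by case: nd. Qed.
Let k0 : (0 < k)%N. Proof. by case: nd. Qed.
Let TK j f : (j < k)%N -> Top s j (Tinv s j f) = f. Proof. exact: (TopK ch0 s0). Qed.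
Let T'K j f : (j < k)%N -> Tinv s j (Top s j f) = f. Proof. exact: (TinvK ch0 s0). Qed.

Variable e : expo -> LP.
Hypothesis he : forall lam, isEg s q lam (e lam).
Local Notation cc := (icoef s q).
Local Notation S_ := (@S_ k d).
Local Notation thin := (@thin k d).
Local Notation zpt := (zpt s q).

Variable K : F -> Prop.
Hypothesis K1 : K 1.
Hypothesis KB : forall x y, K x -> K y -> K (x - y).
Hypothesis KM : forall x y, K x -> K y -> K (x * y).
Hypothesis KV : forall x, K x -> K x^-1.
Hypothesis Ks : K s.
Hypothesis Kq : K q.

Let K0 : K 0. Proof. by rewrite -(subrr 1); apply: KB. Qed.
Let KN x : K x -> K (- x). Proof. by move=> h; rewrite -sub0r; apply: KB. Qed.
Let KD x y : K x -> K y -> K (x + y).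
Proof. by move=> h1 h2; rewrite -[y]opprK; apply: KB => //; apply: KN. Qed.
Let KX x m : K x -> K (x ^+ m).
Proof. by move=> h; elim: m => [|m IH]; rewrite ?expr0 ?exprS //; apply: KM. Qed.
Let KXz x (m : int) : K x -> K (x ^ m).
Proof. by move=> h; case: m => m; [exact: KX | apply: KV; exact: KX]. Qed.
Let K_eig lam i : K (eig s q lam i). Proof. by apply: KM; apply: KXz. Qed.
Let K_ss : K (s - s^-1). Proof. by apply: KB => //; apply: KV. Qed.
Let K_cc lam j : K (cc lam j).
Proof. by apply: KM; [apply: KM | apply: KV; apply: KB]. Qed.

Variable Z : ('I_n -> F) -> Prop.
Hypothesis ZP : forall z, Z z <-> exists c mu, [/\ K c, c != 0, thin mu & z =1 zpt c mu].

Definition vanishing f := forall z, Z z -> ev f z = 0.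

Lemma vanishing_Top j f : (j < k)%N -> vanishing f -> vanishing (Top s j f).
Proof.
move=> hj hf z /ZP[c [mu [cK c0 hmu hz]]]; rewrite (eq_ev _ hz).
have van nu : thin nu -> ev f (zpt c nu) = 0 by move=> hnu; apply: hf; apply/ZP; exists c, nu.
have [h|ne] := eqVneq (mu (inord j)) (mu (inord j.+1)).
  by rewrite (ev_Top_zpt_eq nd) // van // mulr0.
rewrite (ev_Top_zpt nd) // (eq_ev _ (zpt_sw _ _ _ hj ne)) !van ?mulr0 ?subrr //.
exact: thin_sw.
Qed.

Lemma vanishingZ c f : vanishing f -> vanishing (c *: f).
Proof. by move=> hf z hz; rewrite evZ hf // mulr0. Qed.

Lemma vanishingB f g : vanishing f -> vanishing g -> vanishing (f - g).
Proof. by move=> hf hg z hz; rewrite evB hf ?hg // subrr. Qed.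

Lemma vanishing_Tinv j f : (j < k)%N -> vanishing f -> vanishing (Tinv s j f).
Proof. by move=> hj hf; apply: vanishingB; [apply: vanishing_Top | apply: vanishingZ]. Qed.

Lemma vanishing_omega f : vanishing f -> vanishing (omega q f).
Proof.
move=> hf z /ZP[c [mu [cK c0 hmu hz]]]; rewrite (eq_ev _ hz) ev_omega.
have [kap [nu [hnu hk e1]]] := om_zpt_thin nd d0 lattice c hmu.
have kap0 : kap != 0 by case: hk => ->; rewrite ?oner_eq0 // invr_eq0 expf_neq0.
rewrite (eq_ev _ e1); apply: hf; apply/ZP; exists (c * kap), nu; split=> //.
  by apply: KM => //; case: hk => -> //; apply: KV; apply: KX.
exact: mulf_neq0.
Qed.

Lemma foldr_closed (P : LP -> Prop) (A : nat -> LP -> LP) f (r : seq nat) :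
  (forall j g, j \in r -> P g -> P (A j g)) -> P f -> P (foldr (fun j g => A j g) f r).
Proof.
elim: r => [//|j r IH] h Pf /=; apply: (h); first exact: mem_head.
by apply: IH => // m g mr; apply: (h); rewrite in_cons mr orbT.
Qed.

Lemma vanishing_Yop i f : vanishing f -> vanishing (Yop s q i f).
Proof.
move=> hf; have hi := ltn_ord i; apply: (foldr_closed (P := vanishing) (A := fun j => Top s j)).
  by move=> j g; rewrite mem_iota => hj; apply: vanishing_Top; move: hj => /=; lia.
apply: vanishing_omega; apply: (foldr_closed (P := vanishing) (A := fun j => Tinv s j)) => // j g; rewrite mem_iota => hj.
by apply: vanishing_Tinv; lia.
Qed.

(* The joint spectrum of the [Yop i] is simple, so eigenvectors can be split off. *)
Lemma isolate (W : LP -> Prop) : (forall f g, W f -> W g -> W (f - g)) ->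
  (forall c f, K c -> W f -> W (c *: f)) -> (forall i f, W f -> W (Yop s q i f)) ->
  forall (ls : seq expo) (c : expo -> F) lam, uniq ls -> (forall mu, mu \in ls -> K (c mu)) ->
  W (\sum_(mu <- ls) c mu *: e mu) -> lam \in ls -> W (c lam *: e lam).
Proof.
move=> WB WZ WY ls c lam uls Kc Wls lamls.
have {}Wls : W (c lam *: e lam + \sum_(mu <- rem lam ls) c mu *: e mu).
  by move: Wls; rewrite (big_rem lam lamls).
have : lam \notin rem lam ls by rewrite mem_rem_uniq // inE eqxx.
have {}Kc mu : mu \in rem lam ls -> K (c mu) by move/mem_rem; apply: Kc.
have [b eb] : exists b, b = c lam by eexists.
rewrite -eb in Wls *; clear eb uls lamls.
elim: (rem lam ls) c Kc Wls => [|mu rs IH] c Kc; first by rewrite big_nil addr0.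
rewrite big_cons in_cons negb_or => Wf /andP[lm lamrs].
have [i hi] : exists i, eig s q lam i - eig s q mu i != 0.
  apply: Classical_Prop.NNPP => h; case/eqP: lm; apply: (eig_inj nd) => i.
  by apply/eqP; rewrite -subr_eq0; apply/negPn/negP => hi; apply: h; exists i.
(* Applying (Y_i - eig mu i) / u(lam) kills [e mu] and keeps the coefficient of [e lam]. *)
pose u nu := eig s q nu i - eig s q mu i.
apply: (IH (fun nu => (u lam)^-1 * (u nu * c nu))) => //.
  move=> nu nurs; apply: KM; first by apply: KV; apply: KB.
  by apply: KM; [apply: KB | apply: Kc; rewrite in_cons nurs orbT].
have Yu (x : F) nu : Yop s q i (x *: e nu) - eig s q mu i *: (x *: e nu) = (u nu * x) *: e nu.
  have [_ _ h] := he nu; rewrite linearZ /= h.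
  by rewrite !scalerA -scalerBl mulrBl [x * _]mulrC.
have := WZ (u lam)^-1 _ (KV (KB (K_eig lam i) (K_eig mu i))) (WB _ _ (WY i _ Wf) (WZ _ _ (K_eig mu i) Wf)).
congr W; pose D f := Yop s q i f - eig s q mu i *: f; rewrite -[X in _ *: X = _]/(D _).
have DD f g : D (f + g) = D f + D g by rewrite /D linearD scalerDr opprD addrACA.
have D0 : D 0 = 0 by rewrite /D linear0 scaler0 subrr.
rewrite !DD [D (c mu *: _)]Yu [u mu]subrr mul0r scale0r add0r scalerDr.
rewrite [D (b *: _)]Yu scalerA mulKf //; congr (_ + _).
have -> : D (\sum_(nu <- rs) c nu *: e nu) = \sum_(nu <- rs) D (c nu *: e nu).
  exact: (big_morph D DD D0).
by rewrite scaler_sumr; apply: eq_bigr => nu _; rewrite [D _]Yu scalerA.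
Qed.

Lemma vanishing_sum (ls : seq expo) (c : expo -> F) :
  uniq ls -> (forall mu, mu \in ls -> K (c mu)) -> vanishing (\sum_(mu <- ls) c mu *: e mu) ->
  forall lam, lam \in ls -> S_ lam -> c lam = 0.
Proof.
move=> uls Kc hv lam lamls Slam.
have vl : vanishing (c lam *: e lam).
  apply: (isolate vanishingB) (uls) Kc hv lamls; last by move=> i f; apply: vanishing_Yop.
  by move=> x f _; apply: vanishingZ.
have : ev (c lam *: e lam) (zpt 1 0) = 0.
  by apply: vl; apply/ZP; exists 1, 0; split; rewrite ?oner_eq0 //; apply: thin_0.
have [_ /(_ Slam)] := ev_e_zpt0 nd d0 lattice he lam (oner_neq0 F).
by rewrite evZ => ne /eqP; rewrite mulf_eq0 (negPf ne) orbF => /eqP.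
Qed.

Lemma vanishing_e lam : ~ S_ lam -> vanishing (e lam).
Proof.
move=> nS z /ZP[c [mu [_ c0 hmu hz]]]; rewrite (eq_ev _ hz).
by apply: (ev_e_zpt nd d0 lattice he c0) nS; apply: thin_S.
Qed.

(** Repeated weights are allowed, which makes closure under sums immediate; [Kspan_sum] merges them
    afterwards. *)
Inductive Kspan : LP -> Prop :=
| Kspan0 : Kspan 0
| Kspan_add c lam f : K c -> Kspan f -> Kspan (c *: e lam + f).

Lemma Kspan_e lam : Kspan (e lam).
Proof. by rewrite -[e lam]addr0 -[e lam]scale1r; apply: Kspan_add => //; apply: Kspan0. Qed.

Lemma KspanD f g : Kspan f -> Kspan g -> Kspan (f + g).
Proof.
by move=> hf hg; elim: hf => [|c lam f' Kc _ IH]; rewrite ?add0r // -addrA; apply: Kspan_add.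
Qed.

Lemma KspanZ c f : K c -> Kspan f -> Kspan (c *: f).
Proof.
move=> Kc; elim=> [|b lam f' Kb _ IH]; first by rewrite scaler0; apply: Kspan0.
by rewrite scalerDr scalerA; apply: Kspan_add => //; apply: KM.
Qed.

Lemma Kspan_linear (A : {linear LP -> LP}) :
  (forall lam, Kspan (A (e lam))) -> forall f, Kspan f -> Kspan (A f).
Proof.
move=> hA f; elim=> [|b lam f' Kb _ IH]; first by rewrite linear0; apply: Kspan0.
by rewrite linearD linearZ; apply: KspanD => //; apply: KspanZ.
Qed.

Lemma Kspan_Top j f : (j < k)%N -> Kspan f -> Kspan (Top s j f).
Proof.
move=> hj; apply: Kspan_linear => lam /=.
case: (ltgtP (lam (inord j)) (lam (inord j.+1))) => h.
- rewrite (Top_e_up nd he) // -scaleNr; apply: KspanD; apply: KspanZ; try exact: Kspan_e; first exact: Ks.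
  by apply: KN; apply: K_cc.
- have h' : sw_expo j lam (inord j) < sw_expo j lam (inord j.+1) by rewrite sw_l // sw_r.
  have := Top_e_down nd he hj h'; rewrite swK // => ->.
  have Kb : K (s - s^-1 + cc (sw_expo j lam) j) by apply: KD.
  apply: KspanD; apply: KspanZ => //; try exact: Kspan_e.
  by apply: KM; [apply: KV | apply: KB => //; apply: KM].
- by rewrite (Top_e_eq nd he) //; apply: KspanZ => //; apply: Kspan_e.
Qed.

Lemma Kspan_Tinv j f : (j < k)%N -> Kspan f -> Kspan (Tinv s j f).
Proof.
move=> hj hf; rewrite /Tinv -scaleNr; apply: KspanD; first exact: Kspan_Top.
by apply: KspanZ => //; apply: KN.
Qed.

Lemma foldr_TopK g (r : seq nat) : (forall j, j \in r -> (j < k)%N) ->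
  foldr (fun j g => Tinv s j g) (foldr (fun j g => Top s j g) g r) (rev r) = g.
Proof.
elim: r => [//|j r IH] h; rewrite rev_cons foldr_rcons /= T'K; last by apply: h; apply: mem_head.
by apply: IH => m mr; apply: (h); rewrite in_cons mr orbT.
Qed.

Lemma iota0_ltn j : j \in iota 0 k -> (j < k)%N.
Proof. by rewrite mem_iota. Qed.

(** Stability under [omega] thus follows from stability under the first Y-operator and the inverse
    T_j. *)
Lemma omega_Yop f : omega q f = foldr (fun j g => Tinv s j g) (Yop s q ord0 f) (rev (iota 0 k)).
Proof. by rewrite /Yop /= subn0 foldr_TopK //; apply: iota0_ltn. Qed.

Lemma omegainv_Yinv f : omegainv q f = Yinv s q ord0 (foldr (fun j g => Top s j g) f (iota 0 k)).
Proof. by rewrite /Yinv /= subn0 foldr_TopK //; apply: iota0_ltn. Qed.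

Lemma Kspan_omega f : Kspan f -> Kspan (omega q f).
Proof.
move=> hf; rewrite omega_Yop; apply: (foldr_closed (P := Kspan) (A := fun j => Tinv s j)).
  by move=> j g; rewrite mem_rev => /iota0_ltn; apply: Kspan_Tinv.
apply: Kspan_linear hf => lam /=; have [_ _ ->] := he lam.
by apply: KspanZ => //; apply: Kspan_e.
Qed.

(** The first Y-operator is onto the span, because it is diagonal there with nonzero eigenvalues in
    K. *)
Lemma Kspan_omegainv f : Kspan f -> Kspan (omegainv q f).
Proof.
have Y_surj g : Kspan g -> exists2 h, Kspan h & Yop s q ord0 h = g.
  elim=> [|b lam f' Kb _ [h hh <-]]; first by exists 0; [apply: Kspan0 | rewrite linear0].
  exists (b / eig s q lam ord0 *: e lam + h).
    by apply: Kspan_add => //; apply: KM => //; apply: KV.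
  have [_ _ he'] := he lam.
  by rewrite linearD linearZ /= he' scalerA divfK //; apply: (eig_neq0 nd).
move=> hf; have [|h hh e1] := Y_surj (foldr (fun j g => Top s j g) f (iota 0 k)).
  apply: (foldr_closed (P := Kspan) (A := fun j => Top s j)) => // j g /iota0_ltn.
  exact: Kspan_Top.
have := omega_Yop h; rewrite e1 foldr_TopK; last exact: iota0_ltn.
by move=> <-; rewrite (omegaK ch0 q0).
Qed.

Lemma PiLinv_e lam : PiLinv q (e (pie lam)) = q ^ (- lam ord0) *: e lam.
Proof.
have /esym := PiLK nd (e lam); rewrite (Pi_e nd he).
have -> : PiLinv q (q ^ lam ord0 *: e (pie lam)) = q ^ lam ord0 *: PiLinv q (e (pie lam)).
  by rewrite /PiLinv !linearZ.
by move=> ->; rewrite scalerA -expfzDr // addNr expr0z scale1r.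
Qed.

(** Write X_k as (X_k omega) omega^-1: the first factor permutes the eigenvectors up to powers of
    q. *)
Lemma Kspan_Xop_last f : Kspan f -> Kspan (Xop (inord k) f).
Proof.
move/Kspan_omegainv; rewrite -{2}(omegainvK ch0 q0 f); move: (omegainv q f) => g.
rewrite -[X in _ -> Kspan X]/((Xop (inord k) \o omega q) g).
apply: Kspan_linear => lam /=; rewrite -/(PiL q (e lam)) (Pi_e nd he).
by apply: KspanZ; [apply: KXz | apply: Kspan_e].
Qed.

Lemma Kspan_Xinv_last f : Kspan f -> Kspan (Xinv (inord k) f).
Proof.
move=> hf; rewrite -(omegainvK ch0 q0 (Xinv _ f)); apply: Kspan_omega.
rewrite -[X in Kspan X]/((omegainv q \o Xinv (inord k)) f).
move: f hf; apply: Kspan_linear => lam /=; rewrite -/(PiLinv q (e lam)) -(pieinvK lam) PiLinv_e.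
by apply: KspanZ; [apply: KXz | apply: Kspan_e].
Qed.

Lemma Kspan_X i f : Kspan f -> Kspan (Xop i f) /\ Kspan (Xinv i f).
Proof.
suff main m : (m <= k)%N -> forall f, Kspan f ->
    Kspan (Xop (inord (k - m)) f) /\ Kspan (Xinv (inord (k - m)) f).
  have hi : (val i < n)%N := ltn_ord i; have := main (k - i)%N (leq_subr _ _) f.
  by rewrite subKn ?inord_val.
elim: m => [|m IH] hm {}f hf; first by rewrite subn0; split; [exact: Kspan_Xop_last | exact: Kspan_Xinv_last].
have hj : (k - m.+1 < k)%N by lia.
have {IH} := IH ltac:(lia); rewrite (_ : (k - m = (k - m.+1).+1)%N); last by lia.
move: (k - m.+1)%N hj => j hj IH.
have XE g : Xop (inord j) g = Tinv s j (Xop (inord j.+1) (Tinv s j g)).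
  by rewrite -(TXT ch0 s0) // TK // T'K.
have XiE g : Xinv (inord j) g = Top s j (Xinv (inord j.+1) (Top s j g)).
  have {1}-> : g = Xop (inord j) (Top s j (Xinv (inord j.+1) (Top s j g))).
    by rewrite XE T'K // (XinvK ch0) T'K.
  by rewrite (XopK ch0).
split; first by rewrite XE; apply: Kspan_Tinv => //; apply: (IH _ _).1; apply: Kspan_Tinv.
by rewrite XiE; apply: Kspan_Top => //; apply: (IH _ _).2; apply: Kspan_Top.
Qed.

Lemma mono_ind (P : LP -> Prop) : P (mono F 0) ->
  (forall i f, P f -> P (Xop i f) /\ P (Xinv i f)) -> forall a : expo, P (mono F a).
Proof.
move=> P0 PX a; have [m] : exists m : nat, (\sum_i `|a i| <= m)%N by eexists.
elim: m a => [|m IH] a ha.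
  suff -> : a = 0 by [].
  apply/ffunP => i; rewrite ffunE; apply/eqP; rewrite -absz_eq0 -leqn0.
  by apply: leq_trans ha; rewrite (bigD1 i) //= leq_addr.
have [->//|/eqP/ffunP a0] := eqVneq a 0.
have [i ai] : exists i, a i != 0.
  apply: Classical_Prop.NNPP => h; apply: a0 => i; rewrite ffunE; apply/eqP.
  by apply/negPn/negP => hi; apply: h; exists i.
have small (x : int) : (absz (a i + x)%R < absz (a i))%N -> P (mono F (ebump a i x)).
  move=> hx; apply: IH; rewrite -ltnS; apply: leq_trans ha.
  rewrite (bigD1 i) //= [X in (_ < X)%N](bigD1 i) //= ffunE eqxx -addSn leq_add //.
  by apply: leq_sum => p /negPf pi; rewrite ffunE pi.
have bumpK (x y : int) : x + y = 0 -> ebump (ebump a i x) i y = a.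
  move=> xy; apply/ffunP => p; rewrite !ffunE; case: eqP => [->|//]; rewrite ?eqxx.
  by rewrite -addrA xy addr0.
have [pos|neg] := ltrP 0 (a i).
  have <- : Xop i (mono F (ebump a i (-1))) = mono F a by rewrite /Xop linext_mono bumpK.
  by apply: (PX _ _ _).1; apply: small; lia.
have <- : Xinv i (mono F (ebump a i 1)) = mono F a by rewrite /Xinv linext_mono bumpK.
by apply: (PX _ _ _).2; apply: small; move: ai neg; lia.
Qed.

(** V is generated from 1 by the X operators. This serves twice: for the span of the eigenvectors
    and for a subrepresentation that contains 1. *)
Lemma mono_span (P : LP -> Prop) f : (forall a, K f@_a) -> P (mono F 0) ->
  (forall f g, P f -> P g -> P (f + g)) -> (forall c f, K c -> P f -> P (c *: f)) ->
  (forall i f, P f -> P (Xop i f) /\ P (Xinv i f)) -> P f.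
Proof.
move=> Kf P0 PD PZ PX; rewrite (LP_monoE f).
have P0' : P 0 by rewrite -(scale0r (mono F (0 : expo))); apply: PZ.
by apply: (big_ind P) => // a _; apply: PZ => //; apply: mono_ind.
Qed.

Lemma Kspan_sum f : Kspan f -> exists (ls : seq expo) (c : expo -> F),
  [/\ uniq ls, forall lam, K (c lam) & f = \sum_(lam <- ls) c lam *: e lam].
Proof.
elim=> [|b lam g Kb _ [ls [c [uls Kc ->]]]]; first by exists [::], (fun=> 0); rewrite big_nil.
pose ls' := rem lam ls; pose cl := if lam \in ls then c lam else 0.
exists (lam :: ls'), (fun mu => if mu == lam then b + cl else c mu); split.
- by rewrite /= rem_uniq // mem_rem_uniq // inE eqxx.
- by move=> mu; case: eqP => // _; apply: KD => //; rewrite /cl; case: ifP.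
rewrite big_cons eqxx scalerDl -addrA; congr (_ + _).
have -> : \sum_(mu <- ls') (if mu == lam then b + cl else c mu) *: e mu =
          \sum_(mu <- ls') c mu *: e mu.
  apply: eq_big_seq => mu.
  by rewrite /ls' mem_rem_uniq // inE => /andP[/negPf ->].
rewrite /ls' /cl; case: ifP => h; first by rewrite (big_rem lam h).
by rewrite scale0r add0r rem_id // h.
Qed.

Lemma spanning f : (forall a, K f@_a) -> exists (ls : seq expo) (c : expo -> F),
  [/\ uniq ls, forall lam, K (c lam) & f = \sum_(lam <- ls) c lam *: e lam].
Proof.
move=> Kf; apply: Kspan_sum; apply: mono_span Kf _ KspanD _ Kspan_X.
  by rewrite -(e_0 nd he); apply: Kspan_e.
by move=> c g; apply: KspanZ.
Qed.

(** * Descent to the constant polynomial in a subrepresentation *)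

Section Irreducible.
Variable W : LP -> Prop.
Hypothesis WD : forall f g, W f -> W g -> W (f + g).
Hypothesis WZ : forall c f, K c -> W f -> W (c *: f).
Hypothesis WT : forall j f, (j < k)%N -> W f -> W (Top s j f).
Hypothesis WX : forall i f, W f -> W (Xop i f) /\ W (Xinv i f).
Hypothesis WY : forall i f, W f -> W (Yop s q i f).
Hypothesis WYi : forall i f, W f -> W (Yinv s q i f).

Let WB f g : W f -> W g -> W (f - g).
Proof. by move=> hf hg; apply: WD => //; rewrite -scaleN1r; apply: WZ => //; apply: KN. Qed.

Let WT' j f : (j < k)%N -> W f -> W (Tinv s j f).
Proof. by move=> hj hf; apply: WB; [apply: WT | apply: WZ]. Qed.

Let W_unscale c f : K c -> c != 0 -> W (c *: f) -> W f.
Proof. by move=> Kc c0 /(WZ (KV Kc)); rewrite scalerA mulVf // scale1r. Qed.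

Let W_omega f : W f -> W (omega q f).
Proof.
move=> hf; rewrite omega_Yop; apply: (foldr_closed (P := W) (A := fun j => Tinv s j)).
  by move=> j g; rewrite mem_rev => /iota0_ltn; apply: WT'.
exact: WY.
Qed.

Let W_omegainv f : W f -> W (omegainv q f).
Proof.
move=> hf; rewrite omegainv_Yinv; apply: WYi.
apply: (foldr_closed (P := W) (A := fun j => Top s j)) => // j g /iota0_ltn.
exact: WT.
Qed.

Lemma subrep_e0 lam : S_ lam -> W (e lam) -> W (mono F 0).
Proof.
elim/(@expo_ind k): lam => [_|lam IH|lam IH|lam j hj lt IH].
- by rewrite (e_0 nd he).
- move=> Sl hW; apply: IH; first exact: (S_pie nd d0 _).1 Sl.
  have := W_omegainv (WX (inord k) hW).2; rewrite -[omegainv _ _]/(PiLinv q _) PiLinv_e.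
  by move/W_unscale; apply; [apply: KXz | apply: expfz_neq0].
- move=> Sl hW; apply: IH; first exact: (S_pie nd d0 _).2 Sl.
  have := (WX (inord k) (W_omega hW)).1; rewrite -[Xop _ _]/(PiL q _) (Pi_e nd he).
  by move/W_unscale; apply; [apply: KXz | apply: expfz_neq0].
move=> /(S_sw nd d0 hj lt)[Sl nw] hW; apply: IH => //.
have Kb : K (s - s^-1 + cc lam j) by apply: KD.
(* Removing the component along the current eigenvector from its image under T_j leaves a multiple
   of [e lam], which is nonzero because the swap stays inside S. *)
have := WB (WT hj hW) (WZ Kb hW); rewrite (Top_e_down nd he hj lt) addrK.
move/W_unscale; apply; first by apply: KM; [apply: KV | apply: KB => //; apply: KM].
have [-> ne] := icoef_neq_sV nd d0 hj lt.
rewrite mulf_neq0 ?invr_eq0 // oppr_eq0 mulf_neq0 //.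
by rewrite (wall nd d0 lattice hj lt Sl); apply/eqP.
Qed.

Lemma irreducible f : (forall a, K f@_a) -> W f -> ~ vanishing f ->
  forall g, (forall a, K g@_a) -> W g.
Proof.
move=> Kf Wf nv g Kg; have [ls [c [uls Kc ef]]] := spanning Kf.
have [lam [lamls Sl cl]] : exists lam, [/\ lam \in ls, S_ lam & c lam != 0].
  apply: Classical_Prop.NNPP => h; apply: nv; rewrite ef big_seq.
  apply: (big_ind vanishing); first by move=> z _; rewrite ev0.
    by move=> f1 f2 h1 h2 z hz; rewrite evD h1 ?h2 // addr0.
  move=> lam lamls; have [c0|c0] := eqVneq (c lam) 0.
    by move=> z _; rewrite c0 scale0r ev0.
  by apply: vanishingZ; apply: vanishing_e => Sl; apply: h; exists lam.
apply: mono_span WD WZ WX => //; apply: (subrep_e0 Sl); apply: (W_unscale (Kc lam) cl).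
by rewrite ef in Wf; apply: (isolate WB WZ WY uls _ Wf lamls).
Qed.

End Irreducible.

End Quotient.

(** * Application to the specialized family and the field K *)

Section Concrete.
Variables (k r : nat).
Hypothesis hk : leq 1 k.
Hypothesis hr : leq 2 r.
Local Notation n := k.+1.
Local Notation d := (r - 1)%N.
Local Notation expo := (expo n).
Local Notation e := (Ebar k r).
Local Notation inZ := (@inZ k r n).
Local Notation inI := (@inI k r n).
Local Notation inV := (@inV k r n).
Implicit Types (lam : expo) (ls : seq expo) (c : expo -> Lf) (f g : LP Lf n).

Local Opaque sL qL Defs.inK Defs.is_spec.

Let nd := qt_generic_Lf hk hr.
Let lat := lattice hk hr.
Let he lam : isEg (sL k r) (qL k r) lam (e lam) := (E_specialized hk hr lam).1.
Let d0 : (0 < d)%N. Proof. lia. Qed.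
Let ZP z : inZ z <-> exists (x : Lf) (mu : expo),
  [/\ inK k r x, x != 0, @thin k d mu & z =1 zpt (sL k r) (qL k r) x mu].
Proof.
split; first exact: (inZ_zpt hk hr).
move=> [c [mu [cK c0 hmu hz]]]; have [h1 [idx [sa [h2 [h3 h4]]]]] := zpt_inZ hk hr cK c0 hmu.
split; first by move=> i; rewrite hz.
by exists idx, sa; do 2!split=> //; move=> a; rewrite !hz; apply: h4.
Qed.

Lemma inI_vanishing f : inI f <-> inV f /\ vanishing inZ f.
Proof. by []. Qed.

Lemma inV_sum ls c : (forall lam, lam \in ls -> inK k r (c lam)) ->
  inV (\sum_(lam <- ls) c lam *: e lam).
Proof.
move=> cK a; rewrite mcoeff_sum big_seq; apply: inK_sum => lam /cK h.
by rewrite mcoeffZ; apply: inKM h (inV_Ebar hk hr lam a).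
Qed.

Lemma Ebar_independent ls c : uniq ls ->
  (forall lam, lam \in ls -> inS k r lam /\ inK k r (c lam)) ->
  inI (\sum_(lam <- ls) c lam *: e lam) -> forall lam, lam \in ls -> c lam = 0.
Proof.
move=> uls hls /inI_vanishing[_ hv] lam lamls.
apply: (vanishing_sum nd d0 lat he (inK1 k r) (@inKB k r) (@inKM k r) (@inKV k r)
  (inK_s k r) (inK_q k r) ZP uls _ hv lamls); first by move=> mu /hls[].
by apply/(inS_S hk hr); case: (hls lam lamls).
Qed.

Lemma Ebar_span f : inV f -> exists ls c,
  (forall lam, lam \in ls -> inS k r lam /\ inK k r (c lam)) /\
  inI (f - \sum_(lam <- ls) c lam *: e lam).
Proof.
move=> fV; have [ls [c [uls cK ef]]] := spanning nd d0 he (inK1 k r) (@inKB k r)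
  (@inKM k r) (@inKV k r) (inK_s k r) (inK_q k r) fV.
pose S lam : bool := ClassicalEpsilon.excluded_middle_informative (inS k r lam).
have SP lam : reflect (inS k r lam) (S lam).
  by rewrite /S; case: ClassicalEpsilon.excluded_middle_informative => h; constructor.
exists [seq lam <- ls | S lam], c; split.
  by move=> lam; rewrite mem_filter => /andP[/SP].
split.
  by move=> a; rewrite mcoeffB; apply: inKB (fV a) (inV_sum _ a) => lam _.
suff van : vanishing inZ (f - \sum_(lam <- [seq lam <- ls | S lam]) c lam *: e lam) by exact: van.
rewrite big_filter {1}ef (bigID S) /= addrAC subrr add0r.
apply: (big_ind (vanishing inZ)) => [z _|f1 f2 h1 h2 z hz|lam nS].
- exact: ev0.
- by rewrite evD h1 ?h2 // addr0.
apply: vanishingZ; apply: (vanishing_e nd d0 lat he ZP).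
by move/(inS_S hk hr) => /SP; apply/negP.
Qed.

Lemma quotient_irreducible_top : quotient_irreducible k r n.
Proof.
have inV1 : inV (mono Lf 0).
  by move=> a; rewrite mcoeff_mono; case: eqP => _; [apply: inK1 | apply: inK0].
split.
  exists (mono Lf 0); split=> // /inI_vanishing[_ hv].
  have : ev (mono Lf (0 : expo)) (zpt (sL k r) (qL k r) 1 0) = 0.
    apply: hv; apply/ZP; exists 1, 0; split=> //; [exact: inK1|exact: oner_neq0|].
    exact: thin_0.
  rewrite ev_mono => /eqP; apply/negP; apply: monoval_neq0 => i.
  by apply: (zpt_neq0 nd); apply: oner_neq0.
move=> W [_ [WV [WD [WZ [WX WT]]]]].
have [h|nh] := Classical_Prop.classic (forall f, W f -> inI f); [by left | right].
have [f Wf nI] : exists2 f, W f & ~ inI f.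
  by apply: Classical_Prop.NNPP => h; apply: nh => f Wf; apply: Classical_Prop.NNPP => nI;
    apply: h; exists f.
have nv : ~ vanishing inZ f by move=> hv; apply: nI; split; [exact: WV | exact: hv].
move=> g gV; apply: (irreducible nd d0 lat he (inK1 k r) (@inKB k r) (@inKM k r)
  (@inKV k r) (inK_s k r) (inK_q k r) ZP WD WZ) (WV f Wf) Wf nv g gV.
- by move=> j f1 hj; apply: WT.
- by move=> i f1 /(WX i)[].
- by move=> i f1 /(WX i)[].
- by move=> i f1 /(WX i)[].
Qed.

End Concrete.

(* n = k + 1 (so k = n - 1), r >= 2. *)
Theorem theorem6p2 (k r : nat) (hk : leq 1 k) (hr : leq 2 r) :
  (* E_lambda has no pole at (star), for lambda in S^{(n-1,r)} *)
  (forall lam : expo k.+1, inS k r lam -> forall a : expo k.+1, regular k r (E lam)@_a)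
  /\
  (* the classes of the specialized E_lambda are K-linearly independent in V/I *)
  (forall (ls : seq (expo k.+1)) (c : expo k.+1 -> Lf),
      uniq ls ->
      (forall lam, lam \in ls -> inS k r lam /\ inK k r (c lam)) ->
      inI k r (\sum_(lam <- ls) c lam *: Ebar k r lam) ->
      forall lam, lam \in ls -> c lam = 0)
  /\
  (* ... and span V/I over K *)
  (forall f : LP Lf k.+1, inV k r f ->
      exists (ls : seq (expo k.+1)) (c : expo k.+1 -> Lf),
        (forall lam, lam \in ls -> inS k r lam /\ inK k r (c lam)) /\
        inI k r (f - \sum_(lam <- ls) c lam *: Ebar k r lam))
  /\
  (* V/I is an irreducible representation of H_n^{(n-1,r)} *)
  quotient_irreducible k r k.+1.
Proof.
split; first by move=> lam _ a; apply: E_regular.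
split; first exact: Ebar_independent.
split; [exact: Ebar_span | exact: quotient_irreducible_top].
Qed.
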